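(* Let $k\in(1,+\infty]$, $A\in[0,+\infty)$, let $E$ be a complex Banach space such that $E'$ is separable, and let $(\mathcal{P}_\Theta({}^{m}E))_{m=0}^\infty$ be a $\pi_1$-holomorphy type from $E$ to $\mathbb{C}$ with canonical constants. Then every nontrivial convolution operator on $Exp_{\Theta,0,A}^{k}(E)$ is mixing, and thus in particular hypercyclic.
   Context: $E$ is a complex Banach space, $E'$ its topological dual, $\mathbb{N}_0=\mathbb{N}\cup\{0\}$. $\mathcal{P}({}^jE)$ is the Banach space of continuous $j$-homogeneous polynomials $E\to\mathbb{C}$ with the sup norm on the unit ball; $\mathcal{P}_f({}^jE)$ is the span of $\{\phi^j:\phi\in E'\}$; $\mathcal H(U)$ is the space of holomorphic functions on an open set $U\subset E$. If $f(x)=\sum_m P_m(x-a)$ is the Taylor expansion of $f$ at $a$, then $\hat d^m f(a)=m!P_m$. $B_r(0)$ is the open ball of center $0$ and radius $r$, with $B_{1/0}(0)=E$. A holomorphy type $\Theta$ from $E$ to $\mathbb C$ is a sequence of Banach spaces $(\mathcal P_\Theta({}^jE))_{j=0}^\infty$, with norms denoted $\|\cdot\|_\Theta$, such that: (1) each $\mathcal P_\Theta({}^jE)$ is a vector subspace of $\mathcal P({}^jE)$, and $\mathcal P_\Theta({}^0E)=\mathbb C$ as a normed space; (2) there is $\sigma\ge 1$ such that for all $k\le j$ in $\mathbb N_0$, $a\in E$ and $P\in\mathcal P_\Theta({}^jE)$, one has $\hat d^kP(a)\in\mathcal P_\Theta({}^kE)$ and $\|\frac1{k!}\hat d^kP(a)\|_\Theta\le\sigma^j\|P\|_\Theta\|a\|^{j-k}$.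 It has canonical constants if the inequality in (2) holds with $\frac{j!}{k!(j-k)!}$ in place of $\sigma^j$, for all $k\le j$ in $\mathbb N_0$. $\Theta$ is a $\pi_1$-holomorphy type if: (i) $\mathcal P_f({}^jE)\subset\mathcal P_\Theta({}^jE)$ and there is $K>0$ such that $\|b\,\phi^j\|_\Theta\le K^j\|\phi\|^j|b|$ for all $\phi\in E'$, $b\in\mathbb C$, $j\in\mathbb N_0$; (ii) $\mathcal P_f({}^jE)$ is dense in $(\mathcal P_\Theta({}^jE),\|\cdot\|_\Theta)$ for every $j$. For $k\in[1,+\infty)$ and $A\in[0,\infty)$, $Exp_{\Theta,0,A}^k(E)$ is the space of all $f\in\mathcal H(E)$ with $\hat d^jf(0)\in\mathcal P_\Theta({}^jE)$ for all $j\in\mathbb N_0$ and $\|f\|_{\Theta,k,\rho}=\sum_{j=0}^\infty\rho^{-j}\left(\frac{j}{ke}\right)^{j/k}\left\|\frac1{j!}\hat d^jf(0)\right\|_\Theta<\infty$ for all $\rho>A$ (the weight being $1$ for $j=0$), with the topology given by the norms $\|\cdot\|_{\Theta,k,\rho}$, $\rho>A$. For $k=+\infty$, $Exp_{\Theta,0,A}^\infty(E)$ is the space of all $f\in\mathcal H(B_{1/A}(0))$ with $\hat d^jf(0)\in\mathcal P_\Theta({}^jE)$ for all $j$ and $\limsup_{j\to\infty}\|\frac1{j!}\hat d^jf(0)\|_\Theta^{1/j}\le A$, with the topology given by the seminorms $p^\infty_{\Theta,\rho}(f)=\sum_j\rho^{-j}\|\frac1{j!}\hat d^jf(0)\|_\Theta$,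 $\rho>A$. These are Fréchet spaces. When $\Theta$ has canonical constants, the function $df(\cdot)a: x\mapsto\hat d^1f(x)(a)$ belongs to $Exp_{\Theta,0,A}^k(E)$ for all $f\in Exp_{\Theta,0,A}^k(E)$ and $a\in E$; a convolution operator on $Exp_{\Theta,0,A}^k(E)$ is a continuous linear map $L$ of $Exp_{\Theta,0,A}^k(E)$ into itself such that $d(Lf)(\cdot)a=L(df(\cdot)a)$ for all $a\in E$ and $f\in Exp_{\Theta,0,A}^k(E)$. It is nontrivial if it is not a scalar multiple of the identity. A continuous linear operator $T:X\to X$ on a topological vector space is mixing if for any non-empty open sets $U,V\subset X$ there is $n_0\in\mathbb N$ with $T^n(U)\cap V\ne\emptyset$ for all $n\ge n_0$; it is hypercyclic if $\{x,T(x),T^2(x),\dots\}$ is dense in $X$ for some $x\in X$. *)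

(* Defs.v *)
From HB Require Import structures.
From mathcomp Require Import all_boot all_order all_algebra.
From mathcomp Require Import all_classical all_reals all_analysis.
From mathcomp Require Import complex ring.
Set Implicit Arguments.
Unset Strict Implicit.
Unset Printing Implicit Defensive.
Import Order.TTheory GRing.Theory Num.Theory numFieldNormedType.Exports.
Local Open Scope classical_set_scope.
Local Open Scope ring_scope.
Local Open Scope complex_scope.

Section TopologicalDynamics.
Variable X : topologicalType.

Definition mixing (T : X -> X) : Prop :=
  forall U V : set X, open U -> open V -> U !=set0 -> V !=set0 ->
  exists n0 : nat, forall n, (n0 <= n)%N -> (iter n T @` U) `&` V !=set0.

Definition hypercyclic (T : X -> X) : Prop :=
  exists x : X, dense (range (fun n => iter n T x)).

End TopologicalDynamics.

Section Norm.
Variables (R : realType) (V : normedZmodType R[i]).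

(* The library norm of a complex normed space takes its (real) values in R[i];
   nrm is the same norm with values in R, see nrmE. *)
Definition nrm (x : V) : R := complex.Re `|x|.

Lemma nrmE (x : V) : (nrm x)%:C = `|x|.
Proof.
have : 0 <= `|x| by exact: normr_ge0.
rewrite /nrm; case: `|x| => a b; rewrite lecE /= => /andP[/eqP b0 _].
by rewrite /real_complex_def b0.
Qed.

End Norm.

Section Polynomials.
Variables (R : realType) (E : completeNormedModType R[i]).
Local Notation C := (R[i]^o).

(* B : ('I_j -> E) -> C is a (not necessarily symmetric) j-linear form *)
Definition multilinear_form (j : nat) (B : ('I_j -> E) -> C) : Prop :=
  forall (x : 'I_j -> E) (i : 'I_j),
    linear (fun u : E => B (@dfwith _ (fun=> E) x i u) : C).

Definition hompoly (j : nat) : set (E -> C) := [set P |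
  continuous P /\
  exists2 B : ('I_j -> E) -> C, multilinear_form B & P = fun x => B (fun=> x)].

Definition dual : set (E -> C) := [set phi : E -> C | linear phi /\ continuous phi].

Definition dual_norm (phi : E -> C) : R :=
  sup [set nrm (phi x) | x in [set x : E | nrm x <= 1]].

Definition dual_separable : Prop :=
  exists D : set (E -> C), [/\ D `<=` dual, countable D &
    forall phi, dual phi -> forall e : R, 0 < e ->
      exists2 psi, D psi & dual_norm (phi - psi) < e].

Definition hompolyf (j : nat) : set (E -> C) := [set P |
  exists (n : nat) (c : 'I_n -> C) (phi : 'I_n -> E -> C),
    (forall i, dual (phi i)) /\ P = fun x => \sum_(i < n) c i * phi i x ^+ j].

End Polynomials.

Section Holomorphy.
Variables (R : realType) (E : completeNormedModType R[i]).
Local Notation C := (R[i]^o).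
Implicit Types (f : E -> C) (a : E) (P : nat -> E -> C).

Definition is_taylor f a P : Prop :=
  (forall m, hompoly m (P m)) /\
  exists2 r : R, 0 < r &
    {uniform ball a r%:C,
      (fun n x => \sum_(m < n) P m (x - a)) @ \oo --> f}.

Definition holomorphic (U : set E) f : Prop :=
  forall a, U a -> exists P, is_taylor f a P.

(* The sequence (P_m)_m of the Taylor expansion of f at a, which is unique by
   is_taylor_unique below (and the zero sequence if there is no expansion). *)
Definition taylor f a : nat -> E -> C := xget (fun=> fun=> 0) (is_taylor f a).

Definition hdiff (m : nat) f a : E -> C := fun x => m`!%:R * taylor f a m x.

End Holomorphy.

Section HolomorphyTypes.
Variables (R : realType) (E : completeNormedModType R[i]).
Local Notation C := (R[i]^o).

(* V is a vector subspace of E -> C on which N is a complete norm *)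
Definition banach_subspace (V : set (E -> C)) (N : (E -> C) -> R) : Prop :=
  [/\ submod_closed (mem V : {pred E -> C}),
      forall P, V P -> N P = 0 -> P = 0,
      forall P Q, V P -> V Q -> N (P + Q) <= N P + N Q,
      forall (c : C) P, V P -> N (c *: P) = nrm c * N P &
      forall P_ : nat -> E -> C, (forall n, V (P_ n)) ->
        (forall e : R, 0 < e -> exists n0, forall m n,
           (n0 <= m)%N -> (n0 <= n)%N -> N (P_ m - P_ n) < e) ->
        exists2 P, V P & (fun n => N (P_ n - P)) @ \oo --> (0 : R)].

Definition derivative_estimate (V : nat -> set (E -> C))
    (N : nat -> (E -> C) -> R) (c : nat -> nat -> R) : Prop :=
  forall k j, (k <= j)%N -> forall (a : E) (P : E -> C), V j P ->
    V k (hdiff k P a) /\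
    N k ((k`!%:R : C)^-1 *: hdiff k P a) <= c j k * N j P * nrm a ^+ (j - k).

Record holomorphy_type := HolomorphyType {
  hspace : nat -> set (E -> C) ;
  hnorm : nat -> (E -> C) -> R ;
  hspace_banach : forall j, banach_subspace (hspace j) (hnorm j) ;
  hspace_hompoly : forall j, hspace j `<=` hompoly j ;
  hspace0 : hspace 0 = [set cst c | c in [set: C]] ;
  hnorm0 : forall c : C, hnorm 0 (cst c) = nrm c ;
  hspace_hdiff : exists2 sigma : R, 1 <= sigma &
    derivative_estimate hspace hnorm (fun j _ => sigma ^+ j) }.

Variable Theta : holomorphy_type.

Definition canonical_constants : Prop :=
  derivative_estimate (hspace Theta) (hnorm Theta)
    (fun j k => j`!%:R / (k`!%:R * (j - k)`!%:R)).

Definition pi1_holomorphy_type : Prop :=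
  [/\ forall j, hompolyf j `<=` hspace Theta j,
      exists2 K : R, 0 < K &
        forall (phi : E -> C) (b : C) (j : nat), dual phi ->
          hnorm Theta j (fun x => b * phi x ^+ j)
            <= K ^+ j * dual_norm phi ^+ j * nrm b &
      forall j P, hspace Theta j P -> forall e : R, 0 < e ->
        exists2 Q, hompolyf j Q & hnorm Theta j (P - Q) < e].

End HolomorphyTypes.

Section ExpSpace.
Variables (R : realType) (E : completeNormedModType R[i]).
Variables (Theta : holomorphy_type E) (k : \bar R) (A : {nonneg R}).
Local Notation C := (R[i]^o).
Implicit Types (f g : E -> C) (rho : R).

Definition taylor_norm f (j : nat) : R :=
  hnorm Theta j ((j`!%:R : C)^-1 *: hdiff j f 0).

(* In the definitions by cases on k below, the first case is the one of a
   finite k and the second one is k = +oo (k = -oo is not used). *)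

(* At j = 0 the power is 0 `^ 0 = 1. *)
Definition exp_weight rho (j : nat) : R :=
  rho ^- j *
  (if k is r%:E then (j%:R / (r * expR 1)) `^ (j%:R / r) else 1).

Definition exp_series rho f : R^nat :=
  fun j => exp_weight rho j * taylor_norm f j.

Definition exp_norm rho f : R := limn (series (exp_series rho f)).

Definition exp_dom : set E :=
  if k is _%:E then setT
  else if A%:num == 0 then setT else ball (0 : E) (A%:num^-1)%:C.

Definition exp_growth f : Prop :=
  if k is _%:E then forall rho, A%:num < rho -> cvgn (series (exp_series rho f))
  else (limn_esup (fun j => ((taylor_norm f j) `^ (j%:R^-1))%:E)
        <= A%:num%:E)%E.

(* A function on exp_dom is represented by its extension by 0 to E. *)
Definition exp_set : set (E -> C) := [set f |
  [/\ holomorphic exp_dom f,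
      forall x, ~ exp_dom x -> f x = 0,
      forall j, hspace Theta j (hdiff j f 0) &
      exp_growth f]].

Definition dirderiv (a : E) f : E -> C :=
  patch (fun=> 0) exp_dom (fun x => hdiff 1 f x a).

End ExpSpace.

Section PowerSeries.
Variable K : numFieldType.

Let vanish (t0 : K) (c : nat -> K) := forall t, 0 < t -> t <= t0 ->
  forall e, 0 < e -> exists N, forall n, (N <= n)%N ->
    `|\sum_(i < n) c i * t ^+ i| < e.

Let sum_geo (s : K) n : 0 <= s -> s <= 2^-1 -> \sum_(i < n) s ^+ i <= 2.
Proof.
move=> s0 s2; have h : 2^-1 <= 1 - s.
  by rewrite lerBrDr addrC -lerBrDr (_ : 1 - _ = 2^-1) //; field.
rewrite -(@ler_pM2l _ (2^-1)) ?invr_gt0 ?ltr0n// mulVf ?pnatr_eq0//.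
apply: (@le_trans _ _ ((1 - s) * \sum_(i < n) s ^+ i)).
  by apply: ler_wpM2r => //; apply: sumr_ge0 => i _; apply: exprn_ge0.
have -> : (1 - s) * \sum_(i < n) s ^+ i = 1 - s ^+ n.
  by rewrite -[RHS]opprB subrX1 -mulNr opprB.
by rewrite lerBlDr lerDl exprn_ge0.
Qed.

Let vanish0 (t0 : K) c : 0 < t0 -> vanish t0 c -> c 0 = 0.
Proof.
move=> t0p V; apply/eqP; rewrite -normr_eq0; apply: contraT => c00.
have {c00}c0p : 0 < `|c 0| by rewrite lt_def c00 normr_ge0.
have [N HN] := V t0 t0p (lexx _) 1 ltr01.
pose M := 2 + \sum_(i < N) `|c i * t0 ^+ i|.
have Mp : 0 < M by rewrite ltr_wpDr ?sumr_ge0.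
have bnd n : `|c n * t0 ^+ n| <= M.
  have [nN|Nn] := ltnP n N.
    rewrite /M (bigD1 (Ordinal nN)) //= addrCA lerDl addr_ge0 ?sumr_ge0//.
  have h1 := HN n Nn; have h2 := HN n.+1 (leqW Nn).
  have -> : c n * t0 ^+ n =
     \sum_(i < n.+1) c i * t0 ^+ i - \sum_(i < n) c i * t0 ^+ i.
    by rewrite big_ord_recr /= addrAC subrr add0r.
  rewrite (le_trans (ler_normB _ _))// /M -[2]/(1 + 1).
  by rewrite -[leLHS]addr0 lerD ?sumr_ge0// ltW// ltrD.
pose s := `|c 0| / (8 * (M + `|c 0|)).
have Mc : 0 < M + `|c 0| by exact: addr_gt0.
have Dp : 0 < 8 * (M + `|c 0|) by apply: mulr_gt0 => //; rewrite ltr0n.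
have sp : 0 < s by rewrite divr_gt0.
have s2 : s <= 2^-1.
  rewrite /s ler_pdivrMr// mulrA (_ : 2^-1 * 8 = 4); last by field.
  rewrite mulrDr; apply: ler_wpDl; first by apply: mulr_ge0 => //; exact: ltW.
  by apply: ler_peMl; [exact: ltW|rewrite ler1n].
have s1 : s <= 1 by rewrite (le_trans s2)// invf_le1 ?ler1n ?ltr0n.
have tp : 0 < s * t0 by rewrite mulr_gt0.
have tle : s * t0 <= t0 by rewrite ler_piMl// ltW.
have [n0 Hn] := V _ tp tle (`|c 0| / 2) (divr_gt0 c0p (ltr0n _ 2)).
have := Hn n0.+1 (leqnSn _).
rewrite big_ord_recl expr0 mulr1 => h.
have tail : `|\sum_(i < n0) c (lift ord0 i) * (s * t0) ^+ lift ord0 i|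
     <= M * s * 2.
  apply: (le_trans (ler_norm_sum _ _ _)).
  apply: (@le_trans _ _ (\sum_(i < n0) M * s * s ^+ i)).
    apply: ler_sum => i _; rewrite lift0.
    have -> : c i.+1 * (s * t0) ^+ i.+1 = c i.+1 * t0 ^+ i.+1 * s ^+ i.+1.
      by rewrite exprMn; ring.
    rewrite normrM [`|s ^+ _|]ger0_norm; last by apply/exprn_ge0/ltW.
    rewrite -mulrA -exprS; apply: ler_wpM2r => //; exact/exprn_ge0/ltW.
  rewrite -mulr_sumr; apply: ler_wpM2l; last by apply: sum_geo => //; exact: ltW.
  by apply: mulr_ge0; exact: ltW.
have Ms : M * s * 2 <= `|c 0| / 4.
  have -> : M * s * 2 = (`|c 0| / 4) * (M / (M + `|c 0|)).
    by rewrite /s; field; rewrite gt_eqF.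
  apply: ler_piMr; first by apply: divr_ge0.
  by rewrite ler_pdivrMr// mul1r lerDl ltW.
have : `|c 0| < `|c 0| / 2 + `|c 0| / 4.
  set S := \sum_(i < n0) _ in h tail.
  rewrite -{1}[c 0](addrK S); apply: (le_lt_trans (ler_normB _ _)).
  by apply: ltr_leD => //; exact: le_trans tail Ms.
rewrite -mulrDr ltr_pMr// (_ : 2^-1 + 4^-1 = 1 - 4^-1); last by field.
by rewrite ltrBrDr gtrDl invr_lt0 ltrn0.
Qed.

Lemma vanish_coef0 t0 c : 0 < t0 -> vanish t0 c -> forall m, c m = 0.
Proof.
move=> t0p V m; elim: m c V => [|m IH] c V; first exact: vanish0 V.
have c0 := vanish0 t0p V.
apply: (IH (fun i => c i.+1)) => t tp tt0 e ep.
have [N HN] := V t tp tt0 (t * e) (mulr_gt0 tp ep).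
exists N => n Nn; have := HN n.+1 (leqW Nn).
rewrite big_ord_recl c0 mul0r add0r.
under eq_bigr do rewrite lift0 exprS mulrCA.
by rewrite -mulr_sumr normrM (gtr0_norm tp) ltr_pM2l.
Qed.

End PowerSeries.

Section TaylorTheory.
Variables (R : realType) (E : completeNormedModType R[i]).
Local Notation C := (R[i]^o).
Implicit Types (f g : E -> C) (a : E) (P Q : nat -> E -> C).

Lemma hompolyZ j (p : E -> C) (c : C) (x : E) :
  hompoly j p -> p (c *: x) = c ^+ j * p x.
Proof.
move=> [_ [B lB ->]].
pose y n (i : 'I_j) := if (i < n)%N then c *: x else x.
have BZ (z : 'I_j -> E) i u : B (@dfwith _ (fun=> E) z i (c *: u)) =
    c * B (@dfwith _ (fun=> E) z i u).
  have B0 : B (@dfwith _ (fun=> E) z i 0) = 0.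
    have := lB z i 1 0 0; rewrite !scale1r addr0 => /eqP.
    by rewrite eq_sym -subr_eq0 addrK => /eqP.
  by have := lB z i c u 0; rewrite addr0 B0 addr0.
suff H n : (n <= j)%N -> B (y n) = c ^+ n * B (fun=> x).
  rewrite -H//; congr B; apply/funext => i; by rewrite /y ltn_ord.
elim: n => [_|n IH nj]; first by rewrite mul1r; congr B; apply/funext.
pose i := Ordinal nj.
have -> : y n.+1 = @dfwith _ (fun=> E) (y n) i (c *: x).
  apply/funext => k; case: dfwithP => [|k' ik].
    by rewrite /y ltnSn.
  rewrite /y ltnS leq_eqVlt; suff -> : (k' == n :> nat) = false by [].
  by apply/negbTE; rewrite eq_sym.
rewrite BZ (_ : @dfwith _ (fun=> E) (y n) i x = y n).
  by rewrite IH ?(ltnW nj)// mulrA exprS.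
apply/funext => k; case: dfwithP => [|//].
by rewrite /y ltnn.
Qed.

Lemma hompolyD j (p q : E -> C) (c : C) :
  hompoly j p -> hompoly j q -> hompoly j (c *: p + q).
Proof.
move=> [cp [B lB pB]] [cq [D lD qD]]; split.
  move=> x; apply: (@cvgD _ C _ (nbhs x)); last exact: cq.
  by apply: (@cvgZr _ C _ (nbhs x)); apply: cp.
exists (fun x => c * B x + D x); last by rewrite pB qD.
move=> x i s u v; rewrite lB lD /= /GRing.scale /=; ring.
Qed.

Lemma hompoly0 j : hompoly j (0 : E -> C).
Proof.
split; first by move=> x; exact: cvg_cst.
exists (fun=> 0) => // x i s u v; by rewrite scaler0 addr0.
Qed.

Lemma uniform_cvgP (U : set E) (F : nat -> E -> C) f :
  {uniform U, F @ \oo --> f} <->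
  forall e : R, 0 < e -> exists N, forall n, (N <= n)%N -> forall x, U x ->
    `|f x - F n x| < e%:C.
Proof.
split=> [Ff e e0|H].
  have ec : 0 < e%:C :> R[i] by rewrite ltcR.
  have : nbhs (f : {uniform` U -> C}) [set h | forall y, U y -> ball (f y) e%:C (h y)].
    apply/uniform_nbhs; exists [set xy | ball xy.1 e%:C xy.2]; split => //.
    exact: (entourage_ball C (PosNum ec)).
  move=> /Ff [N _ HN]; exists N => n Nn x Ux.
  by have := HN n Nn x Ux.
move=> W /= /uniform_nbhs[G [Gent GW]].
have [e e0 eG] : exists2 e : R[i], 0 < e & [set xy | ball xy.1 e xy.2] `<=` G.
  by move: Gent; rewrite -entourage_ballE => -[e e0 eG]; exists e.
have eR : (complex.Re e)%:C = e.
  by move: (ltW e0); rewrite lecE => /andP[/eqP /= b0 _]; case: e b0 {e0 eG} => ? ? /= ->.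
have e0' : 0 < complex.Re e by rewrite -ltcR eR.
have [N HN] := H _ e0'.
exists N => // n Nn; apply: GW => y Uy; apply: eG => /=.
by have := HN n Nn y Uy; rewrite eR.
Qed.

Lemma is_taylorD f g a P Q (c : C) : is_taylor f a P -> is_taylor g a Q ->
  is_taylor (c *: f + g) a (fun m => c *: P m + Q m).
Proof.
move=> [hP [r r0 /uniform_cvgP fr]] [hQ [s s0 /uniform_cvgP gs]]; split.
  by move=> m; exact: hompolyD.
exists (Num.min r s); first by rewrite lt_min r0.
apply/uniform_cvgP => e e0.
have c1 : 0 < nrm c + 1 by rewrite ltr_wpDl// -lecR nrmE normr_ge0.
have [N1 H1] := fr (e / 2 / (nrm c + 1)) (divr_gt0 (divr_gt0 e0 (ltr0n _ 2)) c1).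
have [N2 H2] := gs (e / 2) (divr_gt0 e0 (ltr0n _ 2)).
exists (maxn N1 N2) => n; rewrite geq_max => /andP[n1 n2] x ax.
have xr : ball a r%:C x by apply: le_ball ax; rewrite lecR ge_min lexx.
have xs : ball a s%:C x by apply: le_ball ax; rewrite lecR ge_min lexx orbT.
have {}H1 := H1 n n1 x xr; have {}H2 := H2 n n2 x xs.
have -> : (c *: f + g) x - \sum_(m < n) (c *: P m + Q m) (x - a) =
  c * (f x - \sum_(m < n) P m (x - a)) + (g x - \sum_(m < n) Q m (x - a)).
  rewrite big_split /= -mulr_sumr.
  have aux (b u v s' t : R[i]) : b * u + v - (b * s' + t) = b * (u - s') + (v - t).
    by ring.
  exact: aux.
apply: (le_lt_trans (ler_normD _ _)); rewrite normrM.
have -> : e%:C = (e / 2)%:C + (e / 2)%:C by rewrite -rmorphD /= -splitr.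
apply: ler_ltD => //.
apply: (@le_trans _ _ ((nrm c)%:C * (e / 2 / (nrm c + 1))%:C)).
  by rewrite nrmE ler_wpM2l// ltW.
rewrite -rmorphM /= lecR mulrCA ger_pMr ?divr_gt0//.
by rewrite ler_pdivrMr// mul1r lerDl.
Qed.

Lemma is_taylor0 a : is_taylor (0 : E -> C) a (fun=> 0).
Proof.
split; first by move=> m; exact: hompoly0.
exists 1 => //; apply/uniform_cvgP => e e0; exists 0%N => n _ x _.
rewrite big1 // subr0 normr0; by rewrite ltcR.
Qed.

Lemma is_taylor_unique f a P Q : is_taylor f a P -> is_taylor f a Q -> P = Q.
Proof.
move=> tP tQ.
have [hD [r r0 /uniform_cvgP fr]] := is_taylorD (-1) tP tQ.
apply/funext => m; apply/funext => y; apply/eqP; rewrite -subr_eq0; apply/eqP.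
pose D m := (-1 : C) *: P m + Q m.
suff : D m y = 0.
  move=> D0; apply/eqP; rewrite -oppr_eq0 opprB; apply/eqP; rewrite -D0.
  by rewrite [RHS]/(-1 * P m y + Q m y) mulN1r addrC.
have y1 : 0 < `|y| + 1 by rewrite ltr_wpDl.
pose t0 : R[i] := r%:C / 2 / (`|y| + 1).
have rc : 0 < r%:C :> R[i] by rewrite ltcR.
have t0p : 0 < t0 by rewrite !divr_gt0.
apply: (@vanish_coef0 _ t0 (fun m => D m y)) => // t tp tt0 e ep.
have eR : (complex.Re e)%:C = e.
  move: (ltW ep); rewrite lecE => /andP[/eqP /= b0 _].
  by case: e b0 {ep} => ? ? /= ->.
have e0 : 0 < complex.Re e by rewrite -ltcR eR.
have [N HN] := fr _ e0; exists N => n Nn.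
have xb : ball a r%:C (a + t *: y).
  rewrite -ball_normE /ball_ /= opprD addrA subrr sub0r normrN normrZ.
  rewrite (gtr0_norm tp); apply: (@le_lt_trans _ _ (t0 * `|y|)).
    by apply: ler_wpM2r.
  rewrite /t0 mulrAC ltr_pdivrMr// ltr_pM// ?divr_ge0 ?ltW//.
    by rewrite gtr_pMr// invf_lt1 ?ltr1n.
  by rewrite ltrDl.
have := HN n Nn _ xb; rewrite eR.
have -> : (-1 : C) *: f + f = 0 by rewrite scaleN1r addNr.
rewrite sub0r normrN; congr (`|_| < _); apply: eq_bigr => i _.
by rewrite addrAC subrr add0r (hompolyZ _ _ (hD i)) mulrC.
Qed.

Lemma taylorE f a P : is_taylor f a P -> taylor f a = P.
Proof.
move=> tP; rewrite /taylor; case: xgetP => [Q _ tQ|/(_ P)//].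
exact: is_taylor_unique tQ tP.
Qed.

Lemma hdiffD m f g a (c : C) :
  (exists P, is_taylor f a P) -> (exists Q, is_taylor g a Q) ->
  hdiff m (c *: f + g) a = c *: hdiff m f a + hdiff m g a.
Proof.
move=> [P tP] [Q tQ]; apply/funext => x.
rewrite /hdiff (taylorE tP) (taylorE tQ) (taylorE (is_taylorD c tP tQ)).
have aux (b u v w : R[i]) : w * (b * u + v) = b * (w * u) + w * v by ring.
exact: aux.
Qed.

Lemma hdiff0 m a : hdiff m (0 : E -> C) a = 0.
Proof. by apply/funext => x; rewrite /hdiff (taylorE (is_taylor0 a)) mulr0. Qed.

Lemma holomorphicD (U : set E) f g (c : C) :
  holomorphic U f -> holomorphic U g -> holomorphic U (c *: f + g).
Proof.
move=> hf hg a Ua; have [P tP] := hf a Ua; have [Q tQ] := hg a Ua.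
exists (fun m => c *: P m + Q m); exact: is_taylorD.
Qed.

End TaylorTheory.

Section ExpClosure.
Variables (R : realType) (E : completeNormedModType R[i]).
Variables (Theta : holomorphy_type E) (k : \bar R) (A : {nonneg R}).
Local Notation C := (R[i]^o).
Implicit Types (f g : E -> C).
Local Notation tn := (taylor_norm Theta).

Lemma nrm_ge0 (V : normedZmodType R[i]) (x : V) : 0 <= nrm x.
Proof. by rewrite -lecR nrmE normr_ge0. Qed.

Lemma hspaceD j (P Q : E -> C) (c : C) :
  hspace Theta j P -> hspace Theta j Q -> hspace Theta j (c *: P + Q).
Proof.
have [[_ lc] _ _ _ _] := hspace_banach Theta j => hP hQ.
by have := lc c P Q (mem_set hP) (mem_set hQ); rewrite inE.
Qed.

Lemma hspace_0 j : hspace Theta j 0.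
Proof.
by have [[s0 _] _ _ _ _] := hspace_banach Theta j; move: s0; rewrite inE.
Qed.

Lemma hspaceZ j (P : E -> C) (c : C) :
  hspace Theta j P -> hspace Theta j (c *: P).
Proof.
move=> hP; rewrite -[c *: P]addr0; apply: hspaceD => //; exact: hspace_0.
Qed.

Lemma hnorm_0 j : hnorm Theta j 0 = 0.
Proof.
have [_ _ _ hZ _] := hspace_banach Theta j.
have := hZ 0 0 (hspace_0 j); rewrite scale0r => ->.
by rewrite /nrm normr0 mul0r.
Qed.

Lemma hnorm_ge0 j (P : E -> C) : hspace Theta j P -> 0 <= hnorm Theta j P.
Proof.
move=> hP; have [_ _ hD hZ _] := hspace_banach Theta j.
have := hD P (-1 *: P) hP (hspaceZ (-1) hP).
rewrite hZ// scaleN1r subrr hnorm_0 {1}/nrm normrN1 mul1r -mulr2n.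
by rewrite pmulrn_lge0.
Qed.

Lemma taylor_norm_ge0 f j : exp_set Theta k A f -> 0 <= tn f j.
Proof. by case=> _ _ hf _; apply/hnorm_ge0/hspaceZ. Qed.

Lemma exp_dom0 : exp_dom k A (0 : E).
Proof.
rewrite /exp_dom; case: k => // [|]; case: eqP => // /eqP A0;
  by apply: ballxx; rewrite ltcR invr_gt0 lt_def A0 /=.
Qed.

Lemma exp_hdiffD j f g (c : C) : exp_set Theta k A f -> exp_set Theta k A g ->
  hdiff j (c *: f + g) 0 = c *: hdiff j f 0 + hdiff j g 0.
Proof.
by case=> hf _ _ _ [hg _ _ _]; apply: hdiffD; [apply: hf|apply: hg];
  exact: exp_dom0.
Qed.

Lemma taylor_normD f g (c : C) j : exp_set Theta k A f -> exp_set Theta k A g ->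
  tn (c *: f + g) j <= nrm c * tn f j + tn g j.
Proof.
move=> ef eg; rewrite /taylor_norm exp_hdiffD// scalerDr scalerA mulrC -scalerA.
have [_ _ hD hZ _] := hspace_banach Theta j.
have [_ _ hf _] := ef; have [_ _ hg _] := eg.
rewrite (le_trans (hD _ _ _ _))//; do ?[exact: hspaceZ]; first exact/hspaceZ/hspaceZ.
by rewrite hZ//; exact: hspaceZ.
Qed.

Lemma exp_weight_ge0 rho j : A%:num < rho -> 0 <= exp_weight k rho j.
Proof.
move=> Ar; have r0 : 0 <= rho by rewrite (le_trans _ (ltW Ar)).
apply: mulr_ge0; first by rewrite invr_ge0 exprn_ge0.
by case: k => // r; exact: powR_ge0.
Qed.

Lemma limn_esup_rootP (u : R^nat) : (forall j, 0 <= u j) ->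
  (limn_esup (fun j => ((u j) `^ (j%:R^-1))%:E) <= A%:num%:E)%E <->
  forall rho, A%:num < rho -> exists N, forall j, (N <= j)%N -> u j <= rho ^+ j.
Proof.
move=> u0; split=> [uA rho Ar|H].
  have r0 : 0 < rho by rewrite (le_lt_trans _ Ar).
  have : (limn_esup (fun j => ((u j) `^ (j%:R^-1))%:E) < rho%:E)%E.
    by apply: le_lt_trans uA _; rewrite lte_fin.
  rewrite /limn_esup limf_esupE => /ereal_inf_lt[_ [V [N _ NV] <-] supV].
  exists (maxn N 1) => j; rewrite geq_max => /andP[Nj j1].
  have := le_lt_trans (ereal_sup_ubound (imageP _ (NV _ Nj))) supV.
  rewrite lte_fin => /ltW h.
  have j0 : j%:R != 0 :> R by rewrite pnatr_eq0 -lt0n.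
  rewrite -[leLHS]powRr1// -(mulVf j0) powRrM -powR_mulrn; last exact: ltW.
  apply: ge0_ler_powR => //; rewrite nnegrE; [exact: powR_ge0|exact: ltW].
apply/lee_addgt0Pr => e e0.
have Ale : A%:num < A%:num + e by rewrite ltrDl.
have [N HN] := H (A%:num + e) Ale.
rewrite /limn_esup limf_esupE; apply: ereal_inf_le.
exists (ereal_sup ((fun j => ((u j) `^ (j%:R^-1))%:E) @` [set j | (maxn N 1 <= j)%N])).
  by exists [set j | (maxn N 1 <= j)%N] => //; exists (maxn N 1).
apply: ge_ereal_sup => _ [j /= + <-]; rewrite geq_max => /andP[Nj j1].
rewrite -EFinD lee_fin.
have j0 : j%:R != 0 :> R by rewrite pnatr_eq0 -lt0n.
have Ae : 0 <= A%:num + e by rewrite addr_ge0// ltW.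
have -> : A%:num + e = ((A%:num + e) ^+ j) `^ j%:R^-1.
  by rewrite -powR_mulrn// -powRrM mulfV// powRr1.
by apply: ge0_ler_powR => //; rewrite ?nnegrE ?exprn_ge0 ?HN// invr_ge0.
Qed.

Lemma exp_growthD f g (c : C) : exp_set Theta k A f -> exp_set Theta k A g ->
  exp_growth Theta k A (c *: f + g).
Proof.
move=> ef eg; have [_ _ hf gf] := ef; have [_ _ hg gg] := eg.
have hn0 j : 0 <= tn (c *: f + g) j.
  by apply/hnorm_ge0/hspaceZ; rewrite exp_hdiffD//; exact: hspaceD.
have tf0 j := taylor_norm_ge0 j ef; have tg0 j := taylor_norm_ge0 j eg.
have tD j := taylor_normD c j ef eg.
have lim (kA := limn_esup (fun j => ((tn (c *: f + g) j) `^ (j%:R^-1))%:E)) :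
  (limn_esup (fun j => ((tn f j) `^ (j%:R^-1))%:E) <= A%:num%:E)%E ->
  (limn_esup (fun j => ((tn g j) `^ (j%:R^-1))%:E) <= A%:num%:E)%E ->
  (kA <= A%:num%:E)%E.
  move=> /(limn_esup_rootP tf0) Hf /(limn_esup_rootP tg0) Hg.
  apply/(limn_esup_rootP hn0) => rho Ar.
  have r0 : 0 < rho by rewrite (le_lt_trans _ Ar).
  have Am : A%:num < (A%:num + rho) / 2 by rewrite midf_lt.
  have mr : (A%:num + rho) / 2 < rho by rewrite midf_lt.
  set s := _ / 2 in Am mr; have s0 : 0 < s by rewrite (le_lt_trans _ Am).
  have [N1 H1] := Hf s Am; have [N2 H2] := Hg s Am.
  have q1 : `|s / rho| < 1 
    by rewrite ger0_norm; [rewrite ltr_pdivrMr// mul1r|exact/ltW/divr_gt0].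
  have c1 : 0 < nrm c + 1 by rewrite ltr_wpDl ?nrm_ge0.
  have /cvgr0Pnorm_lt/(_ (nrm c + 1)^-1) := cvg_expr q1.
  rewrite invr_gt0 => /(_ c1)[N3 _ H3].
  exists (maxn (maxn N1 N2) N3) => j; rewrite !geq_max => /andP[/andP[n1 n2] n3].
  apply: (le_trans (tD j)); apply: (@le_trans _ _ ((nrm c + 1) * s ^+ j)).
    rewrite mulrDl mul1r lerD ?H2//; apply: ler_wpM2l; [exact: nrm_ge0|exact: H1].
  have := H3 j n3; rewrite /= expr_div_n ger0_norm; last first.
    by rewrite divr_ge0 ?exprn_ge0// ltW.
  rewrite ltr_pdivrMr ?exprn_gt0// mulrC ltr_pdivlMr// mulrC.
  by move/ltW.
move: gf gg; rewrite /exp_growth; case: (k) (@exp_weight_ge0) => [r wk|_|_]; [|exact: lim..].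
move=> gf gg rho Ar; have wn0 j := wk rho j Ar.
pose F h := exp_series Theta r%:E rho h.
apply: (@series_le_cvg _ _ (nrm c *: F f + F g)).
- by move=> j; apply: mulr_ge0.
- move=> j; apply: addr_ge0; last by apply: mulr_ge0.
  by apply: mulr_ge0; [exact: nrm_ge0|apply: mulr_ge0].
- move=> j; apply: (le_trans (ler_wpM2l (wn0 j) (tD j))).
  by rewrite mulrDr mulrCA.
by apply: is_cvg_seriesD; [apply: is_cvg_seriesZ; exact: gf|exact: gg].
Qed.

Lemma exp_set0 : exp_set Theta k A (0 : E -> C).
Proof.
have tn0 j : tn (0 : E -> C) j = 0 by rewrite /taylor_norm hdiff0 scaler0 hnorm_0.
split => //.
- by move=> a _; exists (fun=> 0); exact: is_taylor0.
- by move=> j; rewrite hdiff0; exact: hspace_0.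
have lim : (limn_esup (fun j => ((tn (0 : E -> C) j) `^ (j%:R^-1))%:E)
    <= A%:num%:E)%E.
  apply/limn_esup_rootP => [j|rho Ar]; first by rewrite tn0.
  exists 0%N => j _; rewrite tn0 exprn_ge0// (le_trans _ (ltW Ar))//.
rewrite /exp_growth; case: (k) => [r|//|//] rho Ar.
have -> : exp_series Theta r%:E rho (0 : E -> C) = fun=> 0.
  by apply/funext => j; rewrite /exp_series tn0 mulr0.
rewrite (_ : series _ = cst 0); first exact: is_cvg_cst.
by apply/funext => n; rewrite /series /= big1.
Qed.

Definition exp_pred : {pred E -> C} := mem (exp_set Theta k A).

Lemma exp_submod_closed : submod_closed exp_pred.
Proof.
split; first by apply: mem_set; exact: exp_set0.
move=> c f g /set_mem ef /set_mem eg; apply: mem_set.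
have [hf f0 tf _] := ef; have [hg g0 tg _] := eg; split.
- exact: holomorphicD.
- move=> x xU; have aux : c *: (0 : C) + 0 = 0 by rewrite scaler0 addr0.
  by rewrite [LHS]/(c *: f x + g x) f0// g0//; exact: aux.
- by move=> j; rewrite exp_hdiffD//; exact: hspaceD.
- exact: exp_growthD.
Qed.

HB.instance Definition _ :=
  GRing.isSubmodClosed.Build R[i] (E -> C) exp_pred exp_submod_closed.

Record exp_space : Type := ExpSpace {
  exp_val :> E -> C ; exp_valP : exp_val \in exp_pred }.

HB.instance Definition _ := [isSub for exp_val].
HB.instance Definition _ := [Choice of exp_space by <:].
HB.instance Definition _ := [SubChoice_isSubLmodule of exp_space by <:].
HB.instance Definition _ := isPointed.Build exp_space 0.

(* The topology generated by the seminorms exp_norm rho, A < rho *)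
HB.instance Definition _ := @isSubBaseTopological.Build exp_space
  (exp_space * (R * R))%type
  [set i | A%:num < i.2.1 /\ 0 < i.2.2]
  (fun i => [set g | exp_norm Theta k i.2.1 (g - i.1 : exp_space) < i.2.2]).

(* dirderiv k A a f is the function df(.)a; it belongs to exp_space whenever
   Theta has canonical constants, and g below denotes it as an element of
   exp_space. *)
Definition convolution_operator (L : exp_space -> exp_space) : Prop :=
  [/\ linear L, continuous L &
      forall (f g : exp_space) (a : E),
        exp_val g = dirderiv k A a f ->
        exp_val (L g) = dirderiv k A a (L f)].

Definition nontrivial_operator (L : exp_space -> exp_space) : Prop :=
  ~ exists c : R[i], forall f : exp_space, L f = c *: f.

End ExpClosure.

(* Main.v *)
Require Import Defs.
From mathcomp Require Import all_boot all_order all_algebra.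
From mathcomp Require Import all_classical all_reals all_analysis.
From mathcomp Require Import complex qpoly ring lra.
Set Implicit Arguments.
Unset Strict Implicit.
Unset Printing Implicit Defensive.
Import Order.TTheory GRing.Theory Num.Theory numFieldNormedType.Exports.
Local Open Scope classical_set_scope.
Local Open Scope ring_scope.
Local Open Scope complex_scope.

(** Write X for the space Exp and exp(phi) for the exponential of a linear form
   phi in E'.  It belongs to X because k > 1, and it is an eigenvector of every
   convolution operator L: as d(exp phi)(.)a = phi(a) exp(phi), the function
   g = L (exp phi) satisfies dg(.)a = phi(a) g, and such a g is a multiple of
   exp(phi) ([exponential_ode]).  Hence L (exp phi) = c(phi) exp(phi) with
   c(phi) = (L (exp phi))(0).

   Vectors exp(phi) with |c(phi)| < 1 have orbits that tend to 0, and those with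
   |c(phi)| > 1 have backward orbits that tend to 0.  If both families span dense
   subspaces, then for open U and W some x in U with L^n x -> 0 and some y in W
   with z_n -> 0, L^n z_n = y give x + z_n in U and L^n (x + z_n) in W for all
   large n, so that L is mixing ([convolution_mixing]).

   The density ([exponentials_total]) is proved along lines.  The function
   t |-> c(t phi) is entire.  If it is not constant, Liouville's theorem for it and
   for its inverse gives points with |c| < 1 and with |c| > 1, hence discs of such
   points; a closed subspace that contains exp(t phi) for t in a disc contains the
   Taylor coefficients of this curve, hence the whole curve, hence every power
   phi^j ([powers_in_closed_subspace]).  If c is constant on every line, then L is
   a scalar, because the powers of linear forms span a dense subspace
   ([total_powers], [nontrivial_direction]).  Otherwise c is not constant on the
   line of some psi, nor on the line of phi + m psi for large m, and by Lagrange
   interpolation phi^j is a linear combination of the (phi + m psi)^j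
   ([power_interpolation]).

   All this rests on the identification of X with a weighted space of sequences
   of polynomials.  The canonical constants bound the Taylor remainders of the
   terms, so that a series of polynomials with summable weighted norms is
   holomorphic and can be differentiated termwise ([exp_space_of_coefs]), and an
   element of X is determined by its Taylor coefficients at 0, by the identity
   theorem on segments ([exp_coef_inj]).  It follows that X is complete, and also
   separable because E' is; a Baire argument then turns mixing into
   hypercyclicity ([mixing_hypercyclic]). *)

(** * Norms and linear maps *)
Section RealNorm.
Variables (R : realType) (V : normedZmodType R[i]).
Implicit Types (x y : V).

Lemma nrm0 : nrm (0 : V) = 0.
Proof. by rewrite /nrm normr0. Qed.

Lemma nrmN x : nrm (- x) = nrm x.
Proof. by rewrite /nrm normrN. Qed.

Lemma nrmD x y : nrm (x + y) <= nrm x + nrm y.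
Proof. by rewrite -lecR rmorphD /= !nrmE ler_normD. Qed.

Lemma nrmB x y : nrm (x - y) <= nrm x + nrm y.
Proof. by rewrite -(nrmN y) nrmD. Qed.

Lemma nrmC x y : nrm (x - y) = nrm (y - x).
Proof. by rewrite -nrmN opprB. Qed.

Lemma nrm_dist x y : `|nrm x - nrm y| <= nrm (x - y).
Proof.
have := nrmD (x - y) y; have := nrmD (y - x) x; rewrite !subrK nrmC => h1 h2.
by rewrite ler_norml; apply/andP; split; lra.
Qed.

Lemma nrm_eq0 x : (nrm x == 0) = (x == 0).
Proof. by rewrite -(normr_eq0 x) -nrmE eq_complex /= eqxx andbT. Qed.

Lemma nrm_sum (I : Type) (r : seq I) (P : pred I) (F : I -> V) :
  nrm (\sum_(i <- r | P i) F i) <= \sum_(i <- r | P i) nrm (F i).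
Proof.
elim/big_ind2: _ => //; first by rewrite nrm0.
move=> x a y b xa yb; exact: le_trans (nrmD _ _) (lerD xa yb).
Qed.

End RealNorm.

Section ComplexNorm.
Variable R : realType.
Implicit Types x y : R[i].

Lemma pos_complex_real x : 0 < x -> (complex.Re x)%:C = x.
Proof.
by move=> /ltW; rewrite lecE => /andP[/eqP /= b0 _]; case: x b0 => ? ? /= ->.
Qed.

Lemma nrmM x y : nrm (x * y) = nrm x * nrm y.
Proof. by apply: (@complexI R); rewrite rmorphM /= !nrmE normrM. Qed.

Lemma nrm1 : nrm (1 : R[i]) = 1.
Proof. by rewrite /nrm normr1. Qed.

Lemma nrmX x n : nrm (x ^+ n) = nrm x ^+ n.
Proof. by elim: n => [|n IH]; rewrite ?expr0 ?nrm1// !exprS nrmM IH. Qed.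

Lemma nrmV x : nrm x^-1 = (nrm x)^-1.
Proof. by apply: (@complexI R); rewrite fmorphV /= !nrmE normfV. Qed.

Lemma nrm_real (a : R) : nrm (a%:C : R[i]) = `|a|.
Proof.
apply: (@complexI R); rewrite nrmE; have [a0|a0] := leP 0 a.
  by rewrite !ger0_norm// lecR.
by rewrite !ltr0_norm ?rmorphN// ltcR.
Qed.

Lemma nrm_nat n : nrm (n%:R : R[i]) = n%:R.
Proof. by rewrite -(rmorph_nat (real_complex R)) nrm_real ger0_norm. Qed.

Lemma nrmZ (E : normedModType R[i]) x (u : E) : nrm (x *: u) = nrm x * nrm u.
Proof. by apply: (@complexI R); rewrite rmorphM /= !nrmE normrZ. Qed.

End ComplexNorm.

Section LinearMaps.
Variables (K : nzRingType) (U V : lmodType K) (f : U -> V).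
Hypothesis lf : linear f.

Lemma linear_at0 : f 0 = 0.
Proof.
have := lf 1 0 0; rewrite !scale1r addr0 => /eqP.
by rewrite eq_sym -subr_eq0 addrK => /eqP.
Qed.

Lemma linear_scale c u : f (c *: u) = c *: f u.
Proof. by have := lf c u 0; rewrite !addr0 linear_at0 addr0. Qed.

Lemma linear_sub u v : f (u - v) = f u - f v.
Proof. by rewrite addrC -scaleN1r lf scaleN1r addrC. Qed.

Lemma linear_sum n (F : 'I_n -> U) : f (\sum_(i < n) F i) = \sum_(i < n) f (F i).
Proof.
apply: (big_morph f _ linear_at0) => u v.
by have := lf 1 u v; rewrite !scale1r.
Qed.

End LinearMaps.

(** * Liouville's theorem through polynomials *)
Section PolynomialEstimates.
Variable R : realType.
Implicit Types (p q : {poly R[i]}) (r M e : R) (t : R[i]).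

(** Cauchy's estimate without integrals.  In p(t) = e(t^2) + t o(t^2), the values
   e(t^2) and t o(t^2) are the half sum and half difference of p(t) and p(-t), so
   a bound of p on the circle of radius r gives bounds of e and o on the circle of
   radius r^2; this halves the degree. *)
Lemma cauchy_coef p r M m : 0 < r ->
  (forall t, nrm t = r -> nrm p.[t] <= M) -> nrm p`_m * r ^+ m <= M.
Proof.
have [n] := ubnP (size p); elim: n p r M m => // n IH p r M m sp r0 pM.
have [p1|p1] := leqP (size p) 1.
  have := pM r%:C; rewrite nrm_real gtr0_norm// => /(_ erefl).
  rewrite (size1_polyC p1) hornerC coefC => h.
  by case: m => [|m]; rewrite ?expr0 ?mulr1//= nrm0 mul0r (le_trans _ h)// nrm_ge0.
have r20 : 0 < r ^+ 2 by rewrite exprn_gt0.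
have rootE t : nrm t = r ^+ 2 -> nrm (sqrtC t) = r.
  move=> tr; apply/eqP; rewrite -(@eqrXn2 _ 2)//; last 2 first.
  - exact: nrm_ge0.
  - exact: ltW.
  by rewrite -nrmX sqrtCK tr.
have evod u : p.[u] = (even_poly p).[u ^+ 2] + (odd_poly p).[u ^+ 2] * u.
  by rewrite -{1}(poly_even_odd p) hornerD hornerM hornerX !horner_comp hornerXn.
have half2 (x y : R[i]) : nrm x <= M -> nrm y <= M -> nrm ((x + y) / 2%:R) <= M.
  move=> xM yM; rewrite nrmM nrmV nrm_nat ler_pdivrMr//.
  by rewrite (le_trans (nrmD _ _))// mulr_natr mulr2n lerD.
have hs : (uphalf (size p) < n)%N.
  rewrite -ltnS; apply: leq_trans sp; rewrite ltnS uphalf_half.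
  by case: (size p) p1 => [|[|s]]// _; rewrite -[in leqRHS](odd_double_half s.+2);
    rewrite ltn_add2l -addnn -[ltnLHS]addn0 ltn_add2l.
have -> : m = (odd m + m./2.*2)%N by rewrite odd_double_half.
case: (odd m) (m./2) => {}m; rewrite ?add1n ?add0n.
- rewrite -coef_odd_poly exprS mulrCA mulrC -ler_pdivlMr// -mul2n exprM.
  apply: IH => //.
    by apply: leq_ltn_trans hs; rewrite (leq_trans (size_odd_poly _))// uphalf_half leq_addl.
  move=> t /rootE tr; rewrite ler_pdivlMr// -tr -nrmM.
  have -> : (odd_poly p).[t] * sqrtC t = (p.[sqrtC t] + (- p.[- sqrtC t])) / 2%:R.
    by rewrite !evod sqrrN sqrtCK; field.
  by apply: half2; rewrite ?nrmN pM// nrmN.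
- rewrite -coef_even_poly -mul2n exprM.
  apply: IH => //; first exact: leq_ltn_trans (size_even_poly _) hs.
  move=> t /rootE tr.
  have -> : (even_poly p).[t] = (p.[sqrtC t] + p.[- sqrtC t]) / 2%:R.
    by rewrite !evod sqrrN sqrtCK; field.
  by apply: half2; rewrite pM// nrmN.
Qed.

End PolynomialEstimates.

Section Elementary.
Variable R : realType.

Lemma expr_small (x e : R) : 0 <= x < 1 -> 0 < e ->
  exists N, forall n, (N <= n)%N -> x ^+ n < e.
Proof.
move=> /andP[x0 x1] e0; have xn : `|x| < 1 by rewrite ger0_norm.
have /cvgr0Pnorm_lt/(_ e e0)[N _ H] := cvg_expr xn.
exists N => n Nn; have := H n Nn; rewrite /= ger0_norm// exprn_ge0//.
Qed.

(** The last step of Liouville's argument: a bound x r <= B for all large radii r. *)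
Lemma linear_growth_eq0 (x B : R) : 0 <= x ->
  (forall r, 1 <= r -> x * r <= B) -> x = 0.
Proof.
move=> x0 H; apply/eqP; rewrite eq_le x0 andbT leNgt; apply/negP => xp.
have B0 : 0 <= B by rewrite (le_trans _ (H 1 (lexx _)))// mulr1.
have := H (1 + (B + 1) / x); rewrite lerDl divr_ge0 ?addr_ge0// => /(_ isT).
rewrite mulrDr mulr1 mulrCA mulfV ?gt_eqF//; lra.
Qed.

End Elementary.

Section Interpolation.
Variable R : realType.

(** Lagrange interpolation, with coefficients that depend on the nodes only *)
Lemma interpolation (x : nat -> R[i]) (n : nat) : injective x ->
  exists l : 'I_n.+1 -> {poly R[i]}, forall p : {poly R[i]},
    (size p <= n.+1)%N -> p = \sum_(i < n.+1) p.[x i] *: l i.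
Proof.
move=> xI; exists (fun i => val (tnth (lagrange n.+1 x) i)) => p sp.
rewrite {1}(lagrange_gen (ltn0Sn n) xI sp); apply: eq_bigr => i _.
by rewrite mul_polyC.
Qed.

Lemma natr_complex_inj m : injective (fun i : nat => ((m + i)%N%:R : R[i])).
Proof.
by move=> i j /eqP; rewrite eqr_nat eqn_add2l => /eqP.
Qed.

Lemma poly_eventually_neq0 (p : {poly R[i]}) : p != 0 ->
  exists N, forall n, (N <= n)%N -> p.[n%:R] != 0.
Proof.
move=> p0; have [s ps] := closed_field_poly_normal p.
have [N sN] : exists N, forall z, z \in s -> nrm z < N%:R.
  elim: s {ps} => [|z s [N IH]]; first by exists 0%N.
  exists (maxn N (Num.bound (nrm z))) => y; rewrite inE => /orP[/eqP->|/IH h].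
    by rewrite (lt_le_trans (archi_boundP (nrm_ge0 z)))// ler_nat leq_maxr.
  by rewrite (lt_le_trans h)// ler_nat leq_maxl.
exists N => n Nn; rewrite ps hornerZ mulf_neq0 ?lead_coef_eq0//.
rewrite -[_ == 0]/(root (\prod_(z <- s) ('X - z%:P)) n%:R) root_prod_XsubC.
by apply/negP => /sN; rewrite nrm_nat ltr_nat ltnNge Nn.
Qed.

End Interpolation.

Section Liouville.
Variable R : realType.
Implicit Types (p q : {poly R[i]}) (r e : R) (t z : R[i]).

(** The approximants are the truncations of the geometric series of 1 / (t - z),
   which converges uniformly on the disc because it does not contain z. *)
Lemma linear_inverse_approx z r e : 0 <= r < nrm z -> 0 < e ->
  exists q, forall t, nrm t <= r -> nrm (1 - ('X - z%:P).[t] * q.[t]) <= e.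
Proof.
move=> /andP[r0 rz] e0; have zp : 0 < nrm z by exact: le_lt_trans rz.
have z0 : z != 0 by rewrite -nrm_eq0 gt_eqF.
have [|N HN] := @expr_small _ (r / nrm z) e _ e0.
  by rewrite divr_ge0 ?nrm_ge0//= ltr_pdivrMr// mul1r.
pose u : {poly R[i]} := z^-1 *: 'X.
exists (- z^-1 *: \sum_(i < N) u ^+ i) => t tr.
have uE : u.[t] = t / z by rewrite /u hornerZ hornerX mulrC.
have -> : 1 - ('X - z%:P).[t] * (- z^-1 *: \sum_(i < N) u ^+ i).[t] = (t / z) ^+ N.
  have := subrX1 (t / z) N.
  rewrite hornerZ horner_sum hornerXsubC => /(canRL (subrK _)) ->.
  have -> : \sum_(i < N) (u ^+ i).[t] = \sum_(i < N) (t / z) ^+ i.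
    by apply: eq_bigr => i _; rewrite horner_exp uE.
  by field.
rewrite nrmX (le_trans _ (ltW (HN N (leqnn _))))// lerXn2r ?nnegrE ?nrm_ge0//.
  by rewrite divr_ge0// ltW.
by rewrite nrmM nrmV ler_wpM2r// invr_ge0 ltW.
Qed.

(** On a disc free of zeros of p, 1/p is a uniform limit of polynomials: it is a
   product of inverses of linear factors. *)
Lemma poly_inverse_approx p r : 0 <= r ->
  (forall t, nrm t <= r -> p.[t] != 0) -> forall e, 0 < e -> e <= 1 ->
  exists q, forall t, nrm t <= r -> nrm (1 - p.[t] * q.[t]) <= e.
Proof.
move=> r0 pn0; have [s ps] := closed_field_poly_normal p.
have a0 : lead_coef p != 0.
  rewrite lead_coef_eq0; apply: contra_neq (pn0 0 _) => [->|].
    by rewrite horner0.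
  by rewrite nrm0.
have sr z : z \in s -> r < nrm z.
  move=> zs; rewrite ltNge; apply/negP => /pn0/negP; apply.
  rewrite ps hornerZ mulf_eq0 (negPf a0) /=.
  by rewrite -[_ == 0]/(root (\prod_(z <- s) ('X - z%:P)) z) root_prod_XsubC.
suff H e : 0 < e -> e <= 1 -> exists q, forall t, nrm t <= r ->
    nrm (1 - (\prod_(z <- s) ('X - z%:P)).[t] * q.[t]) <= e.
  move=> e e0 e1; have [q Hq] := H e e0 e1.
  exists ((lead_coef p)^-1 *: q) => t tr.
  have -> : p.[t] = lead_coef p * (\prod_(z <- s) ('X - z%:P)).[t].
    by rewrite {1}ps hornerZ.
  by rewrite hornerZ mulrACA divff// mul1r Hq.
elim: s sr {ps pn0 a0} e => [|z s IH] sr e e0 e1.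
  by exists 1 => t _; rewrite big_nil !hornerE subrr nrm0 ltW.
have e3 : 0 < e / 3 by rewrite divr_gt0.
have [q1 H1] : exists q, forall t, nrm t <= r ->
    nrm (1 - ('X - z%:P).[t] * q.[t]) <= e / 3.
  by apply: linear_inverse_approx => //; rewrite r0 sr// mem_head.
have [|||q2 H2] := IH _ (e / 3) => //.
- by move=> y ys; apply: sr; rewrite in_cons ys orbT.
- by lra.
exists (q1 * q2) => t tr; rewrite big_cons !hornerM mulrACA.
have h1 := H1 t tr; have h2 := H2 t tr.
move: h1 h2; set x := _ * q1.[t]; set y := _ * q2.[t] => h1 h2.
have -> : 1 - x * y = (1 - x) + (1 - (1 - x)) * (1 - y) by ring.
rewrite (le_trans (nrmD _ _))// nrmM.
have h3 : nrm (1 - (1 - x)) <= 2.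
  by rewrite (le_trans (nrmB _ _))// nrm1; lra.
have := nrm_ge0 (1 - y); have := nrm_ge0 (1 - (1 - x)); nra.
Qed.

Definition entire_expansion (c : R[i] -> R[i]) (a : nat -> R[i]) : Prop :=
  forall r e, 0 < r -> 0 < e -> exists n0, forall n, (n0 <= n)%N ->
    forall t, nrm t <= r -> nrm (c t - \sum_(i < n) a i * t ^+ i) <= e.

Variables (c : R[i] -> R[i]) (a : nat -> R[i]).
Hypothesis ca : entire_expansion c a.

Let approx r e m : 0 < r -> 0 < e -> exists p : {poly R[i]},
  (forall i, (i <= m)%N -> p`_i = a i) /\
  forall t, nrm t <= r -> nrm (c t - p.[t]) <= e.
Proof.
move=> r0 e0; have [n0 H] := ca r0 e0; pose n := maxn n0 m.+1.
exists (\poly_(i < n) a i); split=> [i im|t tr].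
  by rewrite coef_poly /n leq_max ltnS im orbT.
by rewrite horner_poly; apply: H => //; exact: leq_maxl.
Qed.

Let pow_ge r m : 1 <= r -> (0 < m)%N -> r <= r ^+ m.
Proof. by case: m => // m r1 _; rewrite exprS ler_peMr ?exprn_ege1// (le_trans _ r1). Qed.

Lemma bounded_entire : (forall t, nrm (c t) <= 1) ->
  forall m, (0 < m)%N -> a m = 0.
Proof.
move=> c1 m m0; apply/eqP; rewrite -nrm_eq0; apply/eqP.
apply: (@linear_growth_eq0 _ _ 2); first exact: nrm_ge0.
move=> r r1; have r0 : 0 < r by exact: lt_le_trans r1.
have [p [pa pc]] := @approx r 1 m r0 ltr01.
rewrite -(pa m)//; apply: (@le_trans _ _ (nrm p`_m * r ^+ m)).
  by rewrite ler_wpM2l ?nrm_ge0// pow_ge.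
apply: cauchy_coef => // t tr.
have -> : p.[t] = c t - (c t - p.[t]) by ring.
by rewrite (le_trans (nrmB _ _))// -[leRHS]/(1 + 1) lerD// pc// tr.
Qed.

(** Liouville's theorem for 1/c.  On a disc of radius r, c is close to a polynomial
   p, which has no zero there, and 1/p is close to a polynomial q.  Cauchy's
   estimate makes the coefficients of degree m of q and of p q of order r^-m;
   comparing them in p q gives the same order for that of p, by induction on m. *)
Lemma entire_bounded_below : (forall t, 1 <= nrm (c t)) ->
  forall m, (0 < m)%N -> a m = 0.
Proof.
move=> c1 m; have [k] := ubnP m; elim: k m => // k IH m mk m0.
apply/eqP; rewrite -nrm_eq0; apply/eqP.
apply: (@linear_growth_eq0 _ _ (nrm (a 0) * (1 + 6 * nrm (a 0)))).
  exact: nrm_ge0.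
move=> r r1; have r0 : 0 < r by exact: lt_le_trans r1.
have [p [pa pc]] := @approx r 2^-1 m r0 (ltac:(by rewrite invr_gt0)).
have plow t : nrm t <= r -> 2^-1 <= nrm p.[t].
  move=> tr; have := nrmD (c t - p.[t]) p.[t]; rewrite subrK.
  by have := pc t tr; have := c1 t; lra.
have pn0 t : nrm t <= r -> p.[t] != 0.
  by move=> /plow; apply: contraTneq => ->; rewrite nrm0 -ltNge invr_gt0.
have [||q pq] := poly_inverse_approx (ltW r0) pn0 (e := 2^-1).
- by rewrite invr_gt0.
- by lra.
have pqb t : nrm t <= r -> nrm (p.[t] * q.[t]) <= 3 / 2.
  move=> /pq h; have -> : p.[t] * q.[t] = 1 - (1 - p.[t] * q.[t]) by ring.
  by rewrite (le_trans (nrmB _ _))// nrm1; lra.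
have qb t : nrm t <= r -> nrm q.[t] <= 3.
  move=> tr; have := pqb t tr; have := plow t tr; rewrite nrmM.
  by have := nrm_ge0 q.[t]; nra.
have h1 : nrm q`_m * r ^+ m <= 3.
  by apply: cauchy_coef => // t tr; apply: qb; rewrite tr.
have h2 : nrm (p * q)`_m * r ^+ m <= 2^-1.
  have -> : (p * q)`_m = - (1 - p * q)`_m.
    by rewrite coefB coef1 -[m == 0]negbK -lt0n m0 sub0r opprK.
  rewrite nrmN; apply: cauchy_coef => // t tr.
  by rewrite !hornerE; apply: pq; rewrite tr.
have p0 : nrm p`_0 * nrm q`_0 >= 2^-1.
  have := pq 0; rewrite nrm0 => /(_ (ltW r0)); rewrite -!horner_coef0 -nrmM => h.
  have := nrmD (1 - p.[0] * q.[0]) (p.[0] * q.[0]); rewrite subrK nrm1; lra.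
(* by induction hypothesis the middle coefficients of p are zero *)
have E : p`_m * q`_0 = (p * q)`_m - p`_0 * q`_m.
  rewrite coefM; case: (m) m0 mk IH pa => // m' _ mk IH pa.
  rewrite big_ord_recr big_ord_recl /= subn0 subnn big1 ?addr0//; first ring.
  move=> i _; rewrite /bump leq0n add1n pa ?IH ?mul0r//.
    exact: leq_ltn_trans (ltn_ord i) mk.
  exact: leqW (ltn_ord i).
have h3 : nrm p`_m * r ^+ m * nrm q`_0 <= 2^-1 + 3 * nrm p`_0.
  rewrite mulrAC -nrmM E.
  apply: le_trans (ler_wpM2r _ (nrmB _ _)) _; first by rewrite exprn_ge0// ltW.
  rewrite mulrDl lerD// nrmM -mulrA mulrC ler_wpM2r// nrm_ge0//.
have h4 : nrm (a m) * r <= nrm p`_m * r ^+ m.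
  by rewrite pa// ler_wpM2l ?nrm_ge0// pow_ge.
have x0 : 0 <= nrm p`_m * r ^+ m by rewrite mulr_ge0 ?nrm_ge0// exprn_ge0// ltW.
rewrite (pa 0%N)// in p0 h3 *.
apply: le_trans h4 _; move: x0 h3; set x := _ * r ^+ m => x0 h3.
have h5 := ler_wpM2l (nrm_ge0 (a 0)) h3; have h6 := ler_wpM2l x0 p0.
have h7 : nrm (a 0) * (x * nrm q`_0) = x * (nrm (a 0) * nrm q`_0) by ring.
by rewrite h7 in h5; lra.
Qed.

Lemma entire_values m : (0 < m)%N -> a m <> 0 ->
  (exists t, nrm (c t) < 1) /\ (exists t, 1 < nrm (c t)).
Proof.
move=> m0 am; split; apply: contrapT => /forallNP H; apply: am.
  by apply: entire_bounded_below => // t; rewrite leNgt; apply/negP/H.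
by apply: bounded_entire => // t; rewrite leNgt; apply/negP/H.
Qed.

End Liouville.

(** * Taylor expansions of homogeneous polynomials *)
Section Multilinear.
Variables (R : realType) (E : completeNormedModType R[i]).
Local Notation C := (R[i]^o).

Section Form.
Variables (j : nat) (B : ('I_j -> E) -> C).
Hypothesis BL : multilinear_form B.
Implicit Types (T S : {set 'I_j}) (u v : 'I_j -> E).

Let upd u i x : 'I_j -> E := @dfwith _ (fun=> E) u i x.

Let updE u i x l : upd u i x l = if l == i then x else u l.
Proof.
rewrite /upd; have [->|li] := eqVneq l i; first by rewrite dfwithin.
by rewrite dfwithout// eq_sym.
Qed.

Let BD u i x y : B (upd u i (x + y)) = B (upd u i x) + B (upd u i y).
Proof. by have := BL u i 1 x y; rewrite !scale1r. Qed.

Let B0 u i : B (upd u i 0) = 0.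
Proof.
have := BD u i 0 0; rewrite addr0 => /eqP.
by rewrite eq_sym -subr_eq0 addrK => /eqP.
Qed.

Let BZ u i c x : B (upd u i (c *: x)) = c * B (upd u i x).
Proof. by have := BL u i c x 0; rewrite !addr0 [B (_ 0)]B0 addr0. Qed.

Lemma multilinearZ (c : R[i]) T u :
  B (fun i => if i \in T then c *: u i else u i) = c ^+ #|T| * B u.
Proof.
have [n] := ubnP #|T|; elim: n T => // n IH T Tn.
have [->|[i iT]] := set_0Vmem T.
  by rewrite cards0 expr0 mul1r; congr B; apply/funext => i; rewrite inE.
have cT : #|T| = #|T :\ i|.+1 by rewrite (cardsD1 i) iT add1n.
pose w l := if l \in T :\ i then c *: u l else u l.
have -> : (fun l => if l \in T then c *: u l else u l) = upd w i (c *: u i).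
  apply/funext => l; rewrite updE /w finset.in_setD1.
  by have [->|//] := eqVneq l i; rewrite iT.
rewrite BZ (_ : upd w i (u i) = w); last first.
  apply/funext => l; rewrite updE /w finset.in_setD1.
  by have [->|//] := eqVneq l i.
by rewrite IH ?cT ?exprS ?mulrA// -ltnS -cT.
Qed.

(** The set T of the slots where u + v is expanded grows one slot at a time: the
   slot i is removed from T after its entry v i is replaced by u i or left alone. *)
Lemma multilinear_expand T u v :
  B (fun i => if i \in T then u i + v i else v i) =
  \sum_(S : {set _} | S \subset T) B (fun i => if i \in S then u i else v i).
Proof.
have [n] := ubnP #|T|; elim: n T v => // n IH T v Tn.
have [->|[i iT]] := set_0Vmem T.
  rewrite (big_pred1 finset.set0) => [|S]; last by rewrite finset.subset0.
  by congr B; apply/funext => i; rewrite inE.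
have cT : #|T| = #|T :\ i|.+1 by rewrite (cardsD1 i) iT add1n.
have TiC : i \notin T :\ i by rewrite !inE eqxx.
pose w x l := if l \in T :\ i then u l + upd v i x l else upd v i x l.
have wE x : w x = upd (w 0) i x.
  apply/funext => l; rewrite /w !updE finset.in_setD1.
  by have [->|//] := eqVneq l i.
have -> : (fun l => if l \in T then u l + v l else v l) = w (u i + v i).
  apply/funext => l; rewrite /w !updE finset.in_setD1.
  by have [->|//] := eqVneq l i; rewrite iT.
rewrite wE BD -!wE /w !IH -?cT// addrC.
rewrite [RHS](bigID (fun S => i \in S)) /= [RHS]addrC; congr (_ + _).
  apply: eq_big => [S|S ST].
    by rewrite finset.subsetD1.
  congr B; apply/funext => l; rewrite updE.
  have [->|//] := eqVneq l i.
  by have : i \notin S by apply: contra TiC; apply: (fintype.subsetP ST).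
rewrite [RHS](reindex_onto (fun S => i |: S) (fun S => S :\ i)) /=; last first.
  by move=> S /andP[_ iS]; rewrite finset.setD1K.
apply: eq_big => [S|S ST].
  rewrite finset.setU11 andbT finset.subUset finset.sub1set iT /= finset.subsetD1; apply: andb_id2l => _.
  apply/idP/eqP => [iS|<-]; last by rewrite !inE eqxx.
  by rewrite finset.setU1K.
congr B; apply/funext => l; rewrite updE finset.in_setU1.
by have [->|//] := eqVneq l i; case: ifP.
Qed.

Lemma multilinear_restrict m (e : 'I_m -> 'I_j) (a : E) : injective e ->
  multilinear_form (fun y : 'I_m -> E =>
    B (fun i => if [pick l | e l == i] is Some l then y l else a)).
Proof.
move=> eI y l c x z; rewrite -[_ + _ in RHS]/(c * _ + _).
pose w (y : 'I_m -> E) i := if [pick l | e l == i] is Some l then y l else a.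
have wE x' : w (@dfwith _ (fun=> E) y l x') = upd (w y) (e l) x'.
  apply/funext => i; rewrite /w updE; case: pickP => [l' /eqP <-|ne].
    have [/eI ->|ll'] := eqVneq (e l') (e l); first by rewrite dfwithin.
    by rewrite dfwithout//; apply: contra_neq ll' => ->.
  by have [ie|//] := eqVneq i (e l); have := ne l; rewrite ie eqxx.
by rewrite -/(w _) -/(w _) -/(w _) !wE BD BZ.
Qed.

End Form.

Lemma poly_ext (p q : {poly R[i]}) : (forall t, p.[t] = q.[t]) -> p = q.
Proof.
move=> pq; apply/eqP; rewrite -subr_eq0; apply: contraT => /poly_eventually_neq0.
by case=> N /(_ N (leqnn _)); rewrite hornerD hornerN pq subrr eqxx.
Qed.

Let mform m : set (E -> C) := [set Q |
  exists2 B : ('I_m -> E) -> C, multilinear_form B & Q = fun x => B (fun=> x)].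

Let mformD m Q Q' : mform m Q -> mform m Q' -> mform m (Q + Q').
Proof.
move=> [B BL ->] [B' BL' ->]; exists (fun x => B x + B' x) => //.
by move=> x i c u v; rewrite BL BL' /= /GRing.scale /=; ring.
Qed.

Let mform0 m : mform m 0.
Proof.
by exists (fun=> 0) => // x i c u v; rewrite scaler0 addr0.
Qed.

(** The m-homogeneous part of h |-> P (a + h) is the sum, over the sets S of m
   slots, of the values of the multilinear form with h in S and a elsewhere.  The
   form may be discontinuous; the part is continuous because, as a coefficient of
   t |-> P (a + t h), it is a combination of finitely many P (a + i h). *)
Lemma hompoly_translate j (P : E -> C) (a : E) : hompoly j P ->
  exists2 Q : nat -> E -> C, forall m, hompoly m (Q m) &
    forall n h, (j < n)%N -> P (a + h) = \sum_(m < n) Q m h.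
Proof.
move=> [cP [B BL PB]].
pose F (S : {set 'I_j}) h := B (fun i => if i \in S then h else a).
pose Q m : E -> C := \sum_(S : {set 'I_j} | #|S| == m) F S.
have QE m h : Q m h = \sum_(S : {set 'I_j} | #|S| == m) F S h.
  by rewrite /Q fct_sumE.
have QM m : mform m (Q m).
  rewrite /Q; apply: big_ind => [||S /eqP Sm]; [exact: mform0|exact: mformD|].
  pose e (l : 'I_m) : 'I_j := enum_val (cast_ord (esym Sm) l).
  have eI : injective e by move=> l l' /enum_val_inj/cast_ord_inj.
  exists (fun y => B (fun i => if [pick l | e l == i] is Some l then y l else a)).
    exact: multilinear_restrict.
  apply/funext => h; congr B; apply/funext => i; case: pickP => [l /eqP <-|ne].
    by rewrite enum_valP.
  case: ifP => // iS; have := ne (cast_ord Sm (enum_rank_in iS i)).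
  by rewrite /e cast_ordK enum_rankK_in// eqxx.
have QZ m c h : Q m (c *: h) = c ^+ m * Q m h.
  rewrite !QE mulr_sumr; apply: eq_bigr => S /eqP <-; rewrite -multilinearZ//.
  by congr B; apply/funext => i; case: ifP.
have Q0 m : (j < m)%N -> Q m = 0.
  move=> jm; rewrite /Q big_pred0// => S; apply/negbTE.
  by rewrite neq_ltn (leq_ltn_trans _ jm)// -[leqRHS]card_ord max_card.
have PQ n h : (j < n)%N -> P (a + h) = \sum_(m < n) Q m h.
  move=> jn; have := multilinear_expand BL (finset.setTfor 'I_j) (fun=> h) (fun=> a).
  have -> : (fun i => if i \in (finset.setTfor 'I_j) then h + a else a) = fun=> a + h.
    by apply/funext => i; rewrite inE addrC.
  rewrite -[B _]/((fun x => B (fun=> x)) (a + h)) -PB => ->.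
  have cn (S : {set 'I_j}) : (#|S| < n)%N.
    by rewrite (leq_ltn_trans _ jn)// -[leqRHS]card_ord max_card.
  rewrite (eq_bigl xpredT); last by move=> S; rewrite finset.subsetT.
  rewrite (partition_big (fun S : {set 'I_j} => Ordinal (cn S)) xpredT) //=.
  by apply: eq_bigr => m _; rewrite QE; apply: eq_bigl => S; rewrite -val_eqE.
exists Q; last exact: PQ.
move=> m; split; last exact: QM.
have [mj|jm] := leqP m j; last by rewrite (Q0 m jm) => x; exact: cvg_cst.
have [l lE] := interpolation j (@natr_complex_inj R 0).
(* the coefficient of a polynomial is a linear combination of its values *)
have -> : Q m = \sum_(i < j.+1) (fun h => (l i)`_m * P (a + i%:R *: h)).
  apply/funext => h; rewrite fct_sumE.
  pose p := \poly_(i < j.+1) Q i h.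
  have pE t : p.[t] = P (a + t *: h).
    rewrite horner_poly (PQ j.+1)//; apply: eq_bigr => i _.
    by rewrite QZ mulrC.
  have -> : Q m h = p`_m by rewrite coef_poly ltnS mj.
  rewrite {1}(lE p (size_poly _ _)) coef_sum; apply: eq_bigr => i _.
  by rewrite coefZ pE mulrC.
have cont_sum (I : Type) (s : seq I) (G : I -> E -> C) :
    (forall i, continuous (G i)) -> continuous (\sum_(i <- s) G i).
  move=> cG; elim: s => [|i s IH] x; first by rewrite big_nil; exact: cvg_cst.
  by rewrite big_cons; apply: (@cvgD _ C _ (nbhs x)); [exact: cG|exact: IH].
apply: cont_sum => i x; apply: (@cvgZr _ C _ (nbhs x)).
apply: continuous_comp; last exact: cP.
apply: (@cvgD _ E _ (nbhs x)); first exact: cvg_cst.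
by apply: (@cvgZr _ E _ (nbhs x)); exact: cvg_id.
Qed.

End Multilinear.

Section TaylorOfPolynomials.
Variables (R : realType) (E : completeNormedModType R[i]).
Local Notation C := (R[i]^o).
Implicit Types (P : E -> C) (a h x : E) (t : R[i]).

Lemma taylor_hompoly j P a : hompoly j P -> is_taylor P a (taylor P a) /\
  forall n h, (j < n)%N -> P (a + h) = \sum_(m < n) taylor P a m h.
Proof.
move=> hP; have [Q hQ PQ] := hompoly_translate a hP.
suff tQ : is_taylor P a Q by rewrite (taylorE tQ).
split=> //; exists 1 => //; apply/uniform_cvgP => e e0.
exists j.+1 => n jn x _.
by rewrite -(PQ n (x - a))// [a + _]addrC subrK subrr normr0 ltcR.
Qed.

(** Taylor coefficients of P at a are read off the polynomial t |-> P (a + t h). *)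
Lemma taylor_hompoly_coef j P a h (p : {poly R[i]}) m : hompoly j P ->
  (forall t, P (a + t *: h) = p.[t]) -> taylor P a m h = p`_m.
Proof.
move=> hP Pp; have [[hT _] PT] := taylor_hompoly a hP.
pose n := (maxn j m).+1.
have <- : \poly_(i < n) (taylor P a i h : R[i]) = p.
  apply: poly_ext => t; rewrite -Pp (PT n) ?ltnS ?leq_maxl// horner_poly.
  by apply: eq_bigr => i _; rewrite (hompolyZ _ _ (hT i)) mulrC.
by rewrite coef_poly ltnS leq_maxr.
Qed.

Lemma taylor_hompoly_gt j P a m : hompoly j P -> (j < m)%N -> taylor P a m = 0.
Proof.
move=> hP jm; have [[hT _] PT] := taylor_hompoly a hP; apply/funext => h.
rewrite (@taylor_hompoly_coef j P a h (\poly_(i < j.+1) (taylor P a i h : R[i])))//.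
  by rewrite coef_poly ltnS leqNgt jm.
move=> t; rewrite (PT j.+1)// horner_poly.
by apply: eq_bigr => i _; rewrite (hompolyZ _ _ (hT i)) mulrC.
Qed.

Lemma taylor0E j P a x : hompoly j P -> taylor P a 0 x = P a.
Proof.
move=> hP; have [[hT _] _] := taylor_hompoly a hP.
have := @taylor_hompoly_coef j P a 0 (P a : R[i])%:P 0 hP.
rewrite coefC /= => <- => [|t]; last by rewrite scaler0 addr0 hornerC.
by have := hompolyZ 0 x (hT 0%N); rewrite scale0r mul1r => ->.
Qed.

Lemma coef1_affineX (u v : R[i]) j :
  ((u *: 'X + v%:P) ^+ j)`_1 = j%:R * v ^+ j.-1 * u.
Proof.
have := coef_deriv ((u *: 'X + v%:P) ^+ j) 0; rewrite mulr1n => <-.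
rewrite deriv_exp -horner_coef0 hornerMn derivD derivZ derivX derivC !hornerE.
by rewrite -mulr_natl; ring.
Qed.

(** Euler's identity for homogeneous functions *)
Lemma taylor1_ray j P t h : hompoly j P ->
  taylor P (t *: h) 1 h = j%:R * t ^+ j.-1 * P h.
Proof.
move=> hP.
rewrite (@taylor_hompoly_coef _ _ _ _ (P h *: (1 *: 'X + t%:P) ^+ j) 1 hP).
  by rewrite coefZ coef1_affineX; ring.
move=> s; rewrite -scalerDl (hompolyZ _ _ hP) hornerZ horner_exp !hornerE.
by rewrite addrC mulrC.
Qed.

Lemma taylor1_power j (phi : E -> C) (c : R[i]) x a : linear phi ->
  hompoly j (fun x => c * phi x ^+ j) ->
  taylor (fun x => c * phi x ^+ j) x 1 a = c * (j%:R * phi x ^+ j.-1 * phi a).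
Proof.
move=> lphi hP.
rewrite (@taylor_hompoly_coef _ _ _ _
  (c *: ((phi a : R[i]) *: 'X + (phi x : R[i])%:P) ^+ j) 1 hP).
  by rewrite coefZ coef1_affineX.
move=> s; rewrite [x + _]addrC lphi hornerZ horner_exp !hornerE.
by rewrite [s *: _]mulrC.
Qed.

End TaylorOfPolynomials.

Section HolomorphyTypeTheory.
Variables (R : realType) (E : completeNormedModType R[i]).
Variable (Theta : holomorphy_type E).
Local Notation C := (R[i]^o).
Local Notation V := (hspace Theta).
Local Notation N := (hnorm Theta).
Implicit Types (P Q : E -> C) (a x : E) (c : R[i]).

Lemma hspace_add j P Q : V j P -> V j Q -> V j (P + Q).
Proof. by move=> hP hQ; rewrite -[P]scale1r; exact: hspaceD. Qed.

Lemma hspace_opp j P : V j P -> V j (- P).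
Proof. by move=> hP; rewrite -scaleN1r; exact: hspaceZ. Qed.

Lemma hspace_sub j P Q : V j P -> V j Q -> V j (P - Q).
Proof. by move=> hP hQ; apply: hspace_add => //; exact: hspace_opp. Qed.

Lemma hspace_sum j (I : Type) (s : seq I) (F : I -> E -> C) :
  (forall i, V j (F i)) -> V j (\sum_(i <- s) F i).
Proof.
move=> hF; elim/big_ind: _ => //; [exact: hspace_0|exact: hspace_add].
Qed.

Lemma hnormD j P Q : V j P -> V j Q -> N j (P + Q) <= N j P + N j Q.
Proof. by have [_ _ h _ _] := hspace_banach Theta j; exact: h. Qed.

Lemma hnormZ j c P : V j P -> N j (c *: P) = nrm c * N j P.
Proof. by have [_ _ _ h _] := hspace_banach Theta j; exact: h. Qed.

Lemma hnormN j P : V j P -> N j (- P) = N j P.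
Proof. by move=> hP; rewrite -scaleN1r hnormZ// nrmN nrm1 mul1r. Qed.

Lemma hnormB j P Q : V j P -> V j Q -> N j (P - Q) <= N j P + N j Q.
Proof.
by move=> hP hQ; rewrite -(hnormN hQ); apply: hnormD => //; exact: hspace_opp.
Qed.

Lemma scaled_hdiff (f : E -> C) a m :
  (m`!%:R : C)^-1 *: hdiff m f a = taylor f a m.
Proof.
apply/funext => x; rewrite -[LHS]/((m`!%:R : R[i])^-1 * (m`!%:R * taylor f a m x)).
by rewrite mulKf// pnatr_eq0 -lt0n fact_gt0.
Qed.

Lemma hdiff1 (f : E -> C) a : hdiff 1 f a = taylor f a 1.
Proof. by apply/funext => x; rewrite /hdiff mul1r. Qed.

Hypothesis HC : canonical_constants Theta.

Lemma hspace_taylor j P a m : V j P -> V m (taylor P a m) /\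
  N m (taylor P a m) <= 'C(j, m)%:R * N j P * nrm a ^+ (j - m).
Proof.
move=> hP; have [mj|jm] := leqP m j; last first.
  rewrite (taylor_hompoly_gt _ (hspace_hompoly hP) jm) hnorm_0 bin_small// !mul0r.
  by split=> //; exact: hspace_0.
have [h1 h2] := HC mj a hP; split.
  by rewrite -scaled_hdiff; exact: hspaceZ.
rewrite -scaled_hdiff (le_trans h2)// -(bin_fact mj) natrM natrM.
by rewrite mulfK// mulf_neq0// pnatr_eq0 -lt0n fact_gt0.
Qed.

(** The norm of a holomorphy type dominates the sup norm on balls: this is the
   derivative estimate of order 0. *)
Lemma hspace_bound j P x : V j P -> nrm (P x) <= N j P * nrm x ^+ j.
Proof.
move=> hP; have [h1 h2] := hspace_taylor x 0 hP.
have E0 : taylor P x 0 = cst (P x).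
  by apply/funext => y; rewrite (taylor0E _ _ (hspace_hompoly hP)).
by move: h2; rewrite E0 hnorm0 bin0 mul1r subn0.
Qed.

End HolomorphyTypeTheory.

(** * Weights of the norms *)
Section BoundedSums.
Variable R : realType.
Implicit Types (u v : nat -> R).

Definition bounded_sums u : Prop := exists S, forall n, \sum_(j < n) u j <= S.

Lemma bounded_sums_cvgP u : (forall j, 0 <= u j) ->
  bounded_sums u <-> cvgn (series u).
Proof.
move=> u0; have nd : nondecreasing_seq (series u).
  by apply: nondecreasing_series => n _ _; exact: u0.
split=> [[S uS]|cu].
  apply: nondecreasing_is_cvgn => //; exists S => _ [n _ <-].
  by rewrite /series /= big_mkord.
exists (limn (series u)) => n.
by have := nondecreasing_cvgn_le nd cu n; rewrite {1}/series /= big_mkord.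
Qed.

Lemma bounded_sums_le u v M : 0 <= M -> (forall j, u j <= M * v j) ->
  bounded_sums v -> bounded_sums u.
Proof.
move=> M0 uv [S vS]; exists (M * S) => n.
apply: le_trans (ler_wpM2l M0 (vS n)); rewrite mulr_sumr.
by apply: ler_sum => j _; exact: uv.
Qed.

Lemma sum_geometric_half n : \sum_(j < n) 2^-1 ^+ j <= 2 :> R.
Proof.
elim: n => [|n IH]; first by rewrite big_ord0.
rewrite big_ord_recl expr0; under eq_bigr do rewrite lift0 exprS.
by rewrite -mulr_sumr; lra.
Qed.

Lemma eventually_dominated u v N : (forall j, 0 <= u j) -> (forall j, 0 < v j) ->
  (forall j, (N <= j)%N -> u j <= v j) ->
  exists2 M : R, 0 <= M & forall j, u j <= M * v j.
Proof.
move=> u0 v0 uv.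
have q0 j : 0 <= u j / v j by rewrite divr_ge0// ltW.
exists (1 + \sum_(i < N) u i / v i); first by rewrite addr_ge0// sumr_ge0.
move=> j; have [jN|Nj] := ltnP j N.
  rewrite -ler_pdivrMr// (bigD1 (Ordinal jN))//= addrCA lerDl.
  by rewrite addr_ge0// sumr_ge0.
by rewrite (le_trans (uv j Nj))// ler_peMl// ?lerDl ?sumr_ge0// ltW.
Qed.

Lemma natr_eventually_ge (B : R) : exists N, forall j, (N <= j)%N -> B <= j%:R.
Proof.
exists (Num.bound B) => j Nj; have [B0|B0] := leP 0 B; last first.
  by rewrite (le_trans (ltW B0)).
by rewrite (le_trans (ltW (archi_boundP B0)))// ler_nat.
Qed.

Lemma fact_ge_power j : (j%:R / expR 1) ^+ j <= j`!%:R :> R.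
Proof.
case: j => [|j]; first by rewrite fact0 expr0.
have := @expR_ge1Dxn R j.+1%:R j (ler0n _ _).
rewrite expr_div_n ler_pdivrMr ?exprn_gt0 ?expR_gt0// -expRM_natl mulr1 => h.
rewrite mulrC -ler_pdivrMr ?ltr0n ?fact_gt0//; apply: le_trans h.
by rewrite lerDr.
Qed.

End BoundedSums.

Section Weights.
Variables (R : realType) (k : \bar R).
Hypothesis k1 : (1 < k)%E.

(** For finite k the weight is rho^-j beta_j^j with beta_j = (j/(ke))^(1/k), and
   beta_j = 1 for k = +oo.  Two facts on the growth of beta_j matter: it is
   o(j/e), because k > 1, and it tends to infinity when k is finite. *)
Lemma exp_weight_factor : exists beta : nat -> R,
  [/\ forall j, (0 < j)%N -> 0 < beta j,
      forall rho j, exp_weight k rho j = rho ^- j * beta j ^+ j,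
      forall c, exists N, forall j, (N <= j)%N -> c * beta j <= j%:R / expR 1 &
      k = +oo%E \/ k \is a fin_num /\
        forall c, exists N, forall j, (N <= j)%N -> c <= beta j].
Proof.
have e0 : 0 < expR 1 :> R by exact: expR_gt0.
rewrite /exp_weight; case: k k1 => [r| |//].
  rewrite lte_fin => r1; have r0 : 0 < r by exact: lt_trans r1.
  have re0 : 0 < r * expR 1 by rewrite mulr_gt0.
  exists (fun j => (j%:R / (r * expR 1)) `^ r^-1); split.
  - by move=> j j0; rewrite powR_gt0// divr_gt0// ltr0n.
  - move=> rho j; congr (_ * _).
    by rewrite [j%:R / r]mulrC powRrM powR_mulrn ?powR_ge0.
  - move=> c; pose d := 1 - r^-1.
    have d0 : 0 < d by rewrite subr_gt0 invf_lt1.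
    have [N HN] := natr_eventually_ge (`|c| `^ d^-1 * expR 1).
    exists (maxn N 1) => j; rewrite geq_max => /andP[Nj j1].
    set y := j%:R / expR 1.
    have y0 : 0 < y by rewrite divr_gt0// ltr0n.
    have [d0' y0' rV0] : [/\ 0 <= d, 0 <= y & 0 <= r^-1].
      by rewrite invr_ge0 !ltW.
    have cy : `|c| <= y `^ d.
      rewrite -[leLHS]powRr1// -(mulVf (lt0r_neq0 d0)) powRrM.
      apply: ge0_ler_powR; rewrite ?nnegrE ?powR_ge0//.
      by rewrite /y ler_pdivlMr// HN.
    have ry : (j%:R / (r * expR 1)) `^ r^-1 <= y `^ r^-1.
      apply: ge0_ler_powR; rewrite ?nnegrE ?divr_ge0// ?(ltW re0)//.
      by rewrite ler_wpM2l// lef_pV2 ?posrE// ler_peMl ?ltW.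
    apply: (@le_trans _ _ (`|c| * y `^ r^-1)).
      apply: le_trans (ler_wpM2l (normr_ge0 c) ry).
      by rewrite ler_wpM2r ?powR_ge0// ler_norm.
    have yE : y `^ d * y `^ r^-1 = y.
      by rewrite -powRD ?subrK ?powRr1// (gt_eqF y0) implybT.
    by rewrite -[leRHS]yE ler_wpM2r ?powR_ge0.
  - right; split=> // c; have [N HN] := natr_eventually_ge (`|c| `^ r * (r * expR 1)).
    exists N => j Nj; rewrite (le_trans (ler_norm c))//.
    have -> : `|c| = (`|c| `^ r) `^ r^-1.
      by rewrite -powRrM mulfV ?powRr1// gt_eqF.
    apply: ge0_ler_powR; rewrite ?nnegrE ?powR_ge0 ?invr_ge0 ?divr_ge0 ?(ltW r0)// ?(ltW re0)//.
    by rewrite ler_pdivlMr// HN.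
move=> _; exists (fun=> 1); split=> //.
- by move=> rho j; rewrite expr1n.
- move=> c; have [N HN] := natr_eventually_ge (c * expR 1).
  by exists N => j Nj; rewrite mulr1 ler_pdivlMr// HN.
- by left.
Qed.

Lemma exp_weight_gt0 rho j : 0 < rho -> 0 < exp_weight k rho j.
Proof.
have [b [b0 -> _ _]] := exp_weight_factor => r0.
apply: mulr_gt0; first by rewrite invr_gt0 exprn_gt0.
by case: j => [|j]; rewrite ?expr0// exprn_gt0 ?b0.
Qed.

(** As j! >= (j/e)^j and beta_j = o(j/e), the coefficients of the exponential
   function decay faster than any weight grows; this puts exp(phi) in the space. *)
Lemma exp_weight_fact rho s : 0 < rho -> 0 <= s ->
  bounded_sums (fun j => exp_weight k rho j * (s ^+ j / j`!%:R)).
Proof.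
move=> r0 s0; have [b [b0 wE bN _]] := exp_weight_factor.
have [N HN] := bN (2 * s / rho).
have w0 j := ltW (exp_weight_gt0 j r0).
have [|||M M0 HM] := @eventually_dominated _
  (fun j => exp_weight k rho j * (s ^+ j / j`!%:R)) (fun j => 2^-1 ^+ j) N.
- by move=> j; rewrite mulr_ge0// divr_ge0// exprn_ge0.
- by move=> j; rewrite exprn_gt0// invr_gt0.
- move=> j Nj; rewrite mulrA ler_pdivrMr ?ltr0n ?fact_gt0//.
  rewrite exprVn ler_pdivlMl ?exprn_gt0// wE.
  have -> : 2 ^+ j * (rho ^- j * b j ^+ j * s ^+ j) = (2 * s / rho * b j) ^+ j.
    by rewrite !exprMn exprVn; ring.
  apply: le_trans (fact_ge_power R j).
  have bj : 0 <= b j ^+ j.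
    by have := w0 j; rewrite wE pmulr_rge0// invr_gt0 exprn_gt0.
  case: j Nj bj => [|j] Nj bj; first by rewrite !expr0.
  apply: lerXn2r; rewrite ?nnegrE ?divr_ge0 ?expR_ge0//; last exact: HN.
  by rewrite mulr_ge0 ?(ltW (b0 _ _))// divr_ge0 ?mulr_ge0// ltW.
by apply: (bounded_sums_le M0 HM); exists 2; exact: sum_geometric_half.
Qed.

End Weights.

(** * Series in a holomorphy type *)
Section Convergence.
Variables (R : realType) (E : completeNormedModType R[i]).
Variable (Theta : holomorphy_type E).
Local Notation C := (R[i]^o).
Local Notation V := (hspace Theta).
Local Notation N := (hnorm Theta).
Implicit Types (P Q : E -> C) (a h x : E).

Lemma cvg_nrmP (u : nat -> C) (l : C) : u @ \oo --> l <->
  forall e : R, 0 < e -> exists n0, forall n, (n0 <= n)%N -> nrm (l - u n) < e.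
Proof.
split=> [/cvgrPdist_lt ul e e0|H].
  have /ul[n0 _ H] : 0 < e%:C :> R[i] by rewrite ltcR.
  by exists n0 => n nn; have := H n nn; rewrite /= -nrmE ltcR.
apply/cvgrPdist_lt => e e0; have eE := pos_complex_real e0.
have [|n0 H0] := H (complex.Re e); first by rewrite -ltcR eE.
by exists n0 => // n nn; rewrite /= -nrmE -eE ltcR H0.
Qed.

Lemma nrm_cvg_le (u : nat -> C) (l : C) (B : R) : u @ \oo --> l ->
  (forall n, nrm (u n) <= B) -> nrm l <= B.
Proof.
move=> /cvg_nrmP ul uB; apply/ler_addgt0Pr => e /ul[n H].
have := H n (leqnn n); rewrite -[l in leLHS](subrK (u n)) => h.
by rewrite (le_trans (nrmD _ _))// addrC lerD// ltW.
Qed.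

Lemma cvg_complex_unique (u : nat -> C) (l l' : C) :
  u @ \oo --> l -> u @ \oo --> l' -> l = l'.
Proof.
move=> ul ul'; apply/eqP; rewrite -subr_eq0 -nrm_eq0 eq_le nrm_ge0 andbT.
apply: (nrm_cvg_le (cvgB ul ul')) => n.
by rewrite -[X in nrm X]/(u n - u n) subrr nrm0.
Qed.

Lemma power_series_eq0 (c : nat -> C) (d : R) : 0 < d ->
  (forall s : R, 0 < s <= d ->
    (fun n => \sum_(i < n) c i * s%:C ^+ i) @ \oo --> (0 : C)) ->
  forall m, c m = 0.
Proof.
move=> d0 H m; apply: (@vanish_coef0 _ d%:C (c : nat -> R[i])); first by rewrite ltcR.
move=> t tp td e ep.
have tE := pos_complex_real tp; have eE := pos_complex_real ep.
move: tp td ep; rewrite -tE -eE !ltcR lecR.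
move: (complex.Re t) (complex.Re e) => t' e' t0 td e0.
have t'd : 0 < t' <= d by rewrite t0.
have /cvg_nrmP/(_ e' e0)[n0 Hn] := H t' t'd.
by exists n0 => n nn; have := Hn n nn; rewrite sub0r nrmN -nrmE ltcR.
Qed.

Lemma cvg_finite_sum n (u : nat -> nat -> C) (l : nat -> C) :
  (forall m, u m @ \oo --> l m) ->
  (fun J => \sum_(m < n) u m J) @ \oo --> (\sum_(m < n) l m : C).
Proof.
move=> ul; elim: n => [|n IH].
  rewrite big_ord0 (_ : (fun J => _) = cst 0); first exact: cvg_cst.
  by apply/funext => J; rewrite big_ord0.
rewrite big_ord_recr (_ : (fun J => _) = (fun J => \sum_(m < n) u m J) + u n).
  by apply: cvgD; [exact: IH|exact: ul].
by apply/funext => J; rewrite big_ord_recr.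
Qed.

Lemma hspace_series m (u : nat -> E -> C) : (forall j, V m (u j)) ->
  bounded_sums (fun j => N m (u j)) -> exists2 Q, V m Q &
    forall e : R, 0 < e -> exists n0, forall n, (n0 <= n)%N ->
      N m (\sum_(j < n) u j - Q) < e.
Proof.
move=> Vu /bounded_sums_cvgP us; have {us} : cvgn (series (fun j => N m (u j))).
  by apply: us => j; exact: hnorm_ge0.
set s := series _ => cs.
have VT n : V m (\sum_(j < n) u j) by exact: hspace_sum.
have TD p d : N m (\sum_(j < p + d) u j - \sum_(j < p) u j) <= s (p + d)%N - s p.
  elim: d => [|d IH]; first by rewrite addn0 !subrr hnorm_0.
  rewrite addnS big_ord_recr /= {1}/s seriesSr addrAC [leRHS]addrAC.
  apply: le_trans (hnormD (hspace_sub (VT _) (VT _)) (Vu _)) _; exact: lerD.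
have TB p q (e : R) : (forall n, (p <= n)%N -> `|limn s - s n| < e / 2) ->
    (p <= q)%N -> N m (\sum_(j < q) u j - \sum_(j < p) u j) < e.
  move=> H pq; have := H p (leqnn p); have := H q pq.
  rewrite -(subnKC pq) => h1 h2; rewrite (le_lt_trans (TD _ _))//.
  rewrite [e]splitr (le_lt_trans (ler_norm _))//.
  have -> : s (p + (q - p))%N - s p = (limn s - s p) - (limn s - s (p + (q - p))%N).
    by ring.
  by rewrite (le_lt_trans (ler_normB _ _))// ltrD.
have [_ _ _ _ cpl] := hspace_banach Theta m.
have [|e e0|Q VQ QT] := cpl (fun n => \sum_(j < n) u j); first exact: VT.
  have /cvgrPdist_lt/(_ (e / 2 / 2)) := cs; rewrite !divr_gt0// => /(_ isT)[p _ H].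
  exists p => i j pi pj.
  have -> : \sum_(l < i) u l - \sum_(l < j) u l =
    (\sum_(l < i) u l - \sum_(l < p) u l) - (\sum_(l < j) u l - \sum_(l < p) u l).
    by rewrite opprB addrA subrK.
  rewrite (le_lt_trans (hnormB _ _))//; do ?[exact: hspace_sub].
  by rewrite [e]splitr ltrD// TB.
exists Q => // e e0; have /cvgrPdist_lt/(_ e e0)[n0 _ H] := QT.
exists n0 => n nn; have := H n nn; rewrite /= sub0r normrN.
by apply: le_lt_trans; rewrite ler_norm.
Qed.

(** The terms of degree at least n of (a + q s)^j carry a factor q^n. *)
Lemma binomial_tail_le (a s q : R) j n M : 0 <= a -> 0 <= s -> 0 <= q <= 1 ->
  (j < M)%N ->
  \sum_(m < M | (n <= m)%N) 'C(j, m)%:R * a ^+ (j - m) * (q * s) ^+ m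
    <= q ^+ n * (a + s) ^+ j.
Proof.
move=> a0 s0 /andP[q0 q1] jM.
have b0 m : 0 <= 'C(j, m)%:R * a ^+ (j - m) * s ^+ m.
  by rewrite !mulr_ge0// exprn_ge0.
rewrite exprDn (big_ord_widen _ (fun m => a ^+ (j - m) * s ^+ m *+ 'C(j, m)) jM).
rewrite mulr_sumr [leRHS]big_mkcond [leLHS]big_mkcond /=; apply: ler_sum => m _.
have [mj|jm] := leqP m.+1 j.+1; last first.
  by rewrite bin_small// !mul0r; case: ifP.
have -> : a ^+ (j - m) * s ^+ m *+ 'C(j, m) = 'C(j, m)%:R * a ^+ (j - m) * s ^+ m.
  by rewrite -[LHS]mulr_natl mulrA.
case: ifP => nm; last by rewrite mulr_ge0 ?exprn_ge0.
rewrite exprMn mulrCA; apply: ler_wpM2r => //.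
exact: ler_wiXn2l.
Qed.

Hypothesis HC : canonical_constants Theta.

(** The bound is geometric in n, and the sum over j of its other factor converges
   as soon as that of N(P_j) r^j does for r = |a| + 2 |h|: it is the uniform
   estimate behind termwise Taylor expansion. *)
Lemma taylor_remainder j P a h n : V j P ->
  nrm (P (a + h) - \sum_(m < n) taylor P a m h)
    <= 2^-1 ^+ n * (N j P * (nrm a + 2 * nrm h) ^+ j).
Proof.
move=> VP; have [[hT _] PT] := taylor_hompoly a (hspace_hompoly VP).
pose M := maxn n j.+1; have nM : (n <= M)%N by rewrite leq_maxl.
have jM : (j < M)%N by rewrite leq_maxr.
rewrite (PT M h jM) (big_ord_widen _ (fun m => taylor P a m h) nM).
rewrite (bigID (fun m : 'I_M => (m < n)%N)) /= addrAC subrr add0r.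
rewrite (le_trans (nrm_sum _ _ _))// mulrCA.
have h2 : 0 <= 2 * nrm h by rewrite mulr_ge0 ?nrm_ge0.
have q1 : 0 <= (2^-1 : R) <= 1 by rewrite invr_ge0 ler0n invf_le1 ?ler1n.
apply: le_trans (ler_wpM2l (hnorm_ge0 VP)
  (binomial_tail_le n (nrm_ge0 a) h2 q1 jM)).
rewrite mulKf ?pnatr_eq0//.
rewrite mulr_sumr (eq_bigl (fun m : 'I_M => (n <= m)%N)); last first.
  by move=> m; rewrite -leqNgt.
apply: ler_sum => m _; have [V1 N1] := hspace_taylor HC a m VP.
apply: le_trans (hspace_bound HC h V1) _.
apply: le_trans (ler_wpM2r _ N1) _; first by rewrite exprn_ge0 ?nrm_ge0.
by rewrite le_eqVlt; apply/orP; left; apply/eqP; ring.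
Qed.

Lemma hspace_series_cvg m (u : nat -> E -> C) Q x : (forall j, V m (u j)) ->
  V m Q -> (forall e : R, 0 < e -> exists n0, forall n, (n0 <= n)%N ->
      N m (\sum_(j < n) u j - Q) < e) ->
  (fun n => \sum_(j < n) u j x) @ \oo --> (Q x : C).
Proof.
move=> Vu VQ H; apply/cvg_nrmP => e e0.
have x0 : 0 < nrm x ^+ m + 1 by rewrite ltr_wpDl// exprn_ge0 ?nrm_ge0.
have [n0 Hn] := H (e / (nrm x ^+ m + 1)) (divr_gt0 e0 x0).
exists n0 => n nn; rewrite nrmC.
have VT : V m (\sum_(j < n) u j - Q) by apply: hspace_sub => //; exact: hspace_sum.
have -> : \sum_(j < n) u j x - Q x = (\sum_(j < n) u j - Q) x.
  by rewrite -[RHS]/((\sum_(j < n) u j) x - Q x) fct_sumE.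
rewrite (le_lt_trans (hspace_bound HC x VT))//.
have := Hn n nn; rewrite ltr_pdivlMr// => h.
rewrite (le_lt_trans _ h)// ler_wpM2l ?hnorm_ge0// lerDl//.
Qed.

End Convergence.

(** * Elements of the Exp space as sequences of coefficients *)
Section ExpSpaceCoefficients.
Variables (R : realType) (E : completeNormedModType R[i]).
Variables (Theta : holomorphy_type E) (k : \bar R) (A : {nonneg R}).
Hypothesis k1 : (1 < k)%E.
Local Notation C := (R[i]^o).
Local Notation V := (hspace Theta).
Local Notation N := (hnorm Theta).
Local Notation w := (exp_weight k).
Local Notation dom := (exp_dom k A).
Local Notation X := (exp_space Theta k A).
Implicit Types (P : nat -> E -> C) (a h x : E) (f g : X).

Lemma ball_nrm (a x : E) (r : R) : ball a r%:C x <-> nrm (x - a) < r.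
Proof. by rewrite nrmC -ball_normE /ball_ /= -nrmE ltcR. Qed.

(** Around a point of the domain, powers of the radius are dominated by some
   weight, so that the coefficients of an element of the space are summable
   against them: this is how the growth condition gives convergence on the whole
   domain. *)
Lemma exp_dom_radius x : dom x -> exists r, [/\ nrm x < r,
  forall y : E, nrm y < r -> dom y &
  exists rho M : R, [/\ A%:num < rho, 0 <= M & forall j, r ^+ j <= M * w rho j]].
Proof.
have A0 : 0 <= A%:num by [].
have [b [b0 wE _ [kE|[kfin bN]]]] := exp_weight_factor k1.
  have small r : 0 < r -> A%:num < r^-1 -> exists rho M : R,
      [/\ A%:num < rho, 0 <= M & forall j, r ^+ j <= M * w rho j].
    move=> r0 Ar; exists r^-1, 1; split=> // j.
    by rewrite mul1r /exp_weight kE mulr1 exprVn invrK.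
  have -> : dom = exp_dom +oo%E A by rewrite kE.
  rewrite /exp_dom; case: eqP => [AE _|/eqP An0].
    have r0 : 0 < nrm x + 1 by rewrite ltr_wpDl ?nrm_ge0.
    exists (nrm x + 1); split=> //; first by rewrite ltrDl.
    by apply: (small _ r0); rewrite AE invr_gt0.
  have Ap : 0 < A%:num by rewrite lt_def An0.
  move=> /ball_nrm; rewrite subr0 => xA.
  pose r := (nrm x + (A%:num)^-1) / 2.
  have rA : r < A%:num^-1 by rewrite midf_lt.
  have xr : nrm x < r by rewrite midf_lt.
  have r0 : 0 < r by exact: le_lt_trans (nrm_ge0 x) xr.
  exists r; split=> //.
    by move=> y yr; apply/ball_nrm; rewrite subr0 (lt_trans yr).
  by apply: (small _ r0); rewrite -[ltLHS]invrK ltf_pV2// posrE invr_gt0.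
move=> dx; have r0 : 0 < nrm x + 1 by rewrite ltr_wpDl ?nrm_ge0.
have rho0 : 0 < A%:num + 1 by rewrite ltr_wpDl.
exists (nrm x + 1); split; first by rewrite ltrDl.
  by rewrite /exp_dom; case: k kfin.
have [n Hn] := bN ((nrm x + 1) * (A%:num + 1)).
have [|||M M0 HM] := @eventually_dominated _
  (fun j => (nrm x + 1) ^+ j) (fun j => w (A%:num + 1) j) n.
- by move=> j; rewrite exprn_ge0// ltW.
- by move=> j; exact: exp_weight_gt0.
- move=> j nj; rewrite wE mulrC -ler_pdivrMr ?invr_gt0 ?exprn_gt0//.
  rewrite invrK -exprMn lerXn2r ?nnegrE ?Hn//.
    by rewrite ltW// mulr_gt0.
  by apply: le_trans (Hn _ nj); rewrite ltW// mulr_gt0.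
by exists (A%:num + 1), M; split=> //; rewrite ltrDl.
Qed.

Lemma rho_gt0 (rho : R) : A%:num < rho -> 0 < rho.
Proof. exact: le_lt_trans. Qed.

(** The growth condition, stated in the same way for finite k and for k = +oo *)
Definition admissible P : Prop := (forall j, V j (P j)) /\
  forall rho : R, A%:num < rho -> bounded_sums (fun j => w rho j * N j (P j)).

Lemma taylor_normE (f : E -> C) j : taylor_norm Theta f j = N j (taylor f 0 j).
Proof. by rewrite /taylor_norm scaled_hdiff. Qed.

(** For k = +oo this is the root test. *)
Lemma exp_growthP (f : E -> C) : (forall j, V j (taylor f 0 j)) ->
  exp_growth Theta k A f <-> admissible (taylor f 0).
Proof.
move=> Vf; have t0 j : 0 <= taylor_norm Theta f j.
  by rewrite taylor_normE hnorm_ge0.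
have wt0 rho j : A%:num < rho -> 0 <= w rho j * taylor_norm Theta f j.
  by move=> /rho_gt0 r0; rewrite mulr_ge0// ltW// exp_weight_gt0.
rewrite /admissible (_ : (forall rho : R, _) <->
   forall rho : R, A%:num < rho -> cvgn (series (exp_series Theta k rho f))).
  have [kfin|kinf] := boolP (k \is a fin_num).
    rewrite /exp_growth; case: (k) kfin => // r _; split=> [H|[_ H]] //.
  have kE : k = +oo%E by case: (k) k1 kinf.
  have gE : exp_growth Theta k A f <->
      (limn_esup (fun j => ((taylor_norm Theta f j) `^ (j%:R^-1))%:E) <= A%:num%:E)%E.
    by rewrite /exp_growth kE.
  rewrite gE (limn_esup_rootP A t0) kE.
  split=> [H|[_ H]]; [split=> // rho Ar|move=> rho Ar].
    have Am : A%:num < (A%:num + rho) / 2 by rewrite midf_lt.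
    have mr : (A%:num + rho) / 2 < rho by rewrite midf_lt.
    set s := _ / 2 in Am mr; have s0 := rho_gt0 Am; have r0 := rho_gt0 Ar.
    have [n Hn] := H s Am.
    have ser j : exp_series Theta +oo%E rho f j = rho ^- j * taylor_norm Theta f j.
      by rewrite /exp_series /exp_weight mulr1.
    have [|||M M0 HM] := @eventually_dominated _
      (exp_series Theta +oo%E rho f) (fun j => (s / rho) ^+ j) n.
    - by move=> j; rewrite ser mulr_ge0// invr_ge0 exprn_ge0// ltW.
    - by move=> j; rewrite exprn_gt0// divr_gt0.
    - move=> j nj; rewrite ser expr_div_n mulrC ler_pM2r ?Hn//.
      by rewrite invr_gt0 exprn_gt0.
    apply/bounded_sums_cvgP.
      by move=> j; rewrite ser mulr_ge0// invr_ge0 exprn_ge0// ltW.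
    apply: (bounded_sums_le M0 HM); apply/bounded_sums_cvgP.
      by move=> j; rewrite exprn_ge0// divr_ge0// ltW.
    rewrite (_ : series _ = series (geometric 1 (s / rho))); last first.
      by apply: f_equal; apply/funext => j; rewrite /= mul1r.
    apply: is_cvg_geometric_series.
    rewrite ger0_norm; last by rewrite divr_ge0// ltW.
    by rewrite ltr_pdivrMr// mul1r.
  have r0 := rho_gt0 Ar; have /cvg_series_cvg_0/cvgr0Pnorm_lt/(_ 1 ltr01)[n _ Hn] := H rho Ar.
  exists n => j nj; have := Hn j nj; rewrite /= /exp_series /exp_weight mulr1.
  rewrite ger0_norm; last by rewrite mulr_ge0// invr_ge0 exprn_ge0// ltW.
  by rewrite mulrC ltr_pdivrMr ?exprn_gt0// mul1r => /ltW.
have wE rho : (fun j => w rho j * N j (taylor f 0 j)) = exp_series Theta k rho f.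
  by apply/funext => j; rewrite /exp_series taylor_normE.
split=> H rho Ar; have := H rho Ar; rewrite wE => /bounded_sums_cvgP; apply.
  by move=> j; exact: wt0.
by move=> j; exact: wt0.
Qed.

Lemma exp_coefs_admissible f : admissible (taylor f 0).
Proof.
have /set_mem[_ _ hf gf] := exp_valP f.
by apply/exp_growthP => // j; rewrite -scaled_hdiff; exact: hspaceZ.
Qed.

End ExpSpaceCoefficients.

Section TaylorValue.
Variables (R : realType) (E : completeNormedModType R[i]).
Local Notation C := (R[i]^o).

Lemma is_taylor_value (f : E -> C) a Q x : is_taylor f a Q -> Q 0%N x = f a.
Proof.
move=> [hQ [r r0 /uniform_cvgP fQ]].
have Q0 : Q 0%N x = Q 0%N 0.
  by have := hompolyZ 0 x (hQ 0%N); rewrite scale0r mul1r.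
have ra : ball a r%:C a by apply: ballxx; rewrite ltcR.
apply/eqP; rewrite eq_sym -subr_eq0 -nrm_eq0 eq_le nrm_ge0 andbT.
apply/ler_addgt0Pr => e e0; have [n0 H] := fQ e e0.
have := H n0.+1 (leqnSn _) a ra; rewrite subrr big_ord_recl big1 => [|i _].
  by rewrite addr0 -Q0 -nrmE ltcR add0r => /ltW.
by have := hompolyZ 0 0 (hQ (lift ord0 i)); rewrite scale0r lift0 expr0n mul0r.
Qed.

End TaylorValue.

Section FunctionsFromCoefficients.
Variables (R : realType) (E : completeNormedModType R[i]).
Variables (Theta : holomorphy_type E) (k : \bar R) (A : {nonneg R}).
Hypothesis k1 : (1 < k)%E.
Hypothesis HC : canonical_constants Theta.
Local Notation C := (R[i]^o).
Local Notation V := (hspace Theta).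
Local Notation N := (hnorm Theta).
Local Notation w := (exp_weight k).
Local Notation dom := (exp_dom k A).
Local Notation X := (exp_space Theta k A).
Implicit Types (a h x : E) (f g : X).

Lemma binomial_term_le (a s : R) j m : 0 <= a -> 0 <= s ->
  'C(j, m)%:R * a ^+ (j - m) * s ^+ m <= (a + s) ^+ j.
Proof.
move=> a0 s0; have [mj|jm] := ltnP m j.+1; last first.
  by rewrite bin_small// !mul0r exprn_ge0// addr_ge0.
rewrite exprDn (bigD1 (Ordinal mj))//= -[in leRHS]mulr_natl mulrA lerDl.
by apply: sumr_ge0 => i _; rewrite mulrn_wge0// mulr_ge0// exprn_ge0.
Qed.

Variable P : nat -> E -> C.
Hypothesis admP : admissible Theta k A P.

Let VP j : V j (P j). Proof. by have [] := admP. Qed.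

Let bounded_on_dom r (rho M : R) : A%:num < rho -> 0 <= M ->
  (forall j, r ^+ j <= M * w rho j) ->
  bounded_sums (fun j => N j (P j) * r ^+ j).
Proof.
move=> Ar M0 rM; have [_ /(_ rho Ar)] := admP; apply: (bounded_sums_le M0).
by move=> j; rewrite mulrC mulrA ler_wpM2r ?hnorm_ge0.
Qed.

(** The Taylor coefficient at a of the sum of the P j is obtained termwise; the
   completeness of the type makes it again a polynomial of the type. *)
Let coef_at a m : exists Q, dom a -> V m Q /\
  forall e : R, 0 < e -> exists n0, forall n, (n0 <= n)%N ->
    N m (\sum_(j < n) taylor (P j) a m - Q) < e.
Proof.
have [da|nda] := pselect (dom a); last by exists 0.
have Vu j : V m (taylor (P j) a m) by have [] := hspace_taylor HC a m (VP j).
suff /(hspace_series Vu)[Q VQ HQ] : bounded_sums (fun j => N m (taylor (P j) a m)).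
  by exists Q.
have [r [ar _ [rho [M [Ar M0 rM]]]]] := exp_dom_radius k1 da.
have s0 : 0 < r - nrm a by rewrite subr_gt0.
have sm : 0 <= (r - nrm a) ^- m by rewrite invr_ge0 exprn_ge0// ltW.
apply: (bounded_sums_le sm _ (bounded_on_dom Ar M0 rM)) => j.
have [_ N1] := hspace_taylor HC a m (VP j); apply: (le_trans N1).
rewrite mulrC -[leRHS]mulrC ler_pdivlMr ?exprn_gt0//.
have -> : nrm a ^+ (j - m) * ('C(j, m)%:R * N j (P j)) * (r - nrm a) ^+ m =
  N j (P j) * ('C(j, m)%:R * nrm a ^+ (j - m) * (r - nrm a) ^+ m) by ring.
apply: ler_wpM2l; first exact: hnorm_ge0.
apply: le_trans (binomial_term_le j m (nrm_ge0 a) (ltW s0)) _.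
by rewrite addrC subrK.
Qed.

Let Q a m : E -> C := projT1 (cid (coef_at a m)).

Let QP a m : dom a -> V m (Q a m) /\
  forall e : R, 0 < e -> exists n0, forall n, (n0 <= n)%N ->
    N m (\sum_(j < n) taylor (P j) a m - Q a m) < e.
Proof. exact: (projT2 (cid (coef_at a m))). Qed.

Let Q_cvg a m h : dom a ->
  (fun n => \sum_(j < n) taylor (P j) a m h) @ \oo --> (Q a m h : C).
Proof.
move=> da; have [VQ HQ] := QP m da; have Vu j : V m (taylor (P j) a m) by have [] := hspace_taylor HC a m (VP j).
exact: (@hspace_series_cvg _ _ _ HC m (fun j => taylor (P j) a m) _ h Vu VQ HQ).
Qed.

Let F : E -> C := patch (fun=> 0) dom (fun x => Q x 0 0).

Let F_cvg x : dom x -> (fun n => \sum_(j < n) P j x) @ \oo --> (F x : C).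
Proof.
move=> dx; rewrite /F patchT; last exact: mem_set.
have := @Q_cvg x 0 0 dx.
under [X in X @ \oo --> _ -> _]funext => n.
  by under eq_bigr => j _ do rewrite (taylor0E _ _ (hspace_hompoly (VP j))); over.
by [].
Qed.

(** For each n, the remainder of order n of F is the limit of those of the partial
   sums, so the bound 2^-n S of [taylor_remainder] passes to it. *)
Let F_taylor a : dom a -> is_taylor F a (Q a).
Proof.
move=> da; have [r [ar rdom [rho [M [Ar M0 rM]]]]] := exp_dom_radius k1 da.
have [S HS] := bounded_on_dom Ar M0 rM.
have S0 : 0 <= S by have := HS 0%N; rewrite big_ord0.
have s0 : 0 < (r - nrm a) / 2 by rewrite divr_gt0// subr_gt0.
split; first by move=> m; have [VQ _] := QP m da; exact: hspace_hompoly VQ.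
exists ((r - nrm a) / 2) => //; apply/uniform_cvgP => e e0.
have [|n0 Hn] := @expr_small _ (2^-1) (e / (S + 1)) _ (divr_gt0 e0 (ltr_wpDl S0 ltr01)).
  by rewrite invr_ge0// ler0n invf_lt1 ?ltr1n.
exists n0 => n nn x /ball_nrm; set h := x - a => hs.
have xE : x = a + h by rewrite addrC subrK.
have ahr : nrm a + 2 * nrm h <= r by lra.
have dx : dom x.
  apply: rdom; rewrite xE (le_lt_trans (nrmD _ _))//.
  by have := nrm_ge0 h; lra.
rewrite -nrmE ltcR.
apply: (@le_lt_trans _ _ (2^-1 ^+ n * S)); last first.
  have := Hn n nn; rewrite ltr_pdivlMr ?(ltr_wpDl S0)// mulrDr mulr1.
  by apply: le_lt_trans; rewrite lerDl exprn_ge0// invr_ge0.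
(* u J is the remainder of order n of the J-th partial sum *)
pose u J := \sum_(j < J) P j x - \sum_(m < n) \sum_(j < J) taylor (P j) a m h.
apply: (@nrm_cvg_le _ u).
  apply: cvgB; first exact: F_cvg.
  apply: (@cvg_finite_sum _ n (fun m J => \sum_(j < J) taylor (P j) a m h)
    (fun m => Q a m h)) => m.
  exact: Q_cvg.
move=> J; rewrite /u exchange_big /= -sumrB xE.
apply: le_trans (nrm_sum _ _ _) _.
apply: (@le_trans _ _ (2^-1 ^+ n * \sum_(j < J) N j (P j) * r ^+ j)); last first.
  by rewrite ler_wpM2l// exprn_ge0// invr_ge0.
rewrite mulr_sumr; apply: ler_sum => j _.
apply: le_trans (taylor_remainder HC a h n (VP j)) _.
apply: ler_wpM2l; first by rewrite exprn_ge0// invr_ge0.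
apply: ler_wpM2l; first exact: hnorm_ge0.
apply: lerXn2r; rewrite ?nnegrE//; first by rewrite addr_ge0 ?mulr_ge0 ?nrm_ge0.
by rewrite (le_trans (nrm_ge0 a))// ltW.
Qed.

Let F_coef j : taylor F 0 j = P j.
Proof.
have d0 := exp_dom0 E k A.
rewrite (taylorE (F_taylor d0)); apply/funext => h.
suff H : (fun n => \sum_(i < n) taylor (P i) 0 j h) @ \oo --> (P j h : C).
  exact: (cvg_complex_unique (@Q_cvg 0 j h d0) H).
have tE i : taylor (P i) 0 j h = if i == j then P j h else 0.
  rewrite (@taylor_hompoly_coef _ _ i _ _ _ ((P i h : R[i]) *: 'X^i) j).
  - rewrite coefZ coefXn eq_sym; have [->|_] := eqVneq i j; first by rewrite mulr1.
    by rewrite mulr0.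
  - exact: hspace_hompoly (VP i).
  - move=> t; rewrite add0r (hompolyZ _ _ (hspace_hompoly (VP i))).
    by rewrite hornerZ hornerXn mulrC.
apply/cvg_nrmP => e e0; exists j.+1 => n jn.
rewrite (bigD1 (Ordinal jn))//= tE eqxx big1 ?addr0 ?subrr ?nrm0// => i ij.
by rewrite tE ifN.
Qed.

(** Admissible sequences are the sequences of Taylor coefficients at 0 of elements
   of the space, and these elements can be differentiated termwise. *)
Lemma exp_space_of_coefs : exists f : X, (forall j, taylor f 0 j = P j) /\
  forall x, dom x -> forall m h,
    (fun n => \sum_(j < n) taylor (P j) x m h) @ \oo --> (taylor f x m h : C).
Proof.
have FX : F \in exp_pred Theta k A.
  apply: mem_set; split.
  - by move=> a da; exists (Q a); exact: F_taylor.
  - by move=> x dx; rewrite /F /patch memNset.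
  - by move=> j; rewrite /hdiff F_coef; apply: (hspaceZ (j`!%:R : C)).
  - apply/exp_growthP => // [j|]; first by rewrite F_coef.
    by have -> : taylor F 0 = P by apply/funext => j; exact: F_coef.
exists (ExpSpace FX); split; first exact: F_coef.
by move=> x dx m h /=; rewrite (taylorE (F_taylor dx)); exact: Q_cvg.
Qed.

End FunctionsFromCoefficients.

(** * Uniqueness of the coefficients and norms *)
Section IdentityTheorem.
Variables (R : realType) (E : completeNormedModType R[i]).
Local Notation C := (R[i]^o).
Implicit Types (f : E -> C) (a x y : E) (P : nat -> E -> C).

Lemma taylor_vanish_on_ray f a P y : is_taylor f a P ->
  (exists2 d : R, 0 < d & forall t : R, 0 < t <= d -> f (a + t%:C *: y) = 0) ->
  forall m, P m y = 0.
Proof.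
move=> [hP [r r0 /uniform_cvgP fP]] [d d0 fd] m.
have y1 : 0 < nrm y + 1 by rewrite ltr_wpDl ?nrm_ge0.
pose t0 : R := Num.min d (r / (nrm y + 1)).
have t00 : 0 < t0 by rewrite lt_min d0 divr_gt0.
apply: (@power_series_eq0 _ (fun i => P i y) t0 t00) => t; rewrite le_min => /andP[tp /andP[td tr]].
apply/cvg_nrmP => e ep; have [n0 H] := fP e ep; exists n0 => n nn.
have /(H n nn) : ball a r%:C (a + t%:C *: y).
  apply/ball_nrm; rewrite addrAC subrr add0r nrmZ nrm_real gtr0_norm//.
  move: tr; rewrite ler_pdivlMr// mulrDr mulr1; lra.
rewrite fd ?tp// -nrmE ltcR !sub0r addrAC subrr add0r => h.
have -> : \sum_(i < n) P i y * t%:C ^+ i = \sum_(i < n) P i (t%:C *: y) :> R[i].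
  by apply: eq_bigr => i _; rewrite (hompolyZ _ _ (hP i)) mulrC.
exact: h.
Qed.

Lemma vanish_near_on_ray f a P y : is_taylor f a P -> (forall m, P m y = 0) ->
  exists2 d : R, 0 < d & forall t : R, `|t| < d -> f (a + t%:C *: y) = 0.
Proof.
move=> [hP [r r0 /uniform_cvgP fP]] Py.
have y1 : 0 < nrm y + 1 by rewrite ltr_wpDl ?nrm_ge0.
exists (r / (nrm y + 1)); first by rewrite divr_gt0.
move=> t tr; apply/eqP; rewrite -nrm_eq0 eq_le nrm_ge0 andbT.
apply/ler_addgt0Pr => e e0; rewrite add0r; have [n0 H] := fP e e0.
have /(H n0 (leqnn _)) : ball a r%:C (a + t%:C *: y).
  apply/ball_nrm; rewrite addrAC subrr add0r nrmZ nrm_real.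
  move: tr; rewrite ltr_pdivlMr// mulrDr mulr1; have := normr_ge0 t; lra.
rewrite big1 => [|i _]; first by rewrite subr0 -nrmE ltcR => /ltW.
by rewrite addrAC subrr add0r (hompolyZ _ _ (hP i)) Py mulr0.
Qed.

(** A holomorphic function whose Taylor coefficients at 0 vanish is zero on
   each segment starting at 0: the largest initial part of the segment on which it
   is zero is both open and closed. *)
Lemma identity_on_segment f x :
  (forall t : R, 0 <= t <= 1 -> exists P, is_taylor f (t%:C *: x) P) ->
  taylor f 0 = (fun=> 0) -> f x = 0.
Proof.
move=> fT f0; pose u (t : R) := f (t%:C *: x).
have tD (s t : R) : s%:C *: x + t%:C *: x = (s + t)%:C *: x.
  by rewrite -scalerDl rmorphD.
pose S := [set t | 0 <= t <= 1 /\ forall t', 0 <= t' <= t -> u t' = 0].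
have T0 : is_taylor f 0 (fun=> 0).
  have [P] := fT 0 (ltac:(by rewrite lexx ler01)); rewrite scale0r => TP.
  by rewrite -f0 (taylorE TP).
have S0 : S 0.
  split; rewrite ?lexx ?ler01// => t' /le_anti <-.
  by rewrite /u scale0r -(is_taylor_value 0 T0).
have hS : has_sup S by split; [exists 0|exists 1 => t [/andP[]]].
pose s := sup S.
have s0 : 0 <= s by apply: ub_le_sup => //; case: hS.
have s1 : s <= 1 by apply: ge_sup; [exists 0|move=> t [/andP[]]].
have below t : 0 <= t < s -> u t = 0.
  move=> /andP[t0 ts]; have [t1 [_ H] tt1] := sup_gt hS.1 ts.
  by apply: H; rewrite t0 ltW.
have [P TP] := fT s (ltac:(by rewrite s0 s1)).
have Px m : P m x = 0.
  have [sE|sn0] := eqVneq s 0.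
    move: TP; rewrite sE scale0r => TP.
    by rewrite -(taylorE TP) f0.
  have sp : 0 < s by rewrite lt_def sn0.
  have : P m (- x) = 0.
    apply: (taylor_vanish_on_ray TP); exists s => // t /andP[tp ts].
    have -> : s%:C *: x + t%:C *: - x = (s - t)%:C *: x.
      by rewrite scalerN -scalerBl rmorphB.
    by apply: below; rewrite subr_ge0 ts ltrBlDr ltrDl.
  have [hP _] := TP; rewrite -scaleN1r (hompolyZ _ _ (hP m)) => /eqP.
  by rewrite mulf_eq0 signr_eq0 => /eqP.
have [d d0 near] := vanish_near_on_ray TP Px.
have near_s t : `|t - s| < d -> u t = 0.
  by move=> /near; rewrite tD addrC subrK.
suff s1' : s = 1.
  have := near_s 1; rewrite s1' subrr normr0 => /(_ d0).
  by rewrite /u scale1r.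
apply/eqP; rewrite eq_le s1 leNgt; apply/negP => slt1.
pose t := Num.min 1 (s + d / 2).
have st : s < t by rewrite lt_min slt1 ltrDl divr_gt0.
have : S t.
  split=> [|t' /andP[t0 tt]].
    by rewrite (le_trans s0 (ltW st)) ge_min lexx.
  have [ts|st'] := ltP t' s; first by rewrite below// t0.
  apply: near_s; rewrite ger0_norm ?subr_ge0//.
  by move: tt; rewrite le_min => /andP[_]; lra.
move=> /(ub_le_sup hS.2); rewrite -/s; lra.
Qed.

End IdentityTheorem.

Section ExpSpaceNorms.
Variables (R : realType) (E : completeNormedModType R[i]).
Variables (Theta : holomorphy_type E) (k : \bar R) (A : {nonneg R}).
Hypothesis k1 : (1 < k)%E.
Local Notation C := (R[i]^o).
Local Notation V := (hspace Theta).
Local Notation N := (hnorm Theta).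
Local Notation w := (exp_weight k).
Local Notation dom := (exp_dom k A).
Local Notation X := (exp_space Theta k A).
Implicit Types (a h x : E) (f g : X) (rho : R) (c : R[i]).

Lemma exp_dom_segment x (t : R) : 0 <= t <= 1 -> dom x -> dom (t%:C *: x).
Proof.
move=> /andP[t0 t1]; rewrite /exp_dom; have H s : ball (0 : E) s%:C x ->
    ball (0 : E) s%:C (t%:C *: x).
  move=> /ball_nrm; rewrite subr0 => xs; apply/ball_nrm.
  rewrite subr0 nrmZ nrm_real ger0_norm// (le_lt_trans _ xs)//.
  by rewrite ler_piMl ?nrm_ge0.
by case: k => // [|]; case: ifP => // _; exact: H.
Qed.

Lemma exp_taylor f x : dom x -> is_taylor f x (taylor f x).
Proof.
move=> dx; have /set_mem[hf _ _ _] := exp_valP f.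
by have [P TP] := hf x dx; rewrite (taylorE TP).
Qed.

Lemma exp_outside f x : ~ dom x -> f x = 0.
Proof. by have /set_mem[_ h _ _] := exp_valP f; exact: h. Qed.

Lemma exp_taylorD c f g x m : dom x ->
  taylor (c *: f + g : X) x m = c *: taylor f x m + taylor g x m.
Proof.
by move=> dx; rewrite (taylorE (is_taylorD c (exp_taylor f dx) (exp_taylor g dx))).
Qed.

Lemma exp_coef_inj f g : taylor f 0 = taylor g 0 -> f = g.
Proof.
move=> fg; suff fg0 x : exp_val (f - g) x = 0.
  by apply/eqP; rewrite -subr_eq0; apply/eqP/val_inj/funext => x; exact: fg0.
have [dx|ndx] := pselect (dom x); last exact: exp_outside.
apply: identity_on_segment.
  move=> t t01; exists (taylor (f - g) (t%:C *: x)); apply: exp_taylor.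
  exact: exp_dom_segment.
apply/funext => m.
have -> : f - g = (-1 : R[i]) *: g + f by rewrite scaleN1r addrC.
rewrite exp_taylorD; last exact: exp_dom0.
by rewrite fg scaleN1r addNr.
Qed.

Lemma exp_space_expansion f x m h : canonical_constants Theta -> dom x ->
  (fun n => \sum_(j < n) taylor (taylor f 0 j) x m h) @ \oo --> (taylor f x m h : C).
Proof.
move=> HC dx; have [g [fg cvg]] := exp_space_of_coefs k1 HC (exp_coefs_admissible k1 f).
have <- : g = f by apply: exp_coef_inj; apply/funext => j; exact: fg.
have := cvg x dx m h.
by have -> : taylor g 0 = taylor f 0 by apply/funext => j; exact: fg.
Qed.

Local Notation "`[ f ]_ rho" := (exp_norm Theta k rho f)
  (at level 0, rho at level 2, format "`[ f ]_ rho").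

Lemma exp_coef_hspace f j : V j (taylor f 0 j).
Proof. by have [] := exp_coefs_admissible k1 f. Qed.

Lemma exp_term_ge0 f rho j : A%:num < rho -> 0 <= w rho j * N j (taylor f 0 j).
Proof.
move=> Ar; rewrite mulr_ge0 ?(ltW (exp_weight_gt0 k1 _ (rho_gt0 Ar)))//.
by rewrite hnorm_ge0//; exact: exp_coef_hspace.
Qed.

Lemma exp_seriesE f rho :
  exp_series Theta k rho f = fun j => w rho j * N j (taylor f 0 j).
Proof. by apply/funext => j; rewrite /exp_series taylor_normE. Qed.

Lemma exp_norm_ge_sum f rho n : A%:num < rho ->
  \sum_(j < n) w rho j * N j (taylor f 0 j) <= `[f]_rho.
Proof.
move=> Ar; have [_ /(_ rho Ar)] := exp_coefs_admissible k1 f.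
move=> /bounded_sums_cvgP; rewrite -exp_seriesE => cs.
rewrite /exp_norm; have nd : nondecreasing_seq (series (exp_series Theta k rho f)).
  by apply: nondecreasing_series => j _ _; rewrite exp_seriesE exp_term_ge0.
have := nondecreasing_cvgn_le nd (cs _) n; rewrite {1}/series /= big_mkord exp_seriesE.
by apply => j; exact: exp_term_ge0.
Qed.

Lemma exp_norm_le f rho S : A%:num < rho ->
  (forall n, \sum_(j < n) w rho j * N j (taylor f 0 j) <= S) -> `[f]_rho <= S.
Proof.
move=> Ar H; have [_ /(_ rho Ar)] := exp_coefs_admissible k1 f.
move=> /bounded_sums_cvgP; rewrite -exp_seriesE => cs.
rewrite /exp_norm; apply: limr_le.
  by apply: cs => j; exact: exp_term_ge0.
by near=> n; rewrite /series /= big_mkord exp_seriesE H.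
Unshelve. all: by end_near. Qed.

Lemma exp_coef_le f rho j : A%:num < rho ->
  w rho j * N j (taylor f 0 j) <= `[f]_rho.
Proof.
move=> Ar; apply: le_trans (exp_norm_ge_sum f j.+1 Ar).
by rewrite big_ord_recr lerDr; apply: sumr_ge0 => i _; exact: exp_term_ge0.
Qed.

Lemma exp_norm_ge0 f rho : A%:num < rho -> 0 <= `[f]_rho.
Proof. by move=> Ar; apply: le_trans (exp_coef_le f 0 Ar); exact: exp_term_ge0. Qed.

Lemma exp_normDZ c f g rho : A%:num < rho ->
  `[c *: f + g : X]_rho <= nrm c * `[f]_rho + `[g]_rho.
Proof.
move=> Ar; apply: exp_norm_le => // n.
apply: (@le_trans _ _ (nrm c * (\sum_(j < n) w rho j * N j (taylor f 0 j)) +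
    \sum_(j < n) w rho j * N j (taylor g 0 j))); last first.
  by rewrite lerD// ?ler_wpM2l ?nrm_ge0// exp_norm_ge_sum.
rewrite mulr_sumr -big_split; apply: ler_sum => j _ /=.
rewrite exp_taylorD; last exact: exp_dom0.
have Vf := exp_coef_hspace f j; have Vg := exp_coef_hspace g j.
have w0 := ltW (exp_weight_gt0 k1 j (rho_gt0 Ar)).
rewrite mulrCA -mulrDr ler_wpM2l// -(hnormZ c Vf) hnormD//; exact: hspaceZ.
Qed.

Lemma exp_norm0 rho : A%:num < rho -> `[0 : X]_rho = 0.
Proof.
move=> Ar; apply/eqP; rewrite eq_le exp_norm_ge0// andbT.
apply: exp_norm_le => // n; rewrite big1// => j _.
by rewrite (taylorE (is_taylor0 0)) hnorm_0 mulr0.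
Qed.

Lemma exp_normZ c f rho : A%:num < rho -> `[c *: f : X]_rho <= nrm c * `[f]_rho.
Proof.
by move=> Ar; have := exp_normDZ c f 0 Ar; rewrite addr0 exp_norm0// addr0.
Qed.

Lemma exp_normD f g rho : A%:num < rho -> `[f + g : X]_rho <= `[f]_rho + `[g]_rho.
Proof. by move=> Ar; have := exp_normDZ 1 f g Ar; rewrite scale1r nrm1 mul1r. Qed.

Lemma exp_normN f rho : A%:num < rho -> `[- f : X]_rho = `[f]_rho.
Proof.
move=> Ar; have H g : `[- g : X]_rho <= `[g]_rho.
  by have := exp_normZ (-1) g Ar; rewrite scaleN1r nrmN nrm1 mul1r.
by apply/eqP; rewrite eq_le H -{1}[f]opprK H.
Qed.

Lemma exp_normB f g rho : A%:num < rho -> `[f - g : X]_rho <= `[f]_rho + `[g]_rho.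
Proof. by move=> Ar; rewrite -(exp_normN g Ar) exp_normD. Qed.

Lemma exp_normC f g rho : A%:num < rho -> `[f - g : X]_rho = `[g - f : X]_rho.
Proof. by move=> Ar; rewrite -(exp_normN _ Ar) opprB. Qed.

Lemma exp_norm_triangle f g (h : X) rho : A%:num < rho ->
  `[f - h : X]_rho <= `[f - g : X]_rho + `[g - h : X]_rho.
Proof.
by move=> Ar; apply: le_trans (exp_normD _ _ Ar); rewrite addrA subrK.
Qed.

(** This monotonicity lets a single norm, with rho close to A, replace finitely many
   of them: the topology is that of a sequence of norms. *)
Lemma exp_norm_anti f rho rho' : A%:num < rho -> rho <= rho' -> `[f]_rho' <= `[f]_rho.
Proof.
move=> Ar rr; have Ar' := lt_le_trans Ar rr.
apply: exp_norm_le => // n; apply: le_trans (exp_norm_ge_sum f n Ar).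
apply: ler_sum => j _; apply: ler_wpM2r.
  by rewrite hnorm_ge0//; exact: exp_coef_hspace.
have [b [b0 wE _ _]] := exp_weight_factor k1; rewrite !wE.
have bj : 0 <= b j ^+ j by case: (nat_of_ord j) => [|i]; [rewrite expr0|apply/exprn_ge0/ltW/b0].
have r0 := rho_gt0 Ar; have r0' := rho_gt0 Ar'.
apply: ler_wpM2r => //; rewrite lef_pV2 ?posrE ?exprn_gt0//.
by apply: lerXn2r; rewrite ?nnegrE// ltW.
Qed.

(** The topology is separated, by uniqueness of the coefficients. *)
Lemma exp_norm_eq0 f rho : A%:num < rho -> `[f]_rho = 0 -> f = 0.
Proof.
move=> Ar f0; apply: exp_coef_inj; apply/funext => j.
rewrite [RHS](_ : _ = 0); last by rewrite (taylorE (is_taylor0 0)).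
have w0 := exp_weight_gt0 k1 j (rho_gt0 Ar).
have Vf := exp_coef_hspace f j.
have [_ N0 _ _ _] := hspace_banach Theta j; apply: N0 => //.
apply/eqP; rewrite eq_le hnorm_ge0// andbT -(pmulr_rle0 _ w0) -f0.
exact: exp_coef_le.
Qed.

End ExpSpaceNorms.

(** * Density of the powers of linear forms *)
Section Generators.
Variables (R : realType) (E : completeNormedModType R[i]).
Variables (Theta : holomorphy_type E) (k : \bar R) (A : {nonneg R}).
Hypothesis k1 : (1 < k)%E.
Hypothesis HC : canonical_constants Theta.
Hypothesis Hpi : pi1_holomorphy_type Theta.
Local Notation C := (R[i]^o).
Local Notation V := (hspace Theta).
Local Notation N := (hnorm Theta).
Local Notation w := (exp_weight k).
Local Notation dom := (exp_dom k A).
Local Notation X := (exp_space Theta k A).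
Local Notation dual := (@dual R E).
Local Notation "`[ f ]_ rho" := (exp_norm Theta k rho f)
  (at level 0, rho at level 2, format "`[ f ]_ rho").
Implicit Types (x h : E) (f g : X) (rho s q T : R) (t c : R[i]) (phi : E -> C)
  (P : E -> C) (M : set X).

Definition of_coefs (Q : nat -> E -> C) : X :=
  xget 0 [set f : X | taylor f 0 = Q].

Lemma of_coefsE (Q : nat -> E -> C) : admissible Theta k A Q ->
  taylor (of_coefs Q) 0 = Q.
Proof.
move=> aQ; have [f [fQ _]] := exp_space_of_coefs k1 HC aQ.
rewrite /of_coefs; case: xgetP => [g _ ->//|/(_ f)[]].
by apply/funext => j; exact: fQ.
Qed.

Definition homogeneous j P : X := of_coefs (fun i => if i == j then P else 0).

Let weighted_homogeneous j P n rho : A%:num < rho -> V j P ->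
  \sum_(i < n) w rho i * N i (if i == j :> nat then P else 0) <= w rho j * N j P.
Proof.
move=> Ar VP; have w0 := ltW (exp_weight_gt0 k1 j (rho_gt0 Ar)).
have [jn|nj] := ltnP j n.
  rewrite (bigD1 (Ordinal jn))//= eqxx big1 ?addr0// => i ij.
  by rewrite -val_eqE in ij; rewrite (negPf ij) hnorm_0 mulr0.
rewrite big1 => [|i _]; first by apply: mulr_ge0 => //; exact: hnorm_ge0.
by rewrite ltn_eqF ?hnorm_0 ?mulr0// (leq_trans _ nj).
Qed.

Lemma homogeneousE j P : V j P ->
  taylor (homogeneous j P) 0 = fun i => if i == j then P else 0.
Proof.
move=> VP; apply: of_coefsE; split=> [i|rho Ar].
  by case: eqVneq => [->|_] //; exact: hspace_0.
by exists (w rho j * N j P) => n; exact: weighted_homogeneous.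
Qed.

Lemma exp_norm_homogeneous j P rho : A%:num < rho -> V j P ->
  `[homogeneous j P]_rho <= w rho j * N j P.
Proof.
move=> Ar VP; apply: exp_norm_le => // n.
by rewrite homogeneousE//; exact: weighted_homogeneous.
Qed.

Lemma homogeneousD j c P Q : V j P -> V j Q ->
  homogeneous j (c *: P + Q) = c *: homogeneous j P + homogeneous j Q.
Proof.
move=> VP VQ; apply: exp_coef_inj => //; apply/funext => i.
rewrite exp_taylorD ?homogeneousE//; do ?[exact: exp_dom0|exact: hspaceD].
by case: ifP => // _; rewrite scaler0 addr0.
Qed.

Lemma homogeneous_0 j : homogeneous j 0 = 0.
Proof.
have := homogeneousD 1 (hspace_0 Theta j) (hspace_0 Theta j).
by rewrite !scale1r addr0 => /eqP; rewrite eq_sym -subr_eq0 addrK => /eqP.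
Qed.

Lemma hspace_power phi c j : dual phi -> V j (fun x => c * phi x ^+ j).
Proof.
move=> dphi; have [hf _ _] := Hpi; apply: hf.
exists 1%N, (fun=> c), (fun=> phi); split=> //.
by apply/funext => x; rewrite big_ord1.
Qed.

Definition power phi j : X := homogeneous j (fun x => phi x ^+ j).

Lemma hspace_power1 phi j : dual phi -> V j (fun x => phi x ^+ j).
Proof.
move=> dphi; have := hspace_power 1 j dphi.
by congr (V j _); apply/funext => x; rewrite mul1r.
Qed.

Definition approximable M f : Prop := forall rho (e : R), A%:num < rho -> 0 < e ->
  exists2 g, M g & `[f - g]_rho < e.

Definition closed_subspace M : Prop :=
  [/\ M 0, forall c f g, M f -> M g -> M (c *: f + g) &
      forall f, approximable M f -> M f].

Lemma closed_subspace_sum M n (F : nat -> X) : closed_subspace M ->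
  (forall i, M (F i)) -> M (\sum_(i < n) F i).
Proof.
move=> [M0 MD _] MF; apply: big_ind => // f g Mf Mg.
by rewrite -[f]scale1r; exact: MD.
Qed.

Lemma homogeneous_in_closed_subspace M j P : closed_subspace M ->
  (forall phi, dual phi -> M (power phi j)) -> V j P -> M (homogeneous j P).
Proof.
move=> cM Mphi VP; have [M0 MD Mcl] := cM; have [hf _ dense] := Hpi.
apply: Mcl => rho e Ar e0; have w0 := exp_weight_gt0 k1 j (rho_gt0 Ar).
have [Q fQ PQ] := dense j P VP (e / w rho j) (divr_gt0 e0 w0).
have VQ : V j Q by exact: hf.
exists (homogeneous j Q); last first.
  have -> : homogeneous j P - homogeneous j Q = homogeneous j (P - Q).
    by rewrite addrC -scaleN1r -homogeneousD// scaleN1r addrC.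
  apply: le_lt_trans (exp_norm_homogeneous Ar (hspace_sub VP VQ)) _.
  by rewrite mulrC -ltr_pdivlMr.
have [n [c [phi [dphi QE]]]] := fQ.
have {QE} -> : Q = \sum_(i < n) c i *: (fun x => phi i x ^+ j : C).
  by rewrite QE; apply/funext => x; rewrite fct_sumE.
have Vs m (mn : (m <= n)%N) :
    V j (\sum_(i < m) c (widen_ord mn i) *: (fun x => phi (widen_ord mn i) x ^+ j : C)).
  by apply: hspace_sum => i; apply/hspaceZ/hspace_power1.
elim: n c phi dphi Vs {fQ} => [|n IH] c phi dphi Vs.
  by rewrite big_ord0 homogeneous_0.
rewrite big_ord_recr /= addrC homogeneousD.
- apply: MD; first exact: Mphi.
  by apply: IH => [//|m mn]; apply: hspace_sum => i; apply/hspaceZ/hspace_power1.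
- exact: hspace_power1.
- by apply: hspace_sum => i; apply/hspaceZ/hspace_power1.
Qed.

(** The remainder after n terms is the tail of the series of the norm. *)
Lemma homogeneous_expansion f rho (e : R) : A%:num < rho -> 0 < e ->
  exists n, `[f - \sum_(j < n) homogeneous j (taylor f 0 j)]_rho < e.
Proof.
move=> Ar e0; pose u j := w rho j * N j (taylor f 0 j).
have u0 j : 0 <= u j by exact: exp_term_ge0.
have [n Hn] : exists n, `[f]_rho - e / 2 < \sum_(j < n) u j.
  apply: contrapT => /forallNP H.
  have : `[f]_rho <= `[f]_rho - e / 2.
    by apply: exp_norm_le => // n; rewrite leNgt; apply/negP/H.
  by lra.
exists n; apply: (@le_lt_trans _ _ (e / 2)); last by lra.
have Vf j : V j (taylor f 0 j) by exact: exp_coef_hspace.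
have coefE m : taylor (\sum_(j < m) homogeneous j (taylor f 0 j) : X) 0 =
    fun i => if (i < m)%N then taylor f 0 i else 0.
  elim: m => [|m IH].
    by rewrite big_ord0 (taylorE (is_taylor0 0)); apply/funext => i.
  apply/funext => i; rewrite big_ord_recr /= addrC -[X in X + _]scale1r.
  rewrite exp_taylorD; last exact: exp_dom0.
  rewrite IH homogeneousE// scale1r [in RHS]ltnS [in RHS]leq_eqVlt.
  by have [->|im] := eqVneq i m; rewrite ?ltnn /= ?addr0 ?add0r.
apply: exp_norm_le => // m.
have E0 i : taylor (f - \sum_(j < n) homogeneous j (taylor f 0 j) : X) 0 i =
    if (i < n)%N then 0 else taylor f 0 i.
  rewrite addrC -scaleN1r exp_taylorD; last exact: exp_dom0.
  by rewrite coefE scaleN1r; case: ifP => _; rewrite ?addNr// oppr0 add0r.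
have := exp_norm_ge_sum k1 f (maxn n m) Ar.
rewrite (bigID (fun i : 'I_(maxn n m) => (i < n)%N)) /=.
rewrite -(big_ord_widen _ u (leq_maxl n m)) => h.
apply: (@le_trans _ _ (\sum_(i < maxn n m | ~~ (i < n)%N) u i)); last first.
  by rewrite /u in Hn h *; lra.
rewrite (big_ord_widen _ (fun i => w rho i * N i (taylor (f - \sum_(j < n)
  homogeneous j (taylor f 0 j) : X) 0 i)) (leq_maxr n m)).
rewrite [leLHS]big_mkcond [leRHS]big_mkcond /=; apply: ler_sum => i _.
rewrite E0; have [_|_] := ltnP i n; first by case: ifP => //; rewrite hnorm_0 mulr0.
by case: ifP => // _; exact: u0.
Qed.

(** Elements of the space are limits of their Taylor polynomials, whose terms are
   limits of combinations of powers because the type is of type pi_1. *)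
Lemma total_powers M : closed_subspace M ->
  (forall phi j, dual phi -> M (power phi j)) -> forall f, M f.
Proof.
move=> cM Mphi f; have [_ _ Mcl] := cM; apply: Mcl => rho e Ar e0.
have [n Hn] := homogeneous_expansion f Ar e0; exists (\sum_(j < n)
  homogeneous j (taylor f 0 j)) => //.
apply: (@closed_subspace_sum M n (fun j => homogeneous j (taylor f 0 j))) => // j.
apply: homogeneous_in_closed_subspace => // [phi dphi|]; first exact: Mphi.
exact: exp_coef_hspace.
Qed.

End Generators.

(** * Exponentials of linear forms *)
Section Exponentials.
Variables (R : realType) (E : completeNormedModType R[i]).
Variables (Theta : holomorphy_type E) (k : \bar R) (A : {nonneg R}).
Hypothesis k1 : (1 < k)%E.
Hypothesis HC : canonical_constants Theta.
Hypothesis Hpi : pi1_holomorphy_type Theta.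
Local Notation C := (R[i]^o).
Local Notation V := (hspace Theta).
Local Notation N := (hnorm Theta).
Local Notation w := (exp_weight k).
Local Notation dom := (exp_dom k A).
Local Notation X := (exp_space Theta k A).
Local Notation dual := (@dual R E).
Local Notation "`[ f ]_ rho" := (exp_norm Theta k rho f)
  (at level 0, rho at level 2, format "`[ f ]_ rho").
Implicit Types (x h : E) (f g : X) (rho s q T M : R) (t c : R[i]) (phi : E -> C)
  (b : nat -> R[i]).

Let nball_bounded phi : dual phi ->
  has_sup [set nrm (phi x) | x in [set x : E | nrm x <= 1]].
Proof.
move=> [lphi cphi]; split.
  by exists (nrm (phi 0)), 0 => //=; rewrite nrm0.
have phi0 : phi 0 = 0 := linear_at0 lphi.
have /cvgrPdist_lt/(_ 1 ltr01) := cphi 0; rewrite phi0.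
rewrite -nbhs_ballE => -[e e0 He].
have eE := pos_complex_real e0.
have d0 : 0 < complex.Re e by rewrite -ltcR eE.
move: (complex.Re e) eE d0 => d dE d0; rewrite -dE in He.
exists (2 / d) => _ [x /= x1 <-].
have /He /= : ball (0 : E) d%:C ((d / 2)%:C *: x).
  apply/ball_nrm; rewrite subr0 nrmZ nrm_real ger0_norm ?divr_ge0 ?(ltW d0)//.
  by have := nrm_ge0 x; nra.
rewrite (linear_scale lphi) sub0r normrN -nrmE => h.
have : nrm ((d / 2)%:C * phi x) < 1 by rewrite -ltcR; exact: h.
rewrite nrmM nrm_real ger0_norm ?divr_ge0 ?(ltW d0)// => {}h.
by rewrite ler_pdivlMr// mulrC; lra.
Qed.

Lemma dual_norm_ge0 phi : dual phi -> 0 <= dual_norm phi.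
Proof.
move=> dphi; apply: le_trans (ub_le_sup (nball_bounded dphi).2 _).
  exact: (nrm_ge0 (phi 0)).
by exists 0 => //=; rewrite nrm0.
Qed.

Lemma dual_norm_le phi psi c : dual phi -> dual psi ->
  dual_norm (phi + c *: psi) <= dual_norm phi + nrm c * dual_norm psi.
Proof.
move=> dphi dpsi; apply: ge_sup.
  by exists (nrm ((phi + c *: psi) 0)), 0 => //=; rewrite nrm0.
move=> _ [x /= x1 <-].
apply: (@le_trans _ _ (nrm (phi x) + nrm (c * psi x))); first exact: nrmD.
apply: lerD; first by apply: (ub_le_sup (nball_bounded dphi).2); exists x.
rewrite nrmM ler_wpM2l ?nrm_ge0//.
by apply: (ub_le_sup (nball_bounded dpsi).2); exists x.
Qed.

Lemma dual_lin phi psi c : dual phi -> dual psi -> dual (phi + c *: psi).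
Proof.
move=> [lphi cphi] [lpsi cpsi]; split.
  move=> a u v; rewrite -[LHS]/(phi (a *: u + v) + c * psi (a *: u + v)).
  rewrite lphi lpsi -[RHS]/(a * (phi u + c * psi u) + (phi v + c * psi v)).
  by rewrite /GRing.scale /=; ring.
move=> x; apply: (@cvgD _ C _ (nbhs x)); first exact: cphi.
by apply: (@cvgZr _ C _ (nbhs x)); exact: cpsi.
Qed.

(** The Taylor coefficients of the entire functions of exponential type *)
Definition exponential_type b : Prop :=
  exists s M, [/\ 0 <= s, 0 <= M & forall j, nrm (b j) <= M * (s ^+ j / j`!%:R)].

(** The function x |-> sum_j b_j phi(x)^j; all estimates on the exponentials of one
   line are made on the scalar sequences b. *)
Definition form_series phi b : X :=
  of_coefs Theta k A (fun j x => b j * phi x ^+ j).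

Let form_bound phi rho s : dual phi -> A%:num < rho -> 0 <= s ->
  exists2 S, 0 <= S & forall b M, 0 <= M ->
    (forall j, nrm (b j) <= M * (s ^+ j / j`!%:R)) ->
    forall n, \sum_(j < n) w rho j * N j (fun x => b j * phi x ^+ j) <= M * S.
Proof.
move=> dphi Ar s0; have r0 := rho_gt0 Ar.
have [_ [K K0 HK] _] := Hpi; pose kappa := K * dual_norm phi.
have kappa0 : 0 <= kappa by rewrite mulr_ge0 ?dual_norm_ge0// ltW.
have [S HS] := exp_weight_fact k1 r0 (mulr_ge0 kappa0 s0).
exists S; first by have := HS 0%N; rewrite big_ord0.
move=> b M M0 bM n; apply: le_trans (ler_wpM2l M0 (HS n)).
rewrite mulr_sumr; apply: ler_sum => j _; rewrite mulrCA.
apply: ler_wpM2l; first exact/ltW/exp_weight_gt0.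
apply: le_trans (HK phi (b j) j dphi) _.
have -> : M * ((kappa * s) ^+ j / j`!%:R) =
    K ^+ j * dual_norm phi ^+ j * (M * (s ^+ j / j`!%:R)).
  by rewrite !exprMn -[_ * _ / _]mulrA mulrCA.
by apply: ler_wpM2l => //; rewrite -exprMn exprn_ge0.
Qed.

Lemma form_seriesE phi b : dual phi -> exponential_type b ->
  taylor (form_series phi b) 0 = fun j x => b j * phi x ^+ j.
Proof.
move=> dphi [s [M [s0 M0 bM]]]; apply: of_coefsE => //; split=> [j|rho Ar].
  exact: hspace_power.
by have [S _ H] := form_bound dphi Ar s0; exists (M * S) => n; exact: H.
Qed.

Lemma form_series_norm phi rho s : dual phi -> A%:num < rho -> 0 <= s ->
  exists2 S, 0 <= S & forall b M, 0 <= M ->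
    (forall j, nrm (b j) <= M * (s ^+ j / j`!%:R)) ->
    `[form_series phi b]_rho <= M * S.
Proof.
move=> dphi Ar s0; have [S S0 H] := form_bound dphi Ar s0; exists S => // b M M0 bM.
apply: exp_norm_le => // n; rewrite form_seriesE//; first exact: H.
by exists s, M.
Qed.

Definition exponential phi t : X := form_series phi (fun j => t ^+ j / j`!%:R).

(** phi^i exp(t phi) / i!, the i-th Taylor coefficient at t of the curve
   t |-> exp(t phi) *)
Definition exp_jet phi t i : X :=
  form_series phi (fun j => 'C(j, i)%:R * t ^+ (j - i) / j`!%:R).

Lemma exponential_type_exp t : exponential_type (fun j => t ^+ j / j`!%:R).
Proof.
exists (nrm t), 1; split=> //; first exact: nrm_ge0.
by move=> j; rewrite mul1r nrmM nrmV nrm_nat nrmX.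
Qed.

Lemma exponential_type_jet t i :
  exponential_type (fun j => 'C(j, i)%:R * t ^+ (j - i) / j`!%:R).
Proof.
exists (nrm t + 1), 1; split=> //; first by rewrite addr_ge0 ?nrm_ge0.
move=> j; rewrite mul1r !nrmM nrmV !nrm_nat nrmX ler_wpM2r ?invr_ge0//.
by have := binomial_term_le j i (nrm_ge0 t) ler01; rewrite expr1n mulr1.
Qed.

Lemma exp_coef_sum (I : Type) (r : seq I) (F : I -> X) j :
  taylor (\sum_(i <- r) F i : X) 0 j = \sum_(i <- r) taylor (F i) 0 j.
Proof.
elim: r => [|i r IH]; first by rewrite !big_nil (taylorE (is_taylor0 0)).
rewrite !big_cons -[X in X + _]scale1r exp_taylorD; last exact: exp_dom0.
by rewrite scale1r IH.
Qed.

Lemma exp_coefZ c f j : taylor (c *: f : X) 0 j = c *: taylor f 0 j.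
Proof.
rewrite -[c *: f]addr0 exp_taylorD; last exact: exp_dom0.
by rewrite (taylorE (is_taylor0 0)) addr0.
Qed.

Lemma exp_jet0 phi i : dual phi -> exp_jet phi 0 i = (i`!%:R : R[i])^-1 *: power Theta k A phi i.
Proof.
move=> dphi; apply: exp_coef_inj => //; apply/funext => j.
rewrite exp_coefZ homogeneousE//; last exact: hspace_power1.
rewrite form_seriesE//; last exact: exponential_type_jet.
apply/funext => x; have [->|ji] := eqVneq j i.
  by rewrite binn mul1r subnn expr0 mul1r.
rewrite -[RHS]/((i`!%:R)^-1 * 0) mulr0.
have [lt_ji|le_ij] := ltnP j i; first by rewrite bin_small// !mul0r.
by rewrite expr0n subn_eq0 leqNgt ltn_neqAle eq_sym ji le_ij /= mulr0 !mul0r.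
Qed.

(** The curve t |-> exp(t phi) is entire with values in the space.  The factor q^n
   serves twice: with q = 1/2 for the convergence of its Taylor series, and with
   q -> 0 for the recovery of its coefficients one after the other. *)
Lemma exponential_expansion phi t T rho : dual phi -> A%:num < rho -> 0 <= T ->
  exists2 S, 0 <= S & forall u q n, 0 <= q <= 1 -> nrm u <= q * T ->
    `[exponential phi (t + u) - \sum_(i < n) u ^+ i *: exp_jet phi t i]_rho
      <= q ^+ n * S.
Proof.
move=> dphi Ar T0; have tT : 0 <= nrm t + T by rewrite addr_ge0 ?nrm_ge0.
have [S S0 HS] := form_series_norm dphi Ar tT; exists S => // u q n q01 uq.
have /andP[q0 q1] := q01.
pose b j := ((t + u) ^+ j - \sum_(i < n) 'C(j, i)%:R * t ^+ (j - i) * u ^+ i) / j`!%:R.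
have bB j : nrm (b j) <= q ^+ n * ((nrm t + T) ^+ j / j`!%:R).
  rewrite /b nrmM nrmV nrm_nat mulrA ler_wpM2r ?invr_ge0//.
  pose m := maxn n j.+1; have nm : (n <= m)%N by rewrite leq_maxl.
  have jm : (j < m)%N by rewrite leq_maxr.
  have -> : (t + u) ^+ j = \sum_(i < m) 'C(j, i)%:R * t ^+ (j - i) * u ^+ i.
    rewrite exprDn (big_ord_widen _ (fun i => t ^+ (j - i) * u ^+ i *+ 'C(j, i)) jm).
    rewrite big_mkcond; apply: eq_bigr => i _; rewrite ltnS.
    have [ij|ji] := leqP i j; first by rewrite -[LHS]mulr_natl mulrA.
    by rewrite bin_small// !mul0r.
  rewrite (big_ord_widen _ (fun i => 'C(j, i)%:R * t ^+ (j - i) * u ^+ i) nm).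
  rewrite (bigID (fun i : 'I_m => (i < n)%N)) /= addrAC subrr add0r.
  apply: le_trans (nrm_sum _ _ _) _.
  rewrite (eq_bigl (fun i : 'I_m => (n <= i)%N)); last by move=> i; rewrite -leqNgt.
  apply: le_trans (binomial_tail_le n (nrm_ge0 t) T0 q01 jm).
  apply: ler_sum => i _; rewrite !nrmM !nrmX nrm_nat ler_wpM2l//.
    by rewrite mulr_ge0// exprn_ge0 ?nrm_ge0.
  by apply: lerXn2r => //; rewrite nnegrE ?nrm_ge0// mulr_ge0.
have bE : exponential_type b by exists (nrm t + T), (q ^+ n); split=> //; exact: exprn_ge0.
have -> : exponential phi (t + u) - \sum_(i < n) u ^+ i *: exp_jet phi t i =
    form_series phi b.
  apply: exp_coef_inj => //; apply/funext => j; rewrite addrC -scaleN1r.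
  rewrite exp_taylorD; last exact: exp_dom0.
  rewrite exp_coef_sum.
  rewrite (form_seriesE dphi bE) /exponential (form_seriesE dphi (exponential_type_exp _)).
  apply/funext => x.
  rewrite -[LHS]/(-1 * (\sum_(i < n) taylor (u ^+ i *: exp_jet phi t i) 0 j) x
     + (t + u) ^+ j / j`!%:R * phi x ^+ j) fct_sumE.
  have -> : \sum_(i < n) taylor (u ^+ i *: exp_jet phi t i) 0 j x =
    (\sum_(i < n) 'C(j, i)%:R * t ^+ (j - i) * u ^+ i) * (phi x ^+ j / j`!%:R).
    rewrite mulr_suml; apply: eq_bigr => i _; rewrite exp_coefZ.
    rewrite form_seriesE//; last exact: exponential_type_jet.
    rewrite -[LHS]/(u ^+ i * ('C(j, i)%:R * t ^+ (j - i) / j`!%:R * phi x ^+ j)).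
    by move: (_^-1) => v; ring.
  by rewrite /b; move: (_^-1) => v; ring.
by apply: HS => //; exact: exprn_ge0.
Qed.

End Exponentials.

(** * Exponentials along a line *)
Section DensityAlongLines.
Variables (R : realType) (E : completeNormedModType R[i]).
Variables (Theta : holomorphy_type E) (k : \bar R) (A : {nonneg R}).
Hypothesis k1 : (1 < k)%E.
Hypothesis HC : canonical_constants Theta.
Hypothesis Hpi : pi1_holomorphy_type Theta.
Local Notation C := (R[i]^o).
Local Notation V := (hspace Theta).
Local Notation N := (hnorm Theta).
Local Notation w := (exp_weight k).
Local Notation dom := (exp_dom k A).
Local Notation X := (exp_space Theta k A).
Local Notation dual := (@dual R E).
Local Notation power := (power Theta k A).
Local Notation exponential := (exponential Theta k A).
Local Notation exp_jet := (exp_jet Theta k A).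
Local Notation "`[ f ]_ rho" := (exp_norm Theta k rho f)
  (at level 0, rho at level 2, format "`[ f ]_ rho").
Implicit Types (x h : E) (f g : X) (rho s q T : R) (t c : R[i]) (phi : E -> C)
  (M : set X).

(** By induction on i, the coefficient of order i is the limit, as u -> 0, of
   (exp((t + u) phi) - sum_(l < i) u^l jet_l) / u^i. *)
Lemma jets_in_closed_subspace M phi t : closed_subspace M -> dual phi ->
  (exists2 d : R, 0 < d & forall t', nrm (t' - t) < d -> M (exponential phi t')) ->
  forall i, M (exp_jet phi t i).
Proof.
move=> cM dphi [d d0 Md] i; have [M0 MD Mcl] := cM.
have [n] := ubnP i; elim: n i => // n IH i ni.
apply: Mcl => rho e Ar e0.
have [S S0 HS] := exponential_expansion k1 HC Hpi t dphi Ar ler01.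
pose q := Num.min 1 (Num.min (d / 2) (e / (S + 1) / 2)).
have S1 : 0 < S + 1 by rewrite ltr_wpDl.
have q0 : 0 < q by rewrite !lt_min ltr01 !divr_gt0.
have q1 : q <= 1 by rewrite ge_min lexx.
have qd : q < d.
  by rewrite (@le_lt_trans _ _ (d / 2))// ?ltr_pdivrMr ?mulr_natr ?ltrDl//
    /q !ge_min lexx ?orbT//; lra.
have qS : q * S < e.
  have : q <= e / (S + 1) / 2 by rewrite /q !ge_min lexx !orbT.
  rewrite ler_pdivlMr// ler_pdivlMr// => h; nra.
pose u : R[i] := q%:C.
have uq : nrm u = q by rewrite nrm_real gtr0_norm.
have u0 : u != 0 by rewrite -nrm_eq0 uq gt_eqF.
pose D m := exponential phi (t + u) - \sum_(l < m) u ^+ l *: exp_jet phi t l.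
have Mu : M (exponential phi (t + u)) by apply: Md; rewrite addrAC subrr add0r uq.
exists ((u ^+ i)^-1 *: D i).
  rewrite -[_ *: D i]addr0; apply: (MD) => //.
  rewrite /D addrC -scaleN1r; apply: (MD) => //.
  have : forall l : 'I_i, M (exp_jet phi t l).
    by move=> l; apply: IH; rewrite (leq_trans (ltn_ord l)).
  move=> Ml; apply: big_ind => //; first by move=> f g Mf Mg; rewrite -[f]scale1r; exact: MD.
  by move=> l _; rewrite -[_ *: _]addr0; exact: MD.
have -> : exp_jet phi t i - (u ^+ i)^-1 *: D i = - (u ^+ i)^-1 *: D i.+1.
  rewrite /D big_ord_recr /= opprD addrA; set Y := exponential _ _ - _.
  clearbody Y; rewrite scaleNr scalerBr opprB.
  by rewrite scalerA mulVf ?expf_neq0// scale1r.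
apply: le_lt_trans (exp_normZ k1 _ _ Ar) _.
rewrite nrmN nrmV nrmX uq.
have qi : 0 < q ^+ i by rewrite exprn_gt0.
rewrite mulrC ltr_pdivrMr//; apply: (@le_lt_trans _ _ (q ^+ i.+1 * S)).
  by apply: HS; rewrite ?uq ?mulr1// q1 ltW.
by rewrite exprS mulrAC ltr_pM2r.
Qed.

Lemma exponential_in_closed_subspace M phi t : closed_subspace M -> dual phi ->
  (forall i, M (exp_jet phi t i)) -> forall t', M (exponential phi t').
Proof.
move=> cM dphi Mt t'; have [M0 MD Mcl] := cM; apply: Mcl => rho e Ar e0.
pose u := t' - t; have T0 : 0 <= 2 * nrm u by rewrite mulr_ge0 ?nrm_ge0.
have [S S0 HS] := exponential_expansion k1 HC Hpi t dphi Ar T0.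
have half01 : 0 <= (2^-1 : R) < 1 by rewrite invr_ge0 ler0n invf_lt1 ?ltr1n.
have S1 : 0 < S + 1 by rewrite ltr_wpDl.
have [n Hn] := expr_small half01 (divr_gt0 e0 S1).
exists (\sum_(i < n) u ^+ i *: exp_jet phi t i).
  apply: (@closed_subspace_sum _ _ _ _ _ M n (fun i => u ^+ i *: exp_jet phi t i)) => // i.
  by rewrite -[_ *: _]addr0; exact: MD.
have -> : t' = t + u by rewrite addrC subrK.
have /andP[h0 h1] := half01.
apply: (@le_lt_trans _ _ (2^-1 ^+ n * S)).
  by apply: HS; rewrite ?mulKf ?pnatr_eq0// h0 ltW.
have := Hn n (leqnn n); rewrite ltr_pdivlMr// mulrDr mulr1.
by apply: le_lt_trans; rewrite lerDl exprn_ge0.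
Qed.

(** A closed subspace that contains exp(t phi) for t near some point contains
   the Taylor coefficients of t |-> exp(t phi) there, hence exp(t phi) for all t,
   hence the Taylor coefficients at 0. *)
Lemma powers_in_closed_subspace M phi t : closed_subspace M -> dual phi ->
  (exists2 d : R, 0 < d & forall t', nrm (t' - t) < d -> M (exponential phi t')) ->
  forall j, M (power phi j).
Proof.
move=> cM dphi Md j; have [M0 MD _] := cM.
have Mexp := exponential_in_closed_subspace cM dphi (jets_in_closed_subspace cM dphi Md).
have Mjet i : M (exp_jet phi 0 i).
  by apply: jets_in_closed_subspace => //; exists 1.
have -> : power phi j = (j`!%:R : R[i]) *: exp_jet phi 0 j + 0.
  by rewrite addr0 exp_jet0// scalerA divff ?scale1r// pnatr_eq0 -lt0n fact_gt0.
exact: MD.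
Qed.

Lemma exponential_functional (Lam : X -> C) phi (B rho : R) :
  dual phi -> A%:num < rho -> 0 <= B -> linear Lam ->
  (forall f, nrm (Lam f) <= B * `[f]_rho) ->
  entire_expansion (fun t => Lam (exponential phi t)) (fun i => Lam (exp_jet phi 0 i)).
Proof.
move=> dphi Ar B0 lLam LB r e r0 e0.
have T0 : 0 <= 2 * r by rewrite mulr_ge0// ltW.
have [S S0 HS] := exponential_expansion k1 HC Hpi 0 dphi Ar T0.
have half01 : 0 <= (2^-1 : R) < 1 by rewrite invr_ge0 ler0n invf_lt1 ?ltr1n.
have /andP[h0 h1] := half01.
have BS1 : 0 < B * S + 1 by rewrite ltr_wpDl// mulr_ge0.
have [n0 Hn] := expr_small half01 (divr_gt0 e0 BS1).
exists n0 => n nn t tr.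
have LS : Lam (\sum_(i < n) t ^+ i *: exp_jet phi 0 i) =
    \sum_(i < n) Lam (exp_jet phi 0 i) * t ^+ i.
  rewrite (linear_sum lLam); apply: eq_bigr => i _.
  by rewrite (linear_scale lLam) [_ *: _]mulrC.
rewrite -LS -(linear_sub lLam); apply: le_trans (LB _) _.
have := HS t 2^-1 n; rewrite add0r mulKf ?pnatr_eq0// h0 (ltW h1) => /(_ isT tr) h.
apply: le_trans (ler_wpM2l B0 h) _; rewrite mulrCA.
have := Hn n nn; rewrite ltr_pdivlMr// mulrDr mulr1 => /ltW.
by apply: le_trans; rewrite lerDl exprn_ge0.
Qed.

(** (phi + c psi)^n is polynomial of degree n in c: its value at any c is a
   combination of its values at n + 1 nodes. *)
Lemma power_interpolation n (x : nat -> R[i]) : injective x ->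
  exists l : 'I_n.+1 -> {poly R[i]}, forall phi psi c, dual phi -> dual psi ->
    power (phi + c *: psi) n = \sum_(i < n.+1) (l i).[c] *: power (phi + x i *: psi) n.
Proof.
move=> xI; have [l lE] := interpolation n xI; exists l => phi psi c dphi dpsi.
have Vp t : V n (fun x => (phi + t *: psi) x ^+ n).
  exact: (hspace_power1 Hpi n (dual_lin t dphi dpsi)).
apply: exp_coef_inj => //; apply/funext => j.
rewrite exp_coef_sum (homogeneousE A k1 HC (Vp c)).
under eq_bigr => i _ do rewrite exp_coefZ (homogeneousE A k1 HC (Vp (x i))).
have [_|jn] := eqVneq j n; last by rewrite big1// => i _; rewrite scaler0.
apply/funext => y; rewrite fct_sumE.
pose p : {poly R[i]} := ((psi y : R[i]) *: 'X + (phi y : R[i])%:P) ^+ n.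
have pE t : p.[t] = (phi + t *: psi) y ^+ n.
  by rewrite horner_exp !hornerE addrC mulrC.
have sp : (size p <= n.+1)%N.
  apply: leq_trans (size_poly_exp_leq _ _) _; rewrite ltnS.
  rewrite -[leqRHS]mul1n leq_mul2r -subn1 leq_subLR; apply/orP; right.
  apply: leq_trans (size_polyD _ _) _; rewrite geq_max.
  rewrite (leq_trans (size_scale_leq _ _)) ?size_polyX//=.
  by rewrite (leq_trans (size_polyC_leq1 _)).
rewrite -pE {1}(lE p sp) horner_sum; apply: eq_bigr => i _.
by rewrite hornerZ pE mulrC.
Qed.

End DensityAlongLines.

(** * Neighborhoods and bounded operators *)
Section Topology.
Import finmap.
Variables (R : realType) (E : completeNormedModType R[i]).
Variables (Theta : holomorphy_type E) (k : \bar R) (A : {nonneg R}).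
Hypothesis k1 : (1 < k)%E.
Local Notation X := (exp_space Theta k A).
Local Notation "`[ f ]_ rho" := (exp_norm Theta k rho f)
  (at level 0, rho at level 2, format "`[ f ]_ rho").
Implicit Types (f g : X) (rho e : R) (U : set X).

Let sub_index := [set i : X * (R * R) | A%:num < i.2.1 /\ 0 < i.2.2].
Let sub_ball (i : X * (R * R)) : set X := [set g | `[g - i.1 : X]_(i.2.1) < i.2.2].

Let exp_openP U : open U <->
  exists2 D', D' `<=` finI_from sub_index sub_ball & \bigcup_(i in D') i = U.
Proof. by []. Qed.

Lemma exp_ball_open f rho e : A%:num < rho -> 0 < e ->
  open [set g : X | `[g - f : X]_rho < e].
Proof.
move=> Ar e0; apply/exp_openP; exists [set [set g : X | `[g - f : X]_rho < e]].
  move=> _ ->; exists [fset (f, (rho, e))]%fset.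
    by move=> i /=; rewrite in_fset1 => /eqP ->; rewrite in_setE.
  apply/seteqP; split=> g /=.
    by move=> H; have := H (f, (rho, e)); apply; rewrite /= in_fset1.
  by move=> gf i /=; rewrite in_fset1 => /eqP ->.
by rewrite bigcup_set1.
Qed.

(** A finite intersection of balls contains a ball for the norm of the smallest
   rho. *)
Lemma exp_open_ball U f : open U -> U f ->
  exists rho e, [/\ A%:num < rho, 0 < e & forall g, `[g - f : X]_rho < e -> U g].
Proof.
move=> /exp_openP[D' D'I <-] [W D'W Wf].
have [F FI WE] := D'I _ D'W.
suff [rho [e [Ar e0 H]]] : exists rho e, [/\ A%:num < rho, 0 < e &
    forall g, `[g - f : X]_rho < e -> forall i, i \in (F : seq _) -> sub_ball i g].
  exists rho, e; split; [exact: Ar|exact: e0|move=> g /H gF].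
  by exists W => //; rewrite -WE => i /=; exact: gF.
have {}FI i : i \in (F : seq _) -> A%:num < i.2.1.
  by move=> iF; have := FI i iF; rewrite in_setE => -[].
have {}Wf i : i \in (F : seq _) -> `[f - i.1 : X]_(i.2.1) < i.2.2.
  by move=> iF; move: Wf; rewrite -WE; apply.
elim: (F : seq _) FI Wf => [|i s IH] FI Wf.
  exists (A%:num + 1), 1; split; [by rewrite ltrDl|exact: ltr01|].
  by move=> g _ i; rewrite in_nil.
have [||rho [e [Ar e0 H]]] := IH.
- by move=> j js; apply: FI; rewrite in_cons js orbT.
- by move=> j js; apply: Wf; rewrite in_cons js orbT.
have Ai := FI i (mem_head _ _); have Wi := Wf i (mem_head _ _).
pose rho' := Num.min rho i.2.1; pose e' := Num.min e (i.2.2 - `[f - i.1 : X]_(i.2.1)).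
have Ar' : A%:num < rho' by rewrite lt_min Ar.
exists rho', e'; split; [exact: Ar'|by rewrite lt_min e0 subr_gt0|].
move=> g gf j; rewrite in_cons => /orP[/eqP ->|js].
  rewrite /sub_ball /=; apply: le_lt_trans (exp_norm_triangle k1 _ f _ Ai) _.
  rewrite -ltrBrDr; apply: (@le_lt_trans _ _ `[g - f : X]_rho').
    by apply: (exp_norm_anti k1 _ Ar'); rewrite ge_min lexx orbT.
  by rewrite (lt_le_trans gf)// ge_min lexx orbT.
apply: H js; apply: (@le_lt_trans _ _ `[g - f : X]_rho').
  by apply: (exp_norm_anti k1 _ Ar'); rewrite ge_min lexx.
by rewrite (lt_le_trans gf)// ge_min lexx.
Qed.

Lemma exp_continuous_bounded (L : X -> X) rho : linear L -> continuous L ->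
  A%:num < rho -> exists rho' B, [/\ A%:num < rho', 0 <= B &
    forall f, `[L f]_rho <= B * `[f]_rho'].
Proof.
move=> lL cL Ar.
have oB := exp_ball_open 0 Ar ltr01.
have : open (L @^-1` [set g : X | `[g - 0 : X]_rho < 1]).
  by have /continuousP := cL; apply.
move=> /(@exp_open_ball _ 0)[|rho' [d [Ar' d0 Hd]]].
  by rewrite /= (linear_at0 lL) subr0 exp_norm0.
exists rho', (2 / d); split; [exact: Ar'|by rewrite divr_ge0// ltW|].
move=> f; apply/ler_addgt0Pr => e e0.
have f0 := exp_norm_ge0 k1 f Ar'.
pose s := (2 / d) * `[f]_rho' + e.
have s0 : 0 < s by rewrite ltr_wpDl// mulr_ge0// divr_ge0// ltW.
have : `[L ((s^-1)%:C *: f) - 0 : X]_rho < 1.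
  apply: Hd; rewrite subr0 (le_lt_trans (exp_normZ k1 _ _ Ar'))//.
  rewrite nrm_real gtr0_norm ?invr_gt0// mulrC ltr_pdivrMr// /s mulrDr.
  have -> : d * (2 / d * `[f]_rho') = 2 * `[f]_rho' by field; rewrite gt_eqF.
  have := mulr_gt0 d0 e0; lra.
rewrite subr0 (linear_scale lL) => h.
have -> : L f = s%:C *: ((s^-1)%:C *: L f).
  by rewrite scalerA -rmorphM /= divff ?gt_eqF// scale1r.
apply: le_trans (exp_normZ k1 _ _ Ar) _; rewrite nrm_real gtr0_norm// -/s.
by rewrite -[leRHS]mulr1 ler_wpM2l// ltW.
Qed.

End Topology.

(** * Eigenvectors of convolution operators *)
Section ConvolutionOperators.
Variables (R : realType) (E : completeNormedModType R[i]).
Variables (Theta : holomorphy_type E) (k : \bar R) (A : {nonneg R}).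
Hypothesis k1 : (1 < k)%E.
Hypothesis HC : canonical_constants Theta.
Hypothesis Hpi : pi1_holomorphy_type Theta.
Local Notation C := (R[i]^o).
Local Notation V := (hspace Theta).
Local Notation N := (hnorm Theta).
Local Notation dom := (exp_dom k A).
Local Notation X := (exp_space Theta k A).
Local Notation dual := (@dual R E).
Local Notation power := (power Theta k A).
Local Notation exponential := (exponential Theta k A).
Local Notation exp_jet := (exp_jet Theta k A).
Local Notation "`[ f ]_ rho" := (exp_norm Theta k rho f)
  (at level 0, rho at level 2, format "`[ f ]_ rho").
Implicit Types (x h a : E) (f g : X) (rho e : R) (t c : R[i]) (phi psi : E -> C)
  (M : set X).

Lemma exp_space_value f x : dom x -> taylor f x 0 0 = f x.
Proof. by move=> dx; exact: (is_taylor_value 0 (exp_taylor f dx)). Qed.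

Lemma exp_space_cvg f x : dom x ->
  (fun n => \sum_(j < n) taylor f 0 j x) @ \oo --> (f x : C).
Proof.
move=> dx; rewrite -(@exp_space_value f x dx).
have := @exp_space_expansion _ _ _ _ _ k1 f _ 0 0 HC dx.
under [X in X @ \oo --> _ -> _]funext => n.
  under eq_bigr => j _ do
    rewrite (taylor0E _ _ (hspace_hompoly (exp_coef_hspace k1 f j))).
  over.
by [].
Qed.

Lemma exponentialE phi t : dual phi ->
  taylor (exponential phi t) 0 = fun j x => t ^+ j / j`!%:R * phi x ^+ j.
Proof.
by move=> dphi; apply: form_seriesE => //; exact: exponential_type_exp.
Qed.

Lemma exponential_dirderiv phi t a : dual phi ->
  exp_val ((t * phi a : R[i]) *: exponential phi t) =
    dirderiv k A a (exponential phi t).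
Proof.
move=> dphi; have [lphi _] := dphi; apply/funext => x; rewrite /dirderiv.
have [dx|ndx] := pselect (dom x); last first.
  by rewrite /patch memNset// (exp_outside _ ndx).
rewrite patchT; last exact: mem_set.
rewrite hdiff1; set f := exponential phi t.
have fx := @exp_space_cvg f x dx.
have := @exp_space_expansion _ _ _ _ _ k1 f _ 1 a HC dx.
have fE j : taylor (taylor f 0 j) x 1 a =
    t ^+ j / j`!%:R * (j%:R * phi x ^+ j.-1 * phi a).
  have hP := hspace_hompoly (hspace_power Hpi (t ^+ j / j`!%:R) j dphi).
  by rewrite /f (exponentialE t dphi) (taylor1_power _ _ lphi hP).
have sumE n : \sum_(j < n.+1) taylor (taylor f 0 j) x 1 a =
    t * phi a * \sum_(j < n) taylor f 0 j x.
  rewrite big_ord_recl fE mul0r mul0r mulr0 add0r mulr_sumr.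
  apply: eq_bigr => j _; rewrite fE lift0 /f (exponentialE t dphi) factS natrM exprS.
  rewrite invfM; have j0 : (j.+1%:R : R[i]) != 0 by rewrite pnatr_eq0.
  rewrite -[LHS]/(t * t ^+ j * (j.+1%:R^-1 * (j`!%:R)^-1) *
     (j.+1%:R * phi x ^+ j * phi a) : R[i]).
  rewrite -[RHS]/(t * phi a * (t ^+ j / j`!%:R * phi x ^+ j) : R[i]).
  have := mulVf j0; move: (j.+1%:R^-1) (j`!%:R^-1) => u v uj.
  transitivity (u * j.+1%:R * (t * t ^+ j * v * phi x ^+ j * phi a)); first by ring.
  by rewrite uj; ring.
move=> /cvg_nrmP H; apply: (@cvg_complex_unique _
  (fun n => (t * phi a : R[i]) * \sum_(j < n) taylor f 0 j x)).
  exact: (@cvgZr _ C _ \oo _ _ _ _ fx).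
apply/cvg_nrmP => e /H[n0 Hn]; exists n0 => n nn.
by rewrite -sumE; apply: Hn; exact: leqW.
Qed.

(** A function g whose derivative is t phi times g is a multiple of
   exp(t phi): along each ray its Taylor coefficients at 0 satisfy
   (j + 1) g_{j+1} = t phi g_j. *)
Lemma exponential_ode phi t g : dual phi ->
  (forall x a, dom x -> t * phi a * g x = taylor g x 1 a) ->
  g = (taylor g 0 0 0 : R[i]) *: exponential phi t.
Proof.
move=> dphi ode; have Vg j := exp_coef_hspace k1 g j.
have rec j h : j.+1%:R * taylor g 0 j.+1 h = t * phi h * taylor g 0 j h :> R[i].
  have [r [r0 rdom _]] := exp_dom_radius k1 (exp_dom0 E k A).
  rewrite nrm0 in r0; have h1 : 0 < nrm h + 1 by rewrite ltr_wpDl ?nrm_ge0.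
  have d0 : 0 < r / (nrm h + 1) by rewrite divr_gt0.
  apply/eqP; rewrite -subr_eq0; apply/eqP.
  apply: (@power_series_eq0 _ (fun j => j.+1%:R * taylor g 0 j.+1 h
    - t * phi h * taylor g 0 j h : C) _ d0 _ j) => s /andP[s0 sd].
  have dsh : dom (s%:C *: h).
    apply: rdom; rewrite nrmZ nrm_real gtr0_norm//.
    by move: sd; rewrite ler_pdivlMr// mulrDr mulr1; lra.
  have := @exp_space_expansion _ _ _ _ _ k1 g _ 1 h HC dsh.
  rewrite -(ode _ _ dsh) => /cvg_nrmP H1; have /cvg_nrmP H2 := @exp_space_cvg g _ dsh.
  have c1 : 0 < nrm (t * phi h : R[i]) + 1 by rewrite ltr_wpDl ?nrm_ge0.
  apply/cvg_nrmP => e e0; have e2 : 0 < e / 2 by rewrite divr_gt0.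
  have [n1 {}H1] := H1 _ e2.
  have [n2 {}H2] := H2 _ (divr_gt0 e2 c1).
  exists (maxn n1 n2) => n; rewrite geq_max => /andP[nn1 nn2].
  rewrite sub0r nrmN.
  have {H1} := H1 n.+1 (leqW nn1); have {H2} := H2 n nn2.
  rewrite ltr_pdivlMr// mulrDr mulr1 mulrC -nrmM => h2 h3.
  have -> : \sum_(i < n) (i.+1%:R * taylor g 0 i.+1 h - t * phi h * taylor g 0 i h) * s%:C ^+ i
    = \sum_(j < n.+1) taylor (taylor g 0 j) (s%:C *: h) 1 h
      - t * phi h * \sum_(j < n) taylor g 0 j (s%:C *: h) :> R[i].
    rewrite big_ord_recl (taylor1_ray _ _ (hspace_hompoly (Vg 0%N))) mul0r mul0r add0r.
    rewrite mulr_sumr -sumrB; apply: eq_bigr => i _.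
    rewrite lift0 (taylor1_ray _ _ (hspace_hompoly (Vg _))).
    rewrite (hompolyZ _ _ (hspace_hompoly (Vg _))) /=.
    by rewrite mulrBl; congr (_ - _); ring.
  have -> : \sum_(j < n.+1) taylor (taylor g 0 j) (s%:C *: h) 1 h
      - t * phi h * \sum_(j < n) taylor g 0 j (s%:C *: h) =
    t * phi h * (g (s%:C *: h) - \sum_(j < n) taylor g 0 j (s%:C *: h)) -
    (t * phi h * g (s%:C *: h) - \sum_(j < n.+1) taylor (taylor g 0 j) (s%:C *: h) 1 h)
    :> R[i] by ring.
  apply: le_lt_trans (nrmB _ _) _; rewrite [e]splitr.
  have := nrm_ge0 (g (s%:C *: h) - \sum_(j < n) taylor g 0 j (s%:C *: h)).
  lra.
apply: exp_coef_inj => //; apply/funext => j; apply/funext => x.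
rewrite exp_coefZ (exponentialE t dphi) -[RHS]/(taylor g 0 0 0 * (t ^+ j / j`!%:R * phi x ^+ j) : R[i]).
have g0 : taylor g 0 0 x = taylor g 0 0 0.
  have := hompolyZ 0 x (hspace_hompoly (Vg 0%N)).
  by rewrite scale0r mul1r.
elim: j => [|j IH]; first by rewrite g0 !expr0 fact0 invr1 !mulr1.
have j0 : (j.+1%:R : R[i]) != 0 by rewrite pnatr_eq0.
apply: (mulfI j0); rewrite rec IH factS natrM invfM !exprS.
have := mulfV j0; move: (j.+1%:R^-1) (j`!%:R^-1) => u v uj.
transitivity (j.+1%:R * u * (t * phi x * (taylor g 0 0 0 * (t ^+ j * v * phi x ^+ j))) : R[i]).
  by rewrite uj mul1r.
by ring.
Qed.

(** A convolution operator is determined by this functional, as its eigenvalue at an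
   exponential is the value of the functional there. *)
Definition value_at0 (L : X -> X) f : C := taylor (L f) 0 0 0.

Lemma convolution_exponential (L : X -> X) phi t :
  convolution_operator L -> dual phi ->
  L (exponential phi t) = (value_at0 L (exponential phi t) : R[i]) *: exponential phi t.
Proof.
move=> [lL _ dL] dphi; apply: exponential_ode => // x a dx.
have := dL _ _ _ (exponential_dirderiv t a dphi).
move/(congr1 (fun u : E -> C => u x)); rewrite (linear_scale lL) /dirderiv.
by rewrite patchT ?hdiff1//; exact: mem_set.
Qed.

End ConvolutionOperators.

(** * Mixing *)
Section Mixing.
Variables (R : realType) (E : completeNormedModType R[i]).
Variables (Theta : holomorphy_type E) (k : \bar R) (A : {nonneg R}).
Hypothesis k1 : (1 < k)%E.
Hypothesis HC : canonical_constants Theta.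
Hypothesis Hpi : pi1_holomorphy_type Theta.
Local Notation C := (R[i]^o).
Local Notation X := (exp_space Theta k A).
Local Notation dual := (@dual R E).
Local Notation power := (power Theta k A).
Local Notation exponential := (exponential Theta k A).
Local Notation exp_jet := (exp_jet Theta k A).
Local Notation "`[ f ]_ rho" := (exp_norm Theta k rho f)
  (at level 0, rho at level 2, format "`[ f ]_ rho").
Implicit Types (f g : X) (rho e : R) (t c : R[i]) (phi psi : E -> C) (M : set X).

Lemma power_scale phi c n : dual phi -> power (c *: phi) n = c ^+ n *: power phi n.
Proof.
move=> dphi; have Vp := hspace_power1 Hpi n dphi.
have := homogeneousD A k1 HC (c ^+ n) Vp (hspace_0 Theta n).
rewrite addr0 (homogeneous_0 A k1 HC) addr0 => <-; congr (homogeneous _ _ _ _ _).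
by apply/funext => x; rewrite -[LHS]/((c * phi x) ^+ n) exprMn.
Qed.

Lemma approximable_idem M f : approximable (approximable M) f -> approximable M f.
Proof.
move=> Mf rho e Ar e0; have e2 : 0 < e / 2 by rewrite divr_gt0.
have [g Mg fg] := Mf rho _ Ar e2; have [h Mh gh] := Mg rho _ Ar e2.
exists h => //; apply: le_lt_trans (exp_norm_triangle k1 _ g _ Ar) _.
by have := ltrD fg gh; rewrite -splitr.
Qed.

Lemma approximable_refl M f : M f -> approximable M f.
Proof. by move=> Mf rho e Ar e0; exists f => //; rewrite subrr exp_norm0. Qed.

Lemma approximable_closed_subspace M : M 0 ->
  (forall c f g, M f -> M g -> M (c *: f + g)) -> closed_subspace (approximable M).
Proof.
move=> M0 MD; split.
- by move=> rho e Ar e0; exists 0 => //; rewrite subrr exp_norm0.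
- move=> c f g Mf Mg rho e Ar e0.
  have c1 : 0 < nrm c + 1 by rewrite ltr_wpDl ?nrm_ge0.
  have e2 : 0 < e / 2 by rewrite divr_gt0.
  have [f' Mf' ff'] := Mf rho _ Ar (divr_gt0 e2 c1).
  have [g' Mg' gg'] := Mg rho _ Ar e2.
  exists (c *: f' + g'); first exact: MD.
  have -> : c *: f + g - (c *: f' + g') = c *: (f - f') + (g - g').
    by rewrite scalerBr opprD addrACA.
  rewrite (le_lt_trans (exp_normDZ k1 _ _ _ Ar))// [e]splitr ler_ltD//.
  move: ff'; rewrite ltr_pdivlMr// mulrDr mulr1 mulrC => ff'.
  by have := exp_norm_ge0 k1 (f - f') Ar; lra.
- exact: approximable_idem.
Qed.

Section Functional.
Variables (Lam : X -> C) (rho0 B : R).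
Hypotheses (Ar0 : A%:num < rho0) (B0 : 0 <= B) (linLam : linear Lam).
Hypothesis LamB : forall f, nrm (Lam f) <= B * `[f]_rho0.

Lemma exponential_continuous phi t e : dual phi -> 0 < e -> exists2 d : R, 0 < d &
  forall t', nrm (t' - t) < d ->
    nrm (Lam (exponential phi t') - Lam (exponential phi t)) < e.
Proof.
move=> dphi e0.
have [S S0 HS] := exponential_expansion k1 HC Hpi t dphi Ar0 ler01.
have BS1 : 0 < B * S + 1 by rewrite ltr_wpDl// mulr_ge0.
exists (Num.min 1 (e / (B * S + 1))); first by rewrite lt_min ltr01 divr_gt0.
move=> t'; rewrite lt_min => /andP[u1 ue].
have := HS (t' - t) (nrm (t' - t)) 1%N.
rewrite mulr1 nrm_ge0 (ltW u1) => /(_ isT (lexx _)).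
rewrite [t + _]addrC subrK big_ord1 expr0 scale1r !expr1.
have -> : exp_jet phi t 0 = exponential phi t.
  rewrite /exp_jet /exponential; congr form_series; apply/funext => j.
  by rewrite bin0 mul1r subn0.
move=> h; rewrite -(linear_sub linLam); apply: le_lt_trans (LamB _) _.
apply: le_lt_trans (ler_wpM2l B0 h) _.
move: ue; rewrite ltr_pdivlMr// mulrDr mulr1.
by have := nrm_ge0 (t' - t); rewrite mulrCA; lra.
Qed.

(** Say that phi is generic if Lam (phi^n) <> 0; then t |-> Lam (exp(t phi)) is not
   constant, it takes a value in D, and the powers of phi are in M.  If psi is
   generic, so is phi + m psi for large m, as Lam ((phi + t psi)^n) is a nonzero
   polynomial in t; the powers of any phi are combinations of those of the
   phi + m psi. *)
Lemma exponentials_total (D : set R) :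
  (forall r, D r -> exists2 e : R, 0 < e & forall r', `|r' - r| < e -> D r') ->
  (forall phi n, dual phi -> (0 < n)%N -> Lam (power phi n) <> 0 ->
    exists t, D (nrm (Lam (exponential phi t)))) ->
  (exists phi n, [/\ dual phi, (0 < n)%N & Lam (power phi n) <> 0]) ->
  forall M, closed_subspace M ->
    (forall phi t, dual phi -> D (nrm (Lam (exponential phi t))) ->
      M (exponential phi t)) ->
    forall f, M f.
Proof.
move=> Dop Dval [psi [n [dpsi n0 Lpsi]]] M cM MD; apply: total_powers => //.
have generic phi j : dual phi -> Lam (power phi n) <> 0 -> M (power phi j).
  move=> dphi Lphi; have [t Dt] := Dval phi n dphi n0 Lphi.
  have [e e0 He] := Dop _ Dt.
  have [d d0 Hd] := exponential_continuous t dphi e0.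
  apply: (powers_in_closed_subspace k1 HC Hpi cM dphi (t := t)); exists d => // t' tt'.
  apply: (MD _ _ dphi); apply: He.
  exact: le_lt_trans (nrm_dist _ _) (Hd _ tt').
move=> phi j dphi.
have [l lE] := power_interpolation A k1 HC Hpi n (@natr_complex_inj R 0).
pose p : {poly R[i]} :=
  \sum_(i < n.+1) (Lam (power (phi + i%:R *: psi) n) : R[i]) *: l i.
have pE t : p.[t] = Lam (power (phi + t *: psi) n).
  rewrite lE// (linear_sum linLam) horner_sum; apply: eq_bigr => i _.
  by rewrite (linear_scale linLam) hornerZ mulrC.
have p0 : p != 0.
  (* otherwise Lam ((psi + s phi)^n) = s^n Lam ((phi + psi / s)^n) = 0 for all nonzero
     s, hence also for s = 0 by interpolation; the nodes 1, 2, ... avoid 0 *)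
  apply/eqP => p0; apply: Lpsi.
  have [l' lE'] := power_interpolation A k1 HC Hpi n (@natr_complex_inj R 1).
  have := lE' psi phi 0 dpsi dphi; rewrite scale0r addr0 => ->.
  rewrite (linear_sum linLam) big1// => i _; rewrite (linear_scale linLam); set s : R[i] := _%:R.
  have s0 : s != 0 by rewrite pnatr_eq0.
  have -> : psi + s *: phi = s *: (phi + s^-1 *: psi).
    by rewrite scalerDr scalerA divff// scale1r addrC.
  rewrite power_scale; last exact: dual_lin.
  by rewrite (linear_scale linLam) -pE p0 horner0 !scaler0.
have [m0 Hm] := poly_eventually_neq0 p0.
have [l' lE'] := power_interpolation A k1 HC Hpi j (@natr_complex_inj R m0).
have := lE' phi psi 0 dphi dpsi; rewrite scale0r addr0 => ->.
have [M0 MDD _] := cM.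
apply: big_ind => // [f g Mf Mg|i _]; first by rewrite -[f]scale1r; exact: MDD.
rewrite -[_ *: _]addr0; apply: MDD => //; apply: generic; first exact: dual_lin.
by apply/eqP; rewrite -pE Hm// leq_addr.
Qed.

End Functional.

Variable L : X -> X.
Hypothesis Lconv : convolution_operator L.
Hypothesis Lnontriv : nontrivial_operator L.

Local Notation Lam := (value_at0 L).

Let linL : linear L. Proof. by have [] := Lconv. Qed.

Let contL : continuous L. Proof. by have [] := Lconv. Qed.

Let linLam : linear (Lam : X -> C).
Proof.
move=> c f g; rewrite /value_at0 linL exp_taylorD//; exact: exp_dom0.
Qed.

Let Lam_bounded : exists rho (B : R), [/\ A%:num < rho, 0 <= B &
  forall f, nrm (Lam f) <= B * `[f]_rho].
Proof.
have Ar : A%:num < A%:num + 1 by rewrite ltrDl.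
have [rho [B [Ar' B0 H]]] := exp_continuous_bounded k1 linL contL Ar.
exists rho, B; split=> // f; apply: le_trans (H f).
apply: le_trans (exp_coef_le k1 (L f) 0 Ar).
have -> : exp_weight k (A%:num + 1) 0 = 1.
  by have [b [_ -> _ _]] := exp_weight_factor k1; rewrite !expr0 invr1 mulr1.
have := hspace_bound HC 0 (exp_coef_hspace k1 (L f) 0).
by rewrite expr0 mulr1 mul1r.
Qed.

Lemma exp_jet0_value phi i : dual phi ->
  Lam (exp_jet phi 0 i) = (i`!%:R : R[i])^-1 * Lam (power phi i).
Proof.
move=> dphi; rewrite exp_jet0//; rewrite /value_at0 (linear_scale linL).
by rewrite exp_coefZ.
Qed.

(** Otherwise Lam (exp phi) does not depend on phi, so all exponentials have the
   same eigenvalue, and by density L is a scalar. *)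
Lemma nontrivial_direction :
  exists phi n, [/\ dual phi, (0 < n)%N & Lam (power phi n) <> 0].
Proof.
apply: contrapT => H; apply: Lnontriv.
have Lpow phi n : dual phi -> (0 < n)%N -> Lam (power phi n) = 0.
  by move=> dphi n0; apply: contrapT => ne; apply: H; exists phi, n.
pose one := homogeneous Theta k A 0 (fun=> 1).
have pow0 phi : power phi 0 = one.
  by rewrite /power; congr homogeneous; apply/funext => x; rewrite expr0.
have [rho [B [Ar B0 LB]]] := Lam_bounded.
have Lexp phi t : dual phi -> Lam (exponential phi t) = Lam one.
  move=> dphi; have ent := exponential_functional k1 HC Hpi dphi Ar B0 linLam LB.
  apply/eqP; rewrite -subr_eq0 -nrm_eq0 eq_le nrm_ge0 andbT.
  apply/ler_addgt0Pr => e e0; rewrite add0r.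
  have t1 : 0 < nrm t + 1 by rewrite ltr_wpDl ?nrm_ge0.
  have [n0 Hn] := ent _ e t1 e0.
  have := Hn n0.+1 (leqnSn _) t; rewrite lerDl => /(_ ler01).
  rewrite big_ord_recl big1 => [|i _].
    by rewrite addr0 expr0 mulr1 exp_jet0_value// fact0 invr1 mul1r pow0.
  by rewrite exp_jet0_value// Lpow// mulr0 mul0r.
exists (Lam one) => f.
pose M := [set f : X | L f = (Lam one : R[i]) *: f].
have cM : closed_subspace M.
  split.
  - by rewrite /M /= (linear_at0 linL) scaler0.
  - move=> c g h; rewrite /M /= => Lg Lh; rewrite linL Lg Lh scalerDr !scalerA.
    by rewrite [c * _]mulrC.
  - move=> g gM; rewrite /M /=; apply/eqP; rewrite -subr_eq0; apply/eqP.
    have Ar1 : A%:num < A%:num + 1 by rewrite ltrDl.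
    apply: (exp_norm_eq0 k1 Ar1); apply/eqP; rewrite eq_le exp_norm_ge0// andbT.
    apply/ler_addgt0Pr => e e0; rewrite add0r.
    have [rho' [B' [Ar' B0' LB']]] := exp_continuous_bounded k1 linL contL Ar1.
    pose rr := Num.min rho' (A%:num + 1).
    have Arr : A%:num < rr by rewrite lt_min Ar'.
    pose K := B' + nrm (Lam one : R[i]) + 1.
    have K0 : 0 < K by rewrite ltr_wpDl// addr_ge0 ?nrm_ge0.
    have [h Mh gh] := gM rr (e / K) Arr (divr_gt0 e0 K0).
    have -> : L g - (Lam one : R[i]) *: g =
        L (g - h) - (Lam one : R[i]) *: (g - h).
      by rewrite (linear_sub linL) Mh scalerBr opprB addrA subrK.
    apply: le_trans (exp_normB k1 _ _ Ar1) _.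
    have n1 := LB' (g - h); have n2 := exp_normZ k1 (Lam one) (g - h) Ar1.
    have n3 : `[g - h : X]_rho' <= `[g - h : X]_rr.
      by apply: (exp_norm_anti k1 _ Arr); rewrite ge_min lexx.
    have n4 : `[g - h : X]_(A%:num + 1) <= `[g - h : X]_rr.
      by apply: (exp_norm_anti k1 _ Arr); rewrite ge_min lexx orbT.
    have n5 := exp_norm_ge0 k1 (g - h) Arr.
    move: gh; rewrite ltr_pdivlMr// /K !mulrDr mulr1 => gh.
    have m1 := ler_wpM2l B0' n3; have m2 := ler_wpM2l (nrm_ge0 (Lam one : R[i])) n4.
    apply: le_trans (lerD (le_trans n1 m1) (le_trans n2 m2)) _.
    rewrite [B' * _]mulrC [nrm _ * _]mulrC.
    by apply/ltW; apply: le_lt_trans gh; rewrite lerDl.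
suff : M f by [].
apply: (total_powers k1 HC Hpi cM) => phi j dphi.
apply: (powers_in_closed_subspace k1 HC Hpi cM dphi (t := 0)); exists 1 => // t _.
by rewrite /M /= (convolution_exponential k1 HC Hpi _ Lconv dphi) Lexp.
Qed.

Let eigen phi t n : dual phi -> iter n L (exponential phi t) =
  (Lam (exponential phi t) : R[i]) ^+ n *: exponential phi t.
Proof.
move=> dphi; elim: n => [|n IH]; first by rewrite expr0 scale1r.
rewrite iterS IH (linear_scale linL) (convolution_exponential k1 HC Hpi t Lconv dphi).
by rewrite scalerA -exprSr.
Qed.

Lemma iter_linear n : linear (iter n L).
Proof. by elim: n => // n IH c f g; rewrite /= IH linL. Qed.

Let values phi n : dual phi -> (0 < n)%N -> Lam (power phi n) <> 0 ->
  (exists t, nrm (Lam (exponential phi t)) < 1) /\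
  (exists t, 1 < nrm (Lam (exponential phi t))).
Proof.
move=> dphi n0 Ln; have [rho [B [Ar B0 LB]]] := Lam_bounded.
apply: (entire_values (exponential_functional k1 HC Hpi dphi Ar B0 linLam LB) n0).
rewrite exp_jet0_value// => /eqP; rewrite mulf_eq0 invr_eq0 pnatr_eq0.
by rewrite -[n`! == 0%N]negbK -lt0n fact_gt0 => /eqP.
Qed.

Let null (u : nat -> X) : Prop := forall rho e, A%:num < rho -> 0 < e ->
  exists n0, forall n, (n0 <= n)%N -> `[u n]_rho < e.

Let nullD c u v : null u -> null v -> null (fun n => c *: u n + v n).
Proof.
move=> nu nv rho e Ar e0; have e2 : 0 < e / 2 by rewrite divr_gt0.
have c1 : 0 < nrm c + 1 by rewrite ltr_wpDl ?nrm_ge0.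
have [n1 H1] := nu rho _ Ar (divr_gt0 e2 c1); have [n2 H2] := nv rho _ Ar e2.
exists (maxn n1 n2) => n; rewrite geq_max => /andP[/H1 h1 /H2 h2].
rewrite (le_lt_trans (exp_normDZ k1 _ _ _ Ar))// [e]splitr ler_ltD//.
move: h1; rewrite ltr_pdivlMr// mulrDr mulr1 mulrC => h1.
by have := exp_norm_ge0 k1 (u n) Ar; lra.
Qed.

Let null_scale q f : nrm q < 1 -> null (fun n => q ^+ n *: f).
Proof.
move=> q1 rho e Ar e0; have f0 := exp_norm_ge0 k1 f Ar.
have f1 : 0 < `[f]_rho + 1 by rewrite ltr_wpDl.
have [|n0 H] := @expr_small _ (nrm q) (e / (`[f]_rho + 1)) _ (divr_gt0 e0 f1).
  by rewrite nrm_ge0.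
exists n0 => n /H; rewrite ltr_pdivlMr// mulrDr mulr1 => h.
rewrite (le_lt_trans (exp_normZ k1 _ _ Ar))// nrmX (le_lt_trans _ h)// lerDl.
by rewrite exprn_ge0 ?nrm_ge0.
Qed.

(** X0 and Y0 are the vectors with orbits, and with backward orbits, that tend to 0.
   Both are subspaces, so their closures are the whole space once they contain the
   exponentials with eigenvalue of modulus < 1, respectively > 1. *)
Lemma convolution_mixing : mixing L.
Proof.
have [rho [B [Ar B0 LB]]] := Lam_bounded.
pose X0 : set X := [set f | null (fun n => iter n L f)].
pose Y0 : set X := [set f | exists2 z, forall n, iter n L (z n) = f & null z].
have null0 : null (fun=> 0).
  by move=> rho' e Ar' e0; exists 0%N => n _; rewrite exp_norm0.
have cX : closed_subspace (approximable X0).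
  apply: approximable_closed_subspace.
    rewrite /X0 /=; have -> : (fun n => iter n L 0) = fun=> 0.
      by apply/funext => n; exact: (linear_at0 (iter_linear n)).
    exact: null0.
  move=> c f g nf ng; rewrite /X0 /=.
  have -> : (fun n => iter n L (c *: f + g)) = fun n => c *: iter n L f + iter n L g.
    by apply/funext => n; rewrite iter_linear.
  exact: nullD.
have cY : closed_subspace (approximable Y0).
  apply: approximable_closed_subspace.
    by exists (fun=> 0) => // n; exact: (linear_at0 (iter_linear n)).
  move=> c f g [u uf nu] [v vg nv]; exists (fun n => c *: u n + v n).
    by move=> n; rewrite iter_linear uf vg.
  exact: nullD.
have dX f : approximable X0 f.
  apply: (exponentials_total Ar B0 linLam LB (D := [set r | r < 1])) => //.
  - move=> r /= r1; exists (1 - r); first by rewrite subr_gt0.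
    by move=> r'; rewrite ltr_norml => /andP[_]; rewrite ltrBlDr subrK.
  - by move=> phi n dphi n0 /(values dphi n0)[].
  - exact: nontrivial_direction.
  - move=> phi t dphi /= c1; apply: approximable_refl; rewrite /X0 /=.
    have -> : (fun n => iter n L (exponential phi t)) =
        fun n => (Lam (exponential phi t) : R[i]) ^+ n *: exponential phi t.
      by apply/funext => n; rewrite eigen.
    exact: null_scale.
have dY f : approximable Y0 f.
  apply: (exponentials_total Ar B0 linLam LB (D := [set r | 1 < r])) => //.
  - move=> r /= r1; exists (r - 1); first by rewrite subr_gt0.
    by move=> r'; rewrite ltr_norml => /andP[+ _]; rewrite opprB; lra.
  - by move=> phi n dphi n0 /(values dphi n0)[].
  - exact: nontrivial_direction.
  - move=> phi t dphi /= c1; apply: approximable_refl.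
    have c0 : (Lam (exponential phi t) : R[i]) != 0.
      by rewrite -nrm_eq0 gt_eqF// (lt_trans ltr01).
    exists (fun n => (Lam (exponential phi t) : R[i])^-1 ^+ n *: exponential phi t).
      move=> n; rewrite (linear_scale (iter_linear n)) eigen// scalerA.
      by rewrite -exprMn mulVf// expr1n scale1r.
    by apply: null_scale; rewrite nrmV invf_lt1// (lt_trans ltr01).
move=> U W oU oW [x Ux] [y Wy].
have [r1 [e1 [Ar1 e10 H1]]] := exp_open_ball k1 oU Ux.
have [r2 [e2 [Ar2 e20 H2]]] := exp_open_ball k1 oW Wy.
have [x' Xx' xx'] := dX x r1 (e1 / 2) Ar1 (divr_gt0 e10 (ltr0n _ 2)).
have [y' [z zy' nz] yy'] := dY y r2 (e2 / 2) Ar2 (divr_gt0 e20 (ltr0n _ 2)).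
have [n1 N1] := nz r1 (e1 / 2) Ar1 (divr_gt0 e10 (ltr0n _ 2)).
have [n2 N2] := Xx' r2 (e2 / 2) Ar2 (divr_gt0 e20 (ltr0n _ 2)).
exists (maxn n1 n2) => n; rewrite geq_max => /andP[/N1 h1 /N2 h2].
have LD : iter n L (x' + z n) = iter n L x' + y'.
  by rewrite -[x']scale1r iter_linear zy' !scale1r.
exists (iter n L (x' + z n)); split.
  exists (x' + z n) => //; apply: H1; rewrite addrAC.
  apply: le_lt_trans (exp_normD k1 _ _ Ar1) _; rewrite (exp_normC k1 _ _ Ar1).
  by have := ltrD xx' h1; rewrite -splitr.
apply: H2; rewrite LD -addrA; apply: le_lt_trans (exp_normD k1 _ _ Ar2) _.
rewrite [X in _ + X < _](exp_normC k1 _ _ Ar2).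
by have := ltrD h2 yy'; rewrite -splitr.
Qed.

End Mixing.

(** * Completeness and separability *)
Section Completeness.
Variables (R : realType) (E : completeNormedModType R[i]).
Variables (Theta : holomorphy_type E) (k : \bar R) (A : {nonneg R}).
Hypothesis k1 : (1 < k)%E.
Hypothesis HC : canonical_constants Theta.
Local Notation C := (R[i]^o).
Local Notation V := (hspace Theta).
Local Notation N := (hnorm Theta).
Local Notation w := (exp_weight k).
Local Notation X := (exp_space Theta k A).
Local Notation "`[ f ]_ rho" := (exp_norm Theta k rho f)
  (at level 0, rho at level 2, format "`[ f ]_ rho").
Implicit Types (f g : X) (rho e : R).

Lemma exp_taylorB f g j : taylor (f - g : X) 0 j = taylor f 0 j - taylor g 0 j.
Proof.
rewrite addrC -scaleN1r exp_taylorD; last exact: exp_dom0.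
by rewrite scaleN1r addrC.
Qed.

(** The coefficients of a Cauchy sequence converge in the spaces of the type; the
   sequence of the limits is admissible, as weighted sums over j < J pass to the
   limit. *)
Lemma exp_space_complete (F : nat -> X) :
  (forall rho e, A%:num < rho -> 0 < e -> exists n0, forall m n,
    (n0 <= m)%N -> (n0 <= n)%N -> `[F m - F n : X]_rho <= e) ->
  exists f, forall rho e, A%:num < rho -> 0 < e -> exists n0, forall n,
    (n0 <= n)%N -> `[F n - f : X]_rho <= e.
Proof.
move=> FC; pose a n j := taylor (F n) 0 j.
have Va n j : V j (a n j) by exact: exp_coef_hspace.
have A1 : A%:num < A%:num + 1 by rewrite ltrDl.
have lim j : exists P, V j P /\ forall e, 0 < e -> exists n0, forall n,
    (n0 <= n)%N -> N j (a n j - P) < e.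
  have w0 := exp_weight_gt0 k1 j (rho_gt0 A1).
  have [_ _ _ _ cpl] := hspace_banach Theta j.
  have [|e e0|P VP aP] := cpl (fun n => a n j); first by move=> n; exact: Va.
    have e2 : 0 < e / 2 by rewrite divr_gt0.
    have [n0 Hn] := FC _ _ A1 (mulr_gt0 w0 e2); exists n0 => m n hm hn.
    rewrite -exp_taylorB -(ltr_pM2l w0).
    apply: le_lt_trans (exp_coef_le k1 _ j A1) _; apply: le_lt_trans (Hn _ _ hm hn) _.
    by rewrite ltr_pM2l//; lra.
  exists P; split=> // e e0; have /cvgrPdist_lt/(_ e e0)[n0 _ H] := aP.
  exists n0 => n nn; have := H n nn; rewrite /= sub0r normrN.
  by apply: le_lt_trans; rewrite ler_norm.
have [P HP] := choice lim.
have VP j : V j (P j) by have [] := HP j.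
have Vd n j : V j (a n j - P j) by exact: hspace_sub.
have w_ge0 rho j : A%:num < rho -> 0 <= w rho j.
  by move=> Ar; exact: (ltW (exp_weight_gt0 k1 j (rho_gt0 Ar))).
have small rho J e : A%:num < rho -> 0 < e -> exists n0, forall n, (n0 <= n)%N ->
    \sum_(j < J) w rho j * N j (a n j - P j) <= e.
  move=> Ar; elim: J e => [|J IH] e e0.
    by exists 0%N => n _; rewrite big_ord0 ltW.
  have e2 : 0 < e / 2 by rewrite divr_gt0.
  have [n1 H1] := IH _ e2; have [_ HJ] := HP J.
  have w0 := exp_weight_gt0 k1 J (rho_gt0 Ar).
  have [n2 H2] := HJ _ (divr_gt0 e2 w0).
  exists (maxn n1 n2) => n; rewrite geq_max => /andP[/H1 h1 /H2 h2].
  rewrite big_ord_recr /= [leRHS]splitr lerD//.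
  by move: h2; rewrite ltr_pdivlMr// mulrC => /ltW.
have key rho e : A%:num < rho -> 0 < e -> exists n0, forall n, (n0 <= n)%N ->
    forall J, \sum_(j < J) w rho j * N j (a n j - P j) <= e.
  move=> Ar e0; have [n0 Hn] := FC rho e Ar e0; exists n0 => n nn J.
  apply/ler_addgt0Pr => d d0; have [n1 Hm] := small rho J d Ar d0.
  pose m := maxn n0 n1.
  have hm := Hm m (leq_maxr _ _); have hn := Hn n m nn (leq_maxl _ _).
  apply: le_trans (lerD (le_trans (exp_norm_ge_sum k1 _ J Ar) hn) hm).
  rewrite -big_split /=; apply: ler_sum => j _.
  rewrite exp_taylorB -mulrDr ler_wpM2l ?w_ge0//.
  have -> : a n j - P j = (a n j - a m j) + (a m j - P j) by rewrite addrA subrK.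
  exact: (hnormD (hspace_sub (Va n j) (Va m j)) (Vd m j)).
have admP : admissible Theta k A P.
  split=> // rho Ar; have [n0 Hn] := key rho 1 Ar ltr01.
  have [_ /(_ rho Ar)[S HS]] := exp_coefs_admissible k1 (F n0).
  exists (S + 1) => J; apply: le_trans (lerD (HS J) (Hn n0 (leqnn _) J)).
  rewrite -big_split /=; apply: ler_sum => j _.
  rewrite -mulrDr ler_wpM2l ?w_ge0//.
  have {1}-> : P j = a n0 j - (a n0 j - P j) by rewrite opprB addrC subrK.
  exact: (hnormB (Va n0 j) (Vd n0 j)).
have [f [fP _]] := exp_space_of_coefs k1 HC admP.
exists f => rho e Ar e0; have [n0 Hn] := key rho e Ar e0; exists n0 => n nn.
apply: (exp_norm_le k1 Ar) => J; apply: le_trans (Hn n nn J).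
by apply: ler_sum => j _; rewrite exp_taylorB fP.
Qed.

End Completeness.

Section Separability.
Variables (R : realType) (E : completeNormedModType R[i]).
Variables (Theta : holomorphy_type E) (k : \bar R) (A : {nonneg R}).
Hypothesis k1 : (1 < k)%E.
Hypothesis HC : canonical_constants Theta.
Hypothesis Hpi : pi1_holomorphy_type Theta.
Hypothesis Hsep : dual_separable E.
Local Notation C := (R[i]^o).
Local Notation N := (hnorm Theta).
Local Notation w := (exp_weight k).
Local Notation X := (exp_space Theta k A).
Local Notation dual := (@dual R E).
Local Notation power := (power Theta k A).
Local Notation "`[ f ]_ rho" := (exp_norm Theta k rho f)
  (at level 0, rho at level 2, format "`[ f ]_ rho").
Implicit Types (f g : X) (rho e : R) (c t : R[i]) (phi psi : E -> C).

Lemma poly_lipschitz0 (p : {poly R[i]}) : exists2 B : R, 0 <= B &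
  forall t, nrm t <= 1 -> nrm (p.[t] - p.[0]) <= B * nrm t.
Proof.
elim/poly_ind: p => [|p c [B B0 HB]].
  by exists 0 => // t _; rewrite !horner0 subrr nrm0 mul0r.
exists (B + nrm p.[0]); first by rewrite addr_ge0 ?nrm_ge0.
move=> t t1; rewrite !hornerMXaddC mulr0 add0r addrK nrmM.
apply: ler_wpM2r; first exact: nrm_ge0.
rewrite -[p.[t]](subrK p.[0]); apply: le_trans (nrmD _ _) _; rewrite lerD2r.
by apply: le_trans (HB t t1) _; rewrite ler_piMr.
Qed.

Lemma power_norm rho j : A%:num < rho -> exists2 K : R, 0 <= K &
  forall phi, dual phi -> `[power phi j]_rho <= K * dual_norm phi ^+ j.
Proof.
move=> Ar; have [_ [K K0 HK] _] := Hpi.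
have w0 := ltW (exp_weight_gt0 k1 j (rho_gt0 Ar)).
exists (w rho j * K ^+ j); first by rewrite mulr_ge0// exprn_ge0// ltW.
move=> phi dphi.
apply: le_trans (exp_norm_homogeneous k1 HC Ar (hspace_power1 Hpi j dphi)) _.
rewrite -mulrA ler_wpM2l//; have := HK phi 1 j dphi; rewrite nrm1 mulr1.
by congr (N j _ <= _); apply/funext => x; rewrite mul1r.
Qed.

(** phi + s eta interpolates between finitely many phi + i eta, whose powers stay
   in a bounded set when eta is in the unit ball. *)
Lemma power_continuous phi j rho e : dual phi -> A%:num < rho -> 0 < e ->
  exists2 d : R, 0 < d & forall psi, dual psi -> dual_norm (phi - psi) < d ->
    `[power phi j - power psi j : X]_rho < e.
Proof.
move=> dphi Ar e0; have [K K0 HK] := power_norm j Ar.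
have [l lE] := power_interpolation A k1 HC Hpi j (@natr_complex_inj R 0).
have /choice[B HB] : forall i, exists B : R, 0 <= B /\
    forall t, nrm t <= 1 -> nrm ((l i).[t] - (l i).[0]) <= B * nrm t.
  by move=> i; have [B B0 HB] := poly_lipschitz0 (l i); exists B.
pose D i := K * (dual_norm phi + i%:R) ^+ j.
pose S := \sum_(i < j.+1) B i * D i.
have phi0 := dual_norm_ge0 dphi.
have D0 i : 0 <= D i by rewrite mulr_ge0// exprn_ge0// addr_ge0.
have S0 : 0 <= S by apply: sumr_ge0 => i _; rewrite mulr_ge0//; have [] := HB i.
have S1 : 0 < S + 1 by rewrite ltr_wpDl.
pose d := Num.min 1 (e / (S + 1) / 2).
have d0 : 0 < d by rewrite lt_min ltr01 !divr_gt0.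
have d1 : d <= 1 by rewrite ge_min lexx.
exists d => // psi dpsi phipsi.
have dual0 : dual 0.
  have := dual_lin (-1) dphi dphi; by rewrite scaleN1r subrr.
have dsub : dual (phi - psi) by have := dual_lin (-1) dphi dpsi; rewrite scaleN1r.
pose eta := 0 + (- (d^-1)%:C) *: (phi - psi).
have deta : dual eta := dual_lin _ dual0 dsub.
have eta1 : dual_norm eta <= 1.
  apply: le_trans (dual_norm_le _ dual0 dsub) _.
  have -> : dual_norm (0 : E -> C) = 0.
    rewrite /dual_norm (_ : [set _ | _ in _] = [set 0]) ?sup1//.
    apply/seteqP; split=> [_ [x _ <-]|_ ->]; first by rewrite nrm0.
    by exists 0; rewrite /= nrm0.
  rewrite add0r nrmN nrm_real gtr0_norm ?invr_gt0// mulrC ler_pdivrMr// mul1r.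
  exact: ltW.
(* psi is the value at the small parameter d of the line through phi directed by
   eta, which has norm at most 1 *)
have psiE : psi = phi + d%:C *: eta.
  rewrite /eta add0r scalerA mulrN -rmorphM /= divff ?gt_eqF// scaleN1r opprB.
  by rewrite addrC subrK.
have phiE : phi = phi + 0 *: eta by rewrite scale0r addr0.
have dpos : nrm (d%:C : R[i]) = d by rewrite nrm_real gtr0_norm.
have -> : power phi j - power psi j =
    \sum_(i < j.+1) ((l i).[0] - (l i).[d%:C]) *: power (phi + (0 + i)%:R *: eta) j.
  rewrite psiE (lE phi eta d%:C dphi deta) {1}phiE (lE phi eta 0 dphi deta) -sumrB.
  by apply: eq_bigr => i _; rewrite scalerBl.
have norm_sum n (F : 'I_n -> X) : `[\sum_(i < n) F i : X]_rho <= \sum_(i < n) `[F i]_rho.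
  elim: n F => [|n IH] F; first by rewrite !big_ord0 exp_norm0.
  rewrite !big_ord_recr /=; apply: le_trans (exp_normD k1 _ _ Ar) _.
  by rewrite lerD2r.
apply: le_lt_trans (norm_sum _ _) _; apply: (@le_lt_trans _ _ (d * S)).
  rewrite mulr_sumr; apply: ler_sum => i _.
  apply: le_trans (exp_normZ k1 _ _ Ar) _; rewrite mulrA.
  have [Bi0 HBi] := HB i; have := HBi d%:C; rewrite dpos => /(_ d1) h.
  apply: ler_pM; [exact: nrm_ge0|exact: exp_norm_ge0|by rewrite nrmC mulrC|].
  have deta' : dual (phi + (0 + i)%:R *: eta) := dual_lin _ dphi deta.
  apply: le_trans (HK _ deta') _; apply: ler_wpM2l => //.
  apply: lerXn2r; rewrite ?nnegrE ?dual_norm_ge0 ?addr_ge0//.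
  apply: le_trans (dual_norm_le _ dphi deta) _; rewrite lerD2l nrm_nat add0n.
  by rewrite ler_piMr.
have : d <= e / (S + 1) / 2 by rewrite ge_min lexx orbT.
rewrite ler_pdivlMr// ler_pdivlMr// => h; nra.
Qed.

Definition gaussian_rational (p q : rat) : R[i] := (ratr p)%:C + (0 +i* 1) * (ratr q)%:C.

Lemma gaussian_rational_dense c e : 0 < e ->
  exists p q, nrm (c - gaussian_rational p q) < e.
Proof.
move=> e0; have near (a : R) : exists p, `|a - ratr p| < e / 2.
  have [|p] := @rat_in_itvoo R (a - e / 2) (a + e / 2); first by lra.
  rewrite in_itv /= => /andP[h1 h2]; exists p; rewrite ltr_norml; apply/andP; split; lra.
case: c => a b; have [p ap] := near a; have [q bq] := near b; exists p, q.
have -> : (a +i* b) - gaussian_rational p q =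
    (a - ratr p)%:C + (0 +i* 1) * (b - ratr q)%:C.
  by apply/eqP; rewrite eq_complex /=; apply/andP; split; apply/eqP; ring.
apply: le_lt_trans (nrmD _ _) _; rewrite nrmM !nrm_real.
have -> : nrm (0 +i* 1 : R[i]) = 1.
  apply/eqP; rewrite -(@eqrXn2 _ 2) ?nrm_ge0// -nrmX expr1n.
  have -> : (0 +i* 1 : R[i]) ^+ 2 = -1 :> R[i].
    by apply/eqP; rewrite eq_complex /=; apply/andP; split; apply/eqP; ring.
  by rewrite nrmN nrm1.
by rewrite mul1r [e]splitr ltrD.
Qed.

(** The combinations, with Gaussian rational coefficients, of powers of the elements
   of a countable dense set of linear forms are dense: their closure is a closed
   subspace and, by [power_continuous], contains all powers. *)
Lemma exp_space_separable : exists y : nat -> X, forall f rho e,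
  A%:num < rho -> 0 < e -> exists n, `[f - y n : X]_rho < e.
Proof.
have [D [Ddual /countable_injP[inj injD] Ddense]] := Hsep.
have dual0 : dual (0 : E -> C).
  split; first by move=> c u v; rewrite scaler0 addr0.
  by move=> x; exact: cvg_cst.
pose d n : E -> C := xget 0 [set x | D x /\ inj x = n].
have dd n : dual (d n) 
    by rewrite /d; case: xgetP => [x _ [Dx _]|_]; [exact: Ddual|exact: dual0].
have dD psi : D psi -> d (inj psi) = psi.
  move=> Dpsi; rewrite /d; case: xgetP => [x _ [Dx xi]|/(_ psi)/not_andP[]//].
  by apply: injD xi; exact: mem_set.
pose term (u : rat * rat * nat * nat) : X :=
  gaussian_rational u.1.1.1 u.1.1.2 *: power (d u.1.2) u.2.
pose y (s : seq (rat * rat * nat * nat)) : X := \sum_(u <- s) term u.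
pose S : set X := range y.
suff H : forall f, approximable S f.
  exists (fun n => y (odflt [::] (unpickle n))) => f rho e Ar e0.
  have [_ [s _ <-] fs] := H f rho e Ar e0.
  by exists (pickle s); rewrite pickleK.
have SD f g : S f -> S g -> S (f + g).
  by move=> [s _ <-] [s' _ <-]; exists (s ++ s') => //; rewrite /y big_cat.
have SZ p q f : S f -> S (gaussian_rational p q *: f).
  move=> [s _ <-]; elim: s => [|u s [s' _ IH]].
    by exists [::] => //; rewrite /y !big_nil scaler0.
  have [v vE] : exists v, term v = gaussian_rational p q *: term u.
    exists (p * u.1.1.1 - q * u.1.1.2, p * u.1.1.2 + q * u.1.1.1, u.1.2, u.2).
    rewrite /term /= scalerA; congr (_ *: _); rewrite /gaussian_rational.
    rewrite [ratr (_ - _)]rmorphB [ratr (_ + _)]rmorphD !(@rmorphM _ _ (@ratr R)).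
    apply/eqP; rewrite eq_complex /=; apply/andP; split; apply/eqP; ring.
  by exists (v :: s') => //; rewrite /y !big_cons scalerDr -/(y s') IH vE.
apply: (total_powers k1 HC Hpi); last first.
  move=> phi j dphi rho e Ar e0.
  have [delta delta0 Hd] := power_continuous j dphi Ar e0.
  have [psi Dpsi phipsi] := Ddense phi dphi delta delta0.
  exists (power psi j); last exact: (Hd _ (Ddual _ Dpsi) phipsi).
  exists [:: (1, 0, inj psi, j)] => //; rewrite /y big_seq1 /term /= (dD _ Dpsi).
  by rewrite /gaussian_rational rmorph1 rmorph0 mulr0 addr0 scale1r.
split.
- move=> rho e Ar e0; exists 0; last by rewrite subrr exp_norm0.
  by exists [::] => //; rewrite /y big_nil.
- move=> c f g Sf Sg rho e Ar e0; have e3 : 0 < e / 3 by rewrite divr_gt0.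
  have c1 : 0 < nrm c + 1 by rewrite ltr_wpDl ?nrm_ge0.
  have [f' Sf' ff'] := Sf rho _ Ar (divr_gt0 e3 c1).
  have [g' Sg' gg'] := Sg rho _ Ar e3.
  have f0 := exp_norm_ge0 k1 f' Ar.
  have f1 : 0 < `[f']_rho + 1 by rewrite ltr_wpDl.
  have [p [q cq]] := gaussian_rational_dense c (divr_gt0 e3 f1).
  exists (gaussian_rational p q *: f' + g'); first by apply: SD => //; exact: SZ.
  set s := gaussian_rational p q in cq *.
  have -> : c *: f + g - (s *: f' + g') = c *: (f - f') + ((c - s) *: f' + (g - g')).
    rewrite scalerBr scalerBl opprD addrACA [RHS]addrA.
    by rewrite [X in _ = X + _]addrA subrK.
  apply: le_lt_trans (exp_normDZ k1 _ _ _ Ar) _.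
  apply: le_lt_trans (lerD (lexx _) (exp_normDZ k1 _ _ _ Ar)) _.
  have t1 : nrm c * `[f - f' : X]_rho < e / 3.
    move: ff'; rewrite (ltr_pdivlMr _ _ c1) mulrDr mulr1 mulrC => ff'.
    by apply: (le_lt_trans _ ff'); rewrite lerDl; exact: exp_norm_ge0.
  have t2 : nrm (c - s) * `[f']_rho < e / 3.
    move: cq; rewrite (ltr_pdivlMr _ _ f1) mulrDr mulr1 => cq.
    by apply: (le_lt_trans _ cq); rewrite lerDl; exact: nrm_ge0.
  have e_thirds : e / 3 + (e / 3 + e / 3) = e by field.
  by have := ltrD t1 (ltrD t2 gg'); rewrite e_thirds.
- by move=> f; exact: approximable_idem.
Qed.

End Separability.

(** * From mixing to hypercyclicity *)
Section Hypercyclicity.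
Variables (R : realType) (E : completeNormedModType R[i]).
Variables (Theta : holomorphy_type E) (k : \bar R) (A : {nonneg R}).
Hypothesis k1 : (1 < k)%E.
Hypothesis HC : canonical_constants Theta.
Local Notation X := (exp_space Theta k A).
Local Notation "`[ f ]_ rho" := (exp_norm Theta k rho f)
  (at level 0, rho at level 2, format "`[ f ]_ rho").
Implicit Types (f g x : X) (rho e : R).

Let A1 n : A%:num < A%:num + n.+1%:R^-1.
Proof. by rewrite ltrDl invr_gt0 ltr0n. Qed.

Let n1 n : 0 < (n.+1%:R^-1 : R).
Proof. by rewrite invr_gt0 ltr0n. Qed.

Let small e : 0 < e -> exists n, (n.+1%:R^-1 : R) < e.
Proof.
move=> e0; exists (Num.bound e^-1).
rewrite -[ltRHS]invrK ltf_pV2 ?posrE ?invr_gt0 ?ltr0n//.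
by rewrite (lt_trans (archi_boundP _))// ?ltr_nat// invr_ge0 ltW.
Qed.

(** The Baire argument for a mixing map: nested balls whose centers converge to a
   point with an orbit that visits every member of a countable family of balls. *)
Lemma mixing_hypercyclic (L : X -> X) : continuous L -> mixing L ->
  (exists y : nat -> X, forall f rho e, A%:num < rho -> 0 < e ->
    exists n, `[f - y n : X]_rho < e) -> hypercyclic L.
Proof.
move=> cL mixL [y dense_y].
have cLn n : continuous (iter n L).
  elim: n => [|n IH] x; first exact: cvg_id.
  by apply: (@continuous_comp _ _ _ (iter n L) L); [exact: IH|exact: cL].
pose target n : nat * nat := odflt (0, 0)%N (unpickle n).
(* pairing makes every ball of center y i and index l a target *)
pose W n : set X := [set g | `[g - y (target n).1 : X]_(A%:num + (target n).2.+1%:R^-1)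
  < (target n).2.+1%:R^-1].
have oW n : open (W n) := exp_ball_open _ (A1 _) (n1 _).
have W0 n : W n !=set0 by exists (y (target n).1); rewrite /W /= subrr (exp_norm0 _ k1 (A1 _)).
have step (p : nat * (X * (R * R))) : exists q : X * (R * R),
    A%:num < p.2.2.1 -> 0 < p.2.2.2 ->
    [/\ A%:num < q.2.1, 0 < q.2.2, q.2.1 <= A%:num + p.1.+1%:R^-1, q.2.2 <= p.1.+1%:R^-1 &
     forall g, `[g - q.1 : X]_(q.2.1) <= q.2.2 ->
      `[g - p.2.1 : X]_(p.2.2.1) <= p.2.2.2 /\ exists m, W p.1 (iter m L g)].
  case: p => n [x [rho e]] /=.
  have [[Ar e0]|no] := pselect (A%:num < rho /\ 0 < e); last first.
    by exists (x, (rho, e)) => Ar e0; case: no.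
  have oU := exp_ball_open x Ar e0.
  have U0 : [set g : X | `[g - x : X]_rho < e] !=set0.
    by exists x; rewrite /= subrr (exp_norm0 _ k1 Ar).
  have [m Hm] := mixL _ _ oU (oW n) U0 (W0 n).
  have [_ [[f Uf <-] Wf]] := Hm m (leqnn m).
  have oO : open ([set g : X | `[g - x : X]_rho < e] `&` (iter m L @^-1` W n)).
    by apply: openI => //; have /continuousP := cLn m; apply; exact: oW.
  have [rho1 [e1 [Ar1 e10 H1]]] := exp_open_ball k1 oO (conj Uf Wf).
  pose rho' := Num.min rho1 (A%:num + n.+1%:R^-1).
  pose e' := Num.min (e1 / 2) n.+1%:R^-1.
  have Ar' : A%:num < rho' by rewrite lt_min Ar1 A1.
  exists (f, (rho', e')) => _ _ /=; split.
  - exact: Ar'.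
  - by rewrite lt_min n1 andbT divr_gt0.
  - by rewrite ge_min lexx orbT.
  - by rewrite ge_min lexx orbT.
  move=> g gf; have [|/= gU gW] := H1 g; last by split; [exact: ltW|exists m].
  have g1 : `[g - f : X]_rho1 <= `[g - f : X]_rho'.
    by apply: (exp_norm_anti k1 _ Ar'); rewrite ge_min lexx.
  apply: le_lt_trans (le_trans g1 gf) _; rewrite gt_min; apply/orP; left; lra.
have [next Hnext] := choice step.
pose st := fix st n := if n is n'.+1 then next (n', st n') else (0 : X, (A%:num + 1, 1 : R)).
have valid n : A%:num < (st n).2.1 /\ 0 < (st n).2.2.
  elim: n => [|n [IH1 IH2]] /=; first by rewrite ltrDl.
  by have [] := Hnext (n, st n) IH1 IH2.
have HS n := Hnext (n, st n) (valid n).1 (valid n).2.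
pose x n := (st n).1; pose rho n := (st n).2.1; pose e n := (st n).2.2.
have Ar n : A%:num < rho n by have [] := valid n.
have e0 n : 0 < e n by have [] := valid n.
have rho_le n : rho n.+1 <= A%:num + n.+1%:R^-1 by have [] := HS n.
have e_le n : e n.+1 <= n.+1%:R^-1 by have [] := HS n.
have nest n d g : `[g - x (n + d)%N : X]_(rho (n + d)%N) <= e (n + d)%N ->
    `[g - x n : X]_(rho n) <= e n.
  elim: d => [|d IH]; first by rewrite addn0.
  rewrite addnS => H; apply: IH; have [_ _ _ _ Hg] := HS (n + d)%N.
  by have [] := Hg g H.
have center m n : (n <= m)%N -> `[x m - x n : X]_(rho n) <= e n.
  move=> nm; apply: (nest n (m - n)%N); rewrite subnKC// subrr (exp_norm0 _ k1 (Ar _)).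
  exact: ltW.
have [|f Hf] := exp_space_complete k1 HC (F := x).
  move=> r d Ar' d0; have rA : 0 < r - A%:num by rewrite subr_gt0.
  have [p Hp] := small rA.
  have [q Hq] := small (divr_gt0 d0 (ltr0n _ 2)).
  pose n := maxn p q.
  have inv_anti i j : (i <= j)%N -> (j.+1%:R^-1 : R) <= i.+1%:R^-1.
    by move=> ij; rewrite lef_pV2 ?posrE ?ltr0n// ler_nat.
  have en : e n.+1 <= d / 2.
    apply: le_trans (e_le n) _; apply: le_trans (inv_anti q n (leq_maxr _ _)) _.
    exact: ltW.
  have rn : rho n.+1 <= r.
    apply: le_trans (rho_le n) _; rewrite -lerBrDl.
    exact: le_trans (inv_anti p n (leq_maxl _ _)) (ltW Hp).
  exists n.+1 => i j ni nj; apply: le_trans (exp_norm_anti k1 _ (Ar n.+1) rn) _.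
  apply: le_trans (exp_norm_triangle k1 _ (x n.+1) _ (Ar n.+1)) _.
  have h1 := center _ _ ni; have h2 := center _ _ nj.
  rewrite (exp_normC k1 (x n.+1) (x j) (Ar n.+1)).
  apply: le_trans (lerD h1 h2) _; rewrite [leRHS]splitr; exact: (lerD en en).
have fin n : `[f - x n : X]_(rho n) <= e n.
  apply/ler_addgt0Pr => d d0; have [n0 Hn] := Hf (rho n) d (Ar n) d0.
  pose m := maxn n n0.
  apply: le_trans (exp_norm_triangle k1 _ (x m) _ (Ar n)) _.
  have h1 := Hn m (leq_maxr _ _); have h2 := center m n (leq_maxl _ _).
  rewrite (exp_normC k1 f (x m) (Ar n)) [leRHS]addrC; exact: lerD h1 h2.
have visit n : exists m, W n (iter m L f).
  have [_ _ _ _ Hg] := HS n; have [] := Hg f (fin n.+1); by [].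
exists f => O [z Oz] oO.
have [r [d [Ard d0 Hd]]] := exp_open_ball k1 oO Oz.
have rA : 0 < r - A%:num by rewrite subr_gt0.
have [p Hp] := small rA.
have [q Hq] := small (divr_gt0 d0 (ltr0n _ 2)).
pose l := maxn p q.
have inv_anti i : (i <= l)%N -> (l.+1%:R^-1 : R) <= i.+1%:R^-1.
  by move=> ij; rewrite lef_pV2 ?posrE ?ltr0n// ler_nat.
have lp := inv_anti p (leq_maxl _ _); have lq := inv_anti q (leq_maxr _ _).
have [i Hi] := dense_y z _ _ (A1 l) (n1 l).
have rl : A%:num + l.+1%:R^-1 <= r.
  by rewrite -lerBrDl; exact: le_trans lp (ltW Hp).
have close (u : X) : `[u - y i : X]_(A%:num + l.+1%:R^-1) < l.+1%:R^-1 -> O u.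
  move=> Hu; apply: Hd; have h1 := exp_norm_anti k1 (u - z) (A1 l) rl.
  apply: le_lt_trans h1 _.
  apply: le_lt_trans (exp_norm_triangle k1 u (y i) z (A1 l)) _.
  rewrite (exp_normC k1 (y i) z (A1 l)).
  have lt2 := le_lt_trans lq Hq.
  by have := ltrD (lt_trans Hu lt2) (lt_trans Hi lt2); rewrite -splitr.
have [m Hm] := visit (pickle (i, l)); exists (iter m L f); split; last by exists m.
by apply: close; move: Hm; rewrite /W /target pickleK.
Qed.

End Hypercyclicity.

Theorem theorem4p9 (R : realType) (E : completeNormedModType R[i])
  (k : \bar R) (A : {nonneg R}) (Theta : holomorphy_type E) :
  (1 < k)%E ->
  dual_separable E ->
  pi1_holomorphy_type Theta ->
  canonical_constants Theta ->
  forall L : exp_space Theta k A -> exp_space Theta k A,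
    convolution_operator L -> nontrivial_operator L ->
    mixing L /\ hypercyclic L.
Proof.
move=> k1 Hsep Hpi HC L Lconv Lnontriv.
have mixL := convolution_mixing k1 HC Hpi Lconv Lnontriv.
split; first exact: mixL.
have [_ cL _] := Lconv.
apply: (mixing_hypercyclic k1 HC cL mixL).
exact: exp_space_separable k1 HC Hpi Hsep.
Qed.
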